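(* Let $1\le d\le D$ be integers. There exist constants $c_d,c_d',C_d>0$ depending only on $d$ (with $c_d$ and $(c_d')^{-1}$ small enough) such that the following holds. Let $\tau_{\partial,\min}\in(0,\infty)$ and $0<f_{\min}\le f_{\max}<\infty$ satisfy $f_{\min}\le c_d/\tau_{\partial,\min}^d$ and $c_d'/\tau_{\partial,\min}^d\le f_{\max}$. Then for all $n\ge1$, $$\inf_{\hat B}\ \sup_{P\in\mathcal P^{d,D}_{\infty,\tau_{\partial,\min}}(f_{\min},f_{\max})}\mathbb E_{P^n}\bigl[\mathrm d_{\mathrm H}(\partial M,\hat B)\bigr]\ \ge\ C_d\,\tau_{\partial,\min}\left\{1\wedge\left(\frac1{f_{\min}\tau_{\partial,\min}^d\,n}\right)^{\frac2{d+1}}\right\},$$ where $M=\mathrm{supp}(P)$ and the infimum ranges over all estimators $\hat B=\hat B(X_1,\dots,X_n)$ based on an i.i.d. $n$-sample of $P$.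
   Context: A closed $M\subset\mathbb R^D$ is a $d$-dimensional $\mathcal C^2$-submanifold with boundary if for all $p\in M$ and all small enough open neighborhoods $V_p$ of $p$ in $\mathbb R^D$ there are an open neighborhood $U_0$ of $0$ in $\mathbb R^D$ and a $\mathcal C^2$-diffeomorphism $\Psi_p:U_0\to V_p$ with $\Psi_p(0)=p$ such that either $\Psi_p(U_0\cap(\mathbb R^d\times\{0\}^{D-d}))=M\cap V_p$ (interior point), or $\Psi_p(U_0\cap(\mathbb R^{d-1}\times\mathbb R_+\times\{0\}^{D-d}))=M\cap V_p$ (boundary point). The set of boundary points is $\partial M$ (possibly empty). For closed $S\subset\mathbb R^D$, $\mathrm{Med}(S)$ is the set of points of $\mathbb R^D$ having at least two nearest points on $S$; the reach is $\tau_S=\inf_{z\in\mathrm{Med}(S)}\mathrm d(z,S)$ ($+\infty$ if $\mathrm{Med}(S)=\emptyset$; $\tau_\emptyset=\infty$). $S$ is convex if and only if $\tau_S=\infty$. $\mathcal M^{d,D}_{\tau_{\min},\tau_{\partial,\min}}$ is the set of compact connected $d$-dimensional $\mathcal C^2$-submanifolds $M\subset\mathbb R^D$ with (possibly empty) boundary such that $\tau_M\ge\tau_{\min}$ and $\tau_{\partial M}\ge\tau_{\partial,\min}$; here $\tau_{\min}=\infty$, so $M$ is convex and has non-empty boundary. $\mathcal P^{d,D}_{\tau_{\min},\tau_{\partial,\min}}(f_{\min},f_{\max})$ is the set of Borel probability distributions $P$ on $\mathbb R^D$ whose support $M$ belongs to $\mathcal M^{d,D}_{\tau_{\min},\tau_{\partial,\min}}$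 and which have a density $f$ with respect to $\mathbf 1_M\mathcal H^d$ ($\mathcal H^d$ the $d$-dimensional Hausdorff measure) with $f_{\min}\le f(x)\le f_{\max}$ for all $x\in M$. $\mathrm d_{\mathrm H}(S,S')=\max\{\max_{x\in S}\mathrm d(x,S'),\max_{x'\in S'}\mathrm d(x',S)\}$ is the Hausdorff distance between compact subsets of $\mathbb R^D$, with $\mathrm d(z,S)=\min_{x\in S}\|z-x\|$. $a\wedge b=\min(a,b)$. *)

(* Defs.v *)
From HB Require Import structures.
From mathcomp Require Import all_boot all_order all_algebra.
From mathcomp Require Import all_classical all_reals all_analysis.
From mathcomp Require Import measurable_realfun.
Set Implicit Arguments.
Unset Strict Implicit.
Unset Printing Implicit Defensive.
Import Order.TTheory GRing.Theory Num.Theory.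
Import numFieldNormedType.Exports.
Local Open Scope classical_set_scope.
Local Open Scope ring_scope.

(* R^D is 'rV[R]_D. Its library norm is the sup norm: it gives the usual
   topology, hence the usual open and compact sets and derivatives, but every
   metric quantity below is taken with the Euclidean norm [enorm]. *)

Section Metric.
Context {R : realType} {D : nat}.
Local Notation E := 'rV[R]_D.
Implicit Types (x y z : E) (S : set E).

Definition enorm x : R := Num.sqrt (\sum_(i < D) x ord0 i ^+ 2).

(* +oo when S is empty *)
Definition dist_to z S : \bar R :=
  ereal_inf [set (enorm (z - x))%:E | x in S].

Definition medial_axis S : set E :=
  [set z | exists x y, [/\ S x, S y, x <> y,
     (enorm (z - x))%:E = dist_to z S & (enorm (z - y))%:E = dist_to z S]].

(* +oo when the medial axis is empty *)
Definition reach S : \bar R :=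
  ereal_inf [set dist_to z S | z in medial_axis S].

(* For nonempty S it is +oo when S' is empty; two empty sets are outside its
   intended domain. *)
Definition hausdorff_dist S S' : \bar R :=
  maxe (ereal_sup [set dist_to x S' | x in S])
       (ereal_sup [set dist_to x S | x in S']).

End Metric.

Section HausdorffMeasure.
Context {R : realType} {D : nat}.
Local Notation E := 'rV[R]_D.
Local Open Scope ereal_scope.

(* Lebesgue volume of the Euclidean unit ball of R^n, by the recursion
   omega_(n+2) = (2 pi / (n+2)) omega_n. *)
Fixpoint unit_ball_volume (n : nat) : R :=
  match n with
  | 0 => 1%R
  | 1 => 2%R
  | S (S m) => (2 * pi / m.+2%:R * unit_ball_volume m)%R
  end.

(* the maximum with 0 makes the diameter of the empty set 0 *)
Definition diameter (A : set E) : \bar R :=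
  maxe 0 (ereal_sup [set (enorm (xy.1 - xy.2))%:E | xy in A `*` A]).

Definition covering_of (A : set E) (delta : R) (F : nat -> set E) : Prop :=
  A `<=` \bigcup_i F i /\ forall i, diameter (F i) <= delta%:E.

(* Normalised so that it is Lebesgue measure when k = D. For k = 0 the empty
   pieces of a covering would count for 0 ^ 0 = 1: only meant for k >= 1. *)
Definition hausdorff_measure (k : nat) (A : set E) : \bar R :=
  ereal_sup [set
    ereal_inf [set \sum_(0 <= i <oo)
        (unit_ball_volume k / 2 ^+ k)%:E * diameter (F i) ^+ k
      | F in covering_of A delta]
    | delta in [set delta : R | (0 < delta)%R]].

End HausdorffMeasure.

Section Submanifold.
Context {R : realType} {D : nat}.
Local Notation E := 'rV[R]_D.
Implicit Types (U V : set E) (M : set E) (p : E).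

(* f is of class C^k on the open set U *)
Fixpoint C_on (k : nat) U (f : E -> E) : Prop :=
  match k with
  | 0 => forall x, U x -> {for x, continuous f}
  | k'.+1 => (forall x, U x -> differentiable f x) /\
             (forall v : E, C_on k' U (fun x => 'D_v f x))
  end.

Definition C2_diffeo U V (psi : E -> E) : Prop :=
  exists phi : E -> E,
    [/\ set_fun U V psi, set_fun V U phi,
        (forall x, U x -> phi (psi x) = x) &
        (forall y, V y -> psi (phi y) = y)] /\
    C_on 2 U psi /\ C_on 2 V phi.

(* R^d x {0}^(D-d) *)
Definition flat (d : nat) : set E :=
  [set x | forall i : 'I_D, (d <= i)%N -> x ord0 i = 0].

(* R^(d-1) x R_+ x {0}^(D-d): the d-th coordinate has index d - 1 *)
Definition half_flat (d : nat) : set E :=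
  [set x | flat d x /\ forall i : 'I_D, i.+1 = d -> 0 <= x ord0 i].

Definition chart (model : set E) M p V : Prop :=
  exists (U0 : set E) (psi : E -> E),
    [/\ open_nbhs (0 : E) U0, C2_diffeo U0 V psi, psi 0 = p &
        psi @` (U0 `&` model) = M `&` V].

Definition for_small_open_nbhs p (Q : set E -> Prop) : Prop :=
  exists W, open_nbhs p W /\
    forall V, open_nbhs p V -> V `<=` W -> Q V.

Definition C2_submanifold (d : nat) M : Prop :=
  closed M /\
  forall p, M p -> for_small_open_nbhs p
    (fun V => chart (flat d) M p V \/ chart (half_flat d) M p V).

Definition mboundary (d : nat) M : set E :=
  [set p | M p /\ for_small_open_nbhs p (chart (half_flat d) M p)].

Definition manifold_class (d : nat) (tau_min tau_bmin : \bar R) : set (set E) :=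
  [set M | [/\ compact M, connected M, C2_submanifold d M,
     (tau_min <= reach M)%E & (tau_bmin <= reach (mboundary d M))%E]].

End Submanifold.

(* R^D with its Borel sigma-algebra *)
Definition borel_rV (R : realType) (D : nat) :=
  g_sigma_algebraType (@open 'rV[R]_D).

Section Model.
Context {R : realType} {D : nat}.
Local Open Scope ereal_scope.

Definition msupport (P : probability (borel_rV R D) R) : set 'rV[R]_D :=
  [set x | forall U : set 'rV[R]_D, open_nbhs x U -> 0 < P U].

Definition has_density_on (d : nat) (P : probability (borel_rV R D) R)
    (M : set 'rV[R]_D) (f : borel_rV R D -> R) : Prop :=
  measurable_fun setT f /\
  forall A : set (borel_rV R D), measurable A ->
    P A = \int[hausdorff_measure d : set (borel_rV R D) -> \bar R]_(x in A `&` M) (f x)%:E.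

Definition dist_class (d : nat) (tau_min tau_bmin : \bar R) (fmin fmax : R) :
    set (probability (borel_rV R D) R) :=
  [set P | manifold_class d tau_min tau_bmin (msupport P) /\
    exists f : borel_rV R D -> R, has_density_on d P (msupport P) f /\
      forall x, msupport P x -> (fmin <= f x <= fmax)%R].

End Model.

Section ProductPower.
Context {d : measure_display} {T : measurableType d} {R : realType}.

Definition tcons (n : nat) (xs : T * n.-tuple T) : n.+1.-tuple T :=
  [tuple of xs.1 :: xs.2].

Lemma measurable_tcons n : measurable_fun setT (@tcons n).
Proof. exact: measurable_cons. Qed.

HB.instance Definition _ n :=
  isMeasurableFun.Build _ _ _ _ (@tcons n) (@measurable_tcons n).

(* the law P^n of an i.i.d. n-sample of P *)
Fixpoint iid_law (P : probability T R) (n : nat) : probability (n.-tuple T) R :=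
  match n return probability (n.-tuple T) R with
  | 0 => [the probability _ R of dirac ([tuple] : 0.-tuple T)]
  | n'.+1 => [the probability _ R of
               distribution [the probability _ R of (P \x iid_law P n')%E]
                 [the {mfun _ >-> _} of @tcons n']]
  end.

End ProductPower.

Section Estimator.
Context {R : realType} {D : nat}.

(* Set-valued estimators: compact-valued maps of the sample that are Borel
   for the Hausdorff distance, i.e. whose distance to each fixed compact set
   is a measurable function of the sample. *)
Definition set_estimator (n : nat) :
    set (n.-tuple (borel_rV R D) -> set 'rV[R]_D) :=
  [set B : n.-tuple (borel_rV R D) -> set 'rV[R]_D |
    (forall s, compact (B s)) /\
    forall K : set 'rV[R]_D, compact K -> K !=set0 ->
      measurable_fun [set: n.-tuple (borel_rV R D)]
        (fun s => hausdorff_dist K (B s) : \bar R)].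

Definition boundary_risk (d n : nat) (P : probability (borel_rV R D) R)
    (B : n.-tuple (borel_rV R D) -> set 'rV[R]_D) : \bar R :=
  (\int[iid_law P n]_s hausdorff_dist (mboundary d (msupport P)) (B s))%E.

Definition minimax_risk (d n : nat)
    (model : set (probability (borel_rV R D) R)) : \bar R :=
  ereal_inf [set ereal_sup [set boundary_risk d P B | P in model]
            | B in @set_estimator n].

End Estimator.

(* Main.v *)
From HB Require Import structures.
Require Import Defs.
From mathcomp Require Import all_boot all_order all_algebra.
From mathcomp Require Import all_classical all_reals all_analysis.
From mathcomp Require Import measurable_realfun ring lra.
Import Order.TTheory GRing.Theory Num.Theory.
Import numFieldNormedType.Exports.
Local Open Scope classical_set_scope.
Local Open Scope ring_scope.

(** The bound is Le Cam's two point bound, for two laws carried by convex bodies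
   of dimension [d] that differ only in two small caps.

   The bodies. Take a ball of radius [r = 4 tau] in the flat space R^d and
   translate each line parallel to a fixed axis by [- eps * (1 - s)_+ ^ 3],
   where [s] is the squared distance of the line to the axis divided by
   [rho ^ 2]. The result is [body eps], with boundary [rim eps];
   [body (- eps)] is its mirror image. The cubic profile makes the translation
   of class C^2, so [body eps] is the image of a ball under a C^2 shear: an
   inversion with pole at the antipodal point straightens the boundary of the
   ball, which gives the boundary charts ([chart_rim]), and no interior point
   has such a chart ([flat_no_half_chart]). Since [eps] is at most
   [rho ^ 2 / (100 * r)], the second derivatives of the bump are much smaller
   than the curvature of the sphere, and the function [level] defining the body
   by [level <= r ^ 2] keeps a Hessian between 0 and 4 ([level_taylor]). The
   lower bound gives convexity, hence an infinite reach; the upper bound and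
   the size of the gradient on the rim give [r / 4 <= reach rim]
   ([rim_reach]).

   The laws. The density is [fmin] on the body, raised on a cube around the
   centre so that the total mass is 1. By the mirror symmetry both bodies have
   the same volume, so that both densities agree where the bodies overlap. The
   bodies differ in a cap of width [rho] and height of order [rho ^ 2 / r]
   ([body_gap]), so the laws share all their mass but [q], of order
   [fmin * rho ^ (d + 1) / r]. The common part of the two laws of an
   [n]-sample has mass at least [(1 - q) ^ n], which is at least one half when
   [rho ^ (d + 1)] is a small multiple of [r / (fmin * n)]. On that common part
   no estimator can be close to both rims, which are at distance at least
   [eps] ([tip_far]), and [eps] is of order [rho ^ 2 / r]: this is the rate.

   Volumes are Hausdorff measures, of which four properties are used: Borel
   additivity ([hausdorff_semi_sigma_additive]), from the additivity over sets
   at positive distance; an upper bound for boxes ([hausdorff_box_le]); a lower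
   bound for cubes ([hausdorff_cube_ge]), by counting grid points; and the
   invariance under reflections ([hausdorff_measure_isometry]). The estimates
   concern flat boxes only, which makes the constants independent of the
   ambient dimension. *)

Set Implicit Arguments.
Unset Strict Implicit.
Unset Printing Implicit Defensive.

(** * Euclidean geometry of row vectors *)

Section dot_product.
Context {R : realType} {D : nat}.
Local Notation E := 'rV[R]_D.
Implicit Types (x y z : E) (a : R).

Definition dot x y : R := \sum_(i < D) x ord0 i * y ord0 i.

Lemma dotC x y : dot x y = dot y x.
Proof. by apply: eq_bigr => i _; rewrite mulrC. Qed.

Lemma dotDl x y z : dot (x + y) z = dot x z + dot y z.
Proof. by rewrite -big_split/=; apply: eq_bigr => i _; rewrite !mxE mulrDl. Qed.

Lemma dotZl a x y : dot (a *: x) y = a * dot x y.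
Proof. by rewrite mulr_sumr; apply: eq_bigr => i _; rewrite !mxE mulrA. Qed.

Lemma dotNl x y : dot (- x) y = - dot x y.
Proof. by rewrite -scaleN1r dotZl mulN1r. Qed.

Lemma dotBl x y z : dot (x - y) z = dot x z - dot y z.
Proof. by rewrite dotDl dotNl. Qed.

Lemma dotDr x y z : dot x (y + z) = dot x y + dot x z.
Proof. by rewrite dotC dotDl !(dotC x). Qed.

Lemma dotZr a x y : dot x (a *: y) = a * dot x y.
Proof. by rewrite dotC dotZl dotC. Qed.

Lemma dotNr x y : dot x (- y) = - dot x y.
Proof. by rewrite dotC dotNl dotC. Qed.

Lemma dotBr x y z : dot x (y - z) = dot x y - dot x z.
Proof. by rewrite dotDr dotNr. Qed.

Lemma dot0l x : dot 0 x = 0.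
Proof. by rewrite -(scale0r 0) dotZl mul0r. Qed.

Lemma dot0r x : dot x 0 = 0.
Proof. by rewrite dotC dot0l. Qed.

Lemma dot_ge0 x : 0 <= dot x x.
Proof. by apply: sumr_ge0 => i _; rewrite -expr2 sqr_ge0. Qed.

Lemma sqr_coord_le_dot x i : x ord0 i ^+ 2 <= dot x x.
Proof.
rewrite /dot (bigD1 i)//= -expr2 lerDl; apply: sumr_ge0 => j _.
by rewrite -expr2 sqr_ge0.
Qed.

Lemma dot_eq0 x : dot x x = 0 -> x = 0.
Proof.
move=> x0; apply/rowP => i; rewrite mxE; apply/eqP.
by rewrite -sqrf_eq0 eq_le sqr_ge0 andbT -x0 sqr_coord_le_dot.
Qed.

Lemma dot_gt0 x : x != 0 -> 0 < dot x x.
Proof.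
move=> x0; rewrite lt_neqAle dot_ge0 andbT eq_sym.
by apply: contra x0 => /eqP/dot_eq0 ->.
Qed.

Lemma enormE x : enorm x = Num.sqrt (dot x x).
Proof. by congr Num.sqrt; apply: eq_bigr => i _; rewrite expr2. Qed.

Lemma enorm_ge0 x : 0 <= enorm x.
Proof. exact: sqrtr_ge0. Qed.

Lemma sqr_enorm x : enorm x ^+ 2 = dot x x.
Proof. by rewrite enormE sqr_sqrtr// dot_ge0. Qed.

Lemma enorm0 : enorm (0 : E) = 0.
Proof. by rewrite enormE dot0l sqrtr0. Qed.

Lemma enorm_le x a : 0 <= a -> (enorm x <= a) = (dot x x <= a ^+ 2).
Proof. by move=> a0; rewrite -sqr_enorm ler_sqr ?nnegrE ?enorm_ge0. Qed.

Lemma enorm_ge x a : 0 <= a -> (a <= enorm x) = (a ^+ 2 <= dot x x).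
Proof. by move=> a0; rewrite -sqr_enorm ler_sqr ?nnegrE ?enorm_ge0. Qed.

Lemma enormZ a x : enorm (a *: x) = `|a| * enorm x.
Proof.
by rewrite !enormE dotZl dotZr mulrA -expr2 sqrtrM ?sqr_ge0// sqrtr_sqr.
Qed.

Lemma enormN x : enorm (- x) = enorm x.
Proof. by rewrite !enormE dotNl dotNr opprK. Qed.

Lemma enormB x y : enorm (x - y) = enorm (y - x).
Proof. by rewrite -opprB enormN. Qed.

Lemma coord_le_enorm x i : `|x ord0 i| <= enorm x.
Proof. by rewrite enorm_ge// real_normK ?num_real ?sqr_coord_le_dot. Qed.

Lemma dot_le_enorm x y : dot x y <= enorm x * enorm y.
Proof.
have [->|y0] := eqVneq y 0; first by rewrite dot0r enorm0 mulr0.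
have yy := dot_gt0 y0.
have : 0 <= dot (x - (dot x y / dot y y) *: y) (x - (dot x y / dot y y) *: y).
  exact: dot_ge0.
rewrite !(dotBl, dotBr, dotZl, dotZr) (dotC y x) => h.
have {h} : dot x y ^+ 2 <= dot x x * dot y y.
  rewrite -subr_ge0; move: (mulr_ge0 (ltW yy) h).
  set p := dot x y; set q := dot y y in yy *; set r := dot x x.
  have q0 : q != 0 by rewrite gt_eqF.
  rewrite [X in 0 <= X -> _](_ : _ = r * q - p ^+ 2)//.
  by rewrite /r; field.
rewrite -!sqr_enorm -exprMn => h.
apply: (le_trans (ler_norm _)); rewrite -ler_sqr ?nnegrE ?mulr_ge0 ?enorm_ge0//.
by rewrite real_normK ?num_real.
Qed.

Lemma ler_enormD x y : enorm (x + y) <= enorm x + enorm y.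
Proof.
rewrite enorm_le ?addr_ge0 ?enorm_ge0// !(dotDl, dotDr) sqrrD !sqr_enorm.
by rewrite (dotC y x); have := dot_le_enorm x y; lra.
Qed.

Lemma ler_enorm_distD z x y : enorm (x - y) <= enorm (x - z) + enorm (z - y).
Proof. by rewrite -[in leLHS](subrKA z) ler_enormD. Qed.

Lemma norm_le_enorm x : `|x| <= enorm x.
Proof.
rewrite [`|x|]mx_normrE; apply/bigmax_leP; split => [|[i j] _ /=].
  exact: enorm_ge0.
by rewrite (ord1 i) coord_le_enorm.
Qed.

Lemma coord_le_norm x i : `|x ord0 i| <= `|x|.
Proof.
rewrite [leRHS]mx_normrE.
exact: (le_bigmax _ (fun ij : 'I_1 * 'I_D => `|x ij.1 ij.2|) (ord0, i)).
Qed.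

Lemma dist_to_le z x (S : set E) : S x -> (dist_to z S <= (enorm (z - x))%:E)%E.
Proof. by move=> Sx; apply: ereal_inf_lbound; exists x. Qed.

End dot_product.

Section flat_vectors.
Context {R : realType} {D d : nat}.
Implicit Types x y : 'rV[R]_D.

Lemma flatZ a x : flat d x -> flat d (a *: x).
Proof. by move=> fx i di; rewrite mxE fx// mulr0. Qed.

Lemma flatD x y : flat d x -> flat d y -> flat d (x + y).
Proof. by move=> fx fy i di; rewrite mxE fx// fy// addr0. Qed.

Lemma flat_sub x y : flat d x -> flat d y -> flat d (x - y).
Proof. by move=> fx fy i di; rewrite !mxE fx// fy// subr0. Qed.

End flat_vectors.

(** * Sets measurable for a separating function *)

(** Outside [f <= 0], the set where [f] is at least [1 / (n + 1)] is separated
   from [f <= 0], and what remains is a union of layers. Layers of the same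
   parity are separated from each other, so the measures of the layers have a
   finite sum, and the measure of what remains tends to 0. *)
Lemma caratheodory_separated (R : realType) (T : Type)
    (mu : {outer_measure set T -> \bar R}) (f : T -> R) :
  (forall (A B : set T) (a b : R), a < b -> (forall x, A x -> f x <= a) ->
     (forall x, B x -> b <= f x) -> (mu A + mu B <= mu (A `|` B))%E) ->
  mu.-caratheodory [set x | f x <= 0].
Proof.
move=> sep; apply: le_caratheodory_measurable => X.
set C := [set x | f x <= 0].
have mu_ge0 Y : (0 <= mu Y)%E by exact: outer_measure_ge0.
have [Xoo|Xfin] := eqVneq (mu X) +oo%E; first by rewrite Xoo leey.
pose h n : R := n.+1%:R^-1.
have h_gt0 n : 0 < h n by rewrite invr_gt0.
have h_le m n : (m <= n)%N -> h n <= h m.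
  by move=> mn; rewrite lef_pV2 ?posrE// ler_nat.
have h_lt m n : (m < n)%N -> h n < h m.
  by move=> mn; rewrite ltf_pV2 ?posrE// ltr_nat.
pose A n := X `&` [set x | h n <= f x].
pose Q n := X `&` [set x | h n.+1 <= f x < h n].
have muXfin : mu X \is a fin_num.
  by rewrite ge0_fin_numE ?outer_measure_ge0// lt_neqAle Xfin leey.
(* the layers of one parity are pairwise separated *)
have layers p N : (\sum_(k < N) mu (Q (k.*2 + p)%N) <= mu X)%E.
  suff : (\sum_(k < N) mu (Q (k.*2 + p)%N) <=
      mu (\bigcup_(k < N) Q (k.*2 + p)%N))%E.
    move=> /le_trans; apply; apply: le_outer_measure.
    by move=> x [k _ []].
  elim: N => [|N IH]; first by rewrite big_ord0 outer_measure_ge0.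
  rewrite big_ord_recr/=.
  apply: (le_trans (leeD2r _ IH)); rewrite addeC.
  case: N {IH} => [|N].
    rewrite II0 bigcup_set0 outer_measure0 adde0.
    by apply: le_outer_measure => x QN; exists 0%N.
  apply: (le_trans (sep _ _ (h (N.+1.*2 + p)%N) (h (N.*2 + p).+1) _ _ _)).
  - by apply: h_lt; rewrite doubleS.
  - by move=> x [_ /andP[_ /ltW]].
  - move=> x [k /= kN [_ /andP[+ _]]]; apply: le_trans; apply: h_le.
    by rewrite ltnS leq_add2r leq_double -ltnS.
  - apply: le_outer_measure => x [QN|[k /= kN Qk]]; first by exists N.+1 => //=.
    by exists k => //=; exact: ltn_trans kN _.
have Qsum : (\sum_(k <oo) mu (Q k) <= mu X + mu X)%E.
  apply: lime_le; first exact: is_cvg_nneseries.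
  near=> N; apply: (@le_trans _ _ (\sum_(0 <= k < N.*2) mu (Q k))%E).
    rewrite [leRHS](big_cat_nat (n := N)) //=; last first.
      by rewrite -addnn leq_addr.
    by rewrite leeDl// sume_ge0.
  have -> : (\sum_(0 <= k < N.*2) mu (Q k) =
      \sum_(k < N) mu (Q (k.*2 + 0)%N) + \sum_(k < N) mu (Q (k.*2 + 1)%N))%E.
    elim: (N) => [|m IH]; first by rewrite !big_ord0 big_geq// adde0.
    rewrite doubleS !big_nat_recr//= IH !big_ord_recr/= !addn0 addn1.
    by rewrite -!addeA; congr (_ + _)%E; rewrite addeCA.
  by rewrite leeD.
have tail0 : (\sum_(n <= k <oo) mu (Q k))%E @[n --> \oo] --> 0%E.
  apply: nneseries_tail_cvg => //.
  by rewrite (le_lt_trans Qsum)// -ge0_fin_numE ?fin_numD ?muXfin// adde_ge0.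
have XCA n : (mu (X `&` C) + mu (A n) <= mu X)%E.
  apply: (le_trans (sep _ _ 0 (h n) _ _ _)) => //.
  - by move=> x [].
  - by move=> x [].
  - by apply: le_outer_measure => x [[]|[]].
have AX n : (mu (X `&` ~` C) <= mu (A n) + \sum_(n <= k <oo) mu (Q k))%E.
  have XF : X `&` ~` C `<=` A n `|` \bigcup_(k in ~` `I_n) Q k.
    move=> x [Xx /negP]; rewrite -ltNge => fx.
    have [hf|fh] := leP (h n) (f x); first by left; split.
    right.
    have [m hm] : exists m, h m <= f x.
      exists (Num.bound (f x)^-1); rewrite /h invf_ple ?posrE// ltW//.
      rewrite (lt_trans (archi_boundP _)) ?invr_ge0 ?ltW// ltr_nat//.
    have [m' + mmin] := ex_minnP (ex_intro (fun m => h m <= f x) _ hm).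
    case: m' mmin => [|m'] mmin hm'.
      by have := le_lt_trans hm' (lt_le_trans fh (h_le 0 n (leq0n _))); rewrite ltxx.
    exists m'; rewrite /= ?/setC /=.
      apply/negP; rewrite -leqNgt -ltnS; rewrite ltnNge; apply/negP => m'n.
      by have := le_lt_trans hm' (lt_le_trans fh (h_le _ _ m'n)); rewrite ltxx.
    split => //=; rewrite hm'/= ltNge; apply/negP => /mmin; by rewrite ltnn.
  apply: (le_trans (le_outer_measure mu _ _ XF)).
  apply: (le_trans (outer_measureU2 _ _ _)); rewrite leeD2l//.
  exact: outer_measure_sigma_subadditive_tail.
have lim0 : (mu X + \sum_(n <= k <oo) mu (Q k))%E @[n --> \oo] --> (mu X + 0)%E.
  by apply: cvgeD => //; [rewrite fin_num_adde_defr | exact: cvg_cst].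
rewrite -[leRHS]adde0 -(cvg_lim _ lim0)//; apply: lime_ge.
  by apply/cvg_ex; exists (mu X + 0)%E.
near=> n; apply: (le_trans (leeD2l _ (AX n))).
by rewrite addeA leeD2r.
Unshelve. all: by end_near.
Qed.

(** * Hausdorff measure is a Borel measure *)

Section hausdorff_outer.
Context {R : realType} {D : nat} (k : nat).
Local Notation E := 'rV[R]_D.
Local Open Scope ereal_scope.

Lemma unit_ball_volume_gt0 n : (0 < @unit_ball_volume R n)%R.
Proof.
suff : (0 < @unit_ball_volume R n)%R /\ (0 < @unit_ball_volume R n.+1)%R by case.
elim: n => [|n [h1 h2]]; first by split => //=; rewrite ltr0n.
split => //=; rewrite mulr_gt0// divr_gt0 ?ltr0n// mulr_gt0 ?pi_gt0//.
Qed.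

Lemma diameter_ge0 (A : set E) : 0 <= diameter A.
Proof. by rewrite /diameter le_max lexx. Qed.

Lemma diameter0 : diameter (set0 : set E) = 0.
Proof.
rewrite /diameter (_ : [set _ | xy in _] = set0) ?ereal_sup0 ?maxEge ?leNye//.
by rewrite -subset0 => x [[? ?] []].
Qed.

Lemma diameter_le (A : set E) (e : R) : (0 <= e)%R ->
  (forall x y, A x -> A y -> (enorm (x - y) <= e)%R) -> diameter A <= e%:E.
Proof.
move=> e0 Ae; rewrite /diameter ge_max lee_fin e0/=.
by apply: ge_ereal_sup => _ [[x y] [Ax Ay] <-]; rewrite lee_fin Ae.
Qed.

Lemma enorm_diameter (A : set E) x y : A x -> A y ->
  (enorm (x - y))%:E <= diameter A.
Proof.
move=> Ax Ay; rewrite /diameter le_max; apply/orP; right.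
by apply: ereal_sup_ubound; exists (x, y).
Qed.

Local Notation c := (unit_ball_volume k.+1 / 2 ^+ k.+1 : R)%R.

(** Giving an infinite weight to the sets of diameter larger than [delta]
   turns coverings by small sets into arbitrary coverings, so that the
   generic extension of a set function applies. *)
Definition small_weight (delta : R) (A : set E) : \bar R :=
  if diameter A <= delta%:E then c%:E * diameter A ^+ k.+1 else +oo.

Lemma c_gt0 : (0 < c)%R.
Proof. by rewrite divr_gt0 ?unit_ball_volume_gt0// exprn_gt0. Qed.

Lemma c_diam_ge0 (A : set E) : 0 <= c%:E * diameter A ^+ k.+1.
Proof. by rewrite mule_ge0 ?lee_fin ?(ltW c_gt0)// expe_ge0// diameter_ge0. Qed.

Lemma small_weight_ge0 delta A : 0 <= small_weight delta A.
Proof.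
rewrite /small_weight; case: ifPn => // _; exact: c_diam_ge0.
Qed.

Lemma small_weight0 delta : (0 < delta)%R -> small_weight delta set0 = 0.
Proof.
move=> d0; rewrite /small_weight diameter0 lee_fin ltW//.
by rewrite expeS mul0e mule0.
Qed.

(** The space with all its subsets measurable: every covering is then a
   measurable covering. *)
Definition discrete_copy : Type := E.
HB.instance Definition _ := Pointed.on discrete_copy.
HB.instance Definition _ := @isMeasurable.Build default_measure_display
  discrete_copy discrete_measurable discrete_measurable0
  discrete_measurableC discrete_measurableU.

Definition hausdorff_pre (delta : R) (A : set E) : \bar R :=
  mu_ext (small_weight delta : set discrete_copy -> \bar R) A.

Lemma hausdorff_preE delta A :
  ereal_inf [set \sum_(0 <= i <oo) c%:E * diameter (F i) ^+ k.+1
            | F in covering_of A delta] = hausdorff_pre delta A.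
Proof.
apply/eqP; rewrite eq_le; apply/andP; split.
  apply: le_ereal_inf_tmp => _ [F [_ AF] <-].
  have [[i Fi]|small] := pselect (exists i, small_weight delta (F i) = +oo).
    rewrite (eseries_pinfty _ _ Fi) ?leey// => n _.
    by rewrite -ltNye (lt_le_trans _ (small_weight_ge0 _ _)).
  apply: ereal_inf_lbound; exists F; last first.
    apply: eq_eseriesr => i _; rewrite /small_weight; case: ifPn => // Fi.
    by exfalso; apply: small; exists i; rewrite /small_weight (negbTE Fi).
  split => // i; apply: contrapT => /negP Fi.
  by apply: small; exists i; rewrite /small_weight (negbTE Fi).
apply: le_ereal_inf_tmp => _ [F [AF Fd] <-]; apply: ereal_inf_lbound.
exists F; first by split.
by apply: eq_eseriesr => i _; rewrite /small_weight Fd.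
Qed.

Lemma hausdorff_measureE A : hausdorff_measure k.+1 A =
  ereal_sup [set hausdorff_pre delta A | delta in [set delta : R | (0 < delta)%R]].
Proof.
rewrite /hausdorff_measure; congr ereal_sup; apply/seteqP.
split => _ [d /= d0 <-]; exists d => //; rewrite ?hausdorff_preE//.
Qed.

Lemma hausdorff_pre_le delta A : (0 < delta)%R ->
  hausdorff_pre delta A <= hausdorff_measure k.+1 A.
Proof.
by move=> d0; rewrite hausdorff_measureE; apply: ereal_sup_ubound; exists delta.
Qed.

Lemma hausdorff_pre_anti delta delta' A : (delta <= delta')%R ->
  hausdorff_pre delta' A <= hausdorff_pre delta A.
Proof.
move=> dd'; rewrite -!hausdorff_preE; apply: le_ereal_inf => _ [F [AF Fd] <-].
by exists F => //; split => // i; rewrite (le_trans (Fd i)) ?lee_fin.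
Qed.

Lemma hausdorff_measure0 : hausdorff_measure k.+1 (set0 : set E) = 0.
Proof.
rewrite hausdorff_measureE; apply/eqP; rewrite eq_le; apply/andP; split.
  apply: ge_ereal_sup => _ [d d0 <-]; rewrite /hausdorff_pre mu_ext0//.
  - exact: small_weight0.
  - exact: small_weight_ge0.
apply: ereal_sup_ubound; exists 1%R => /=; first exact: ltr01.
rewrite /hausdorff_pre mu_ext0//; [exact: small_weight0|exact: small_weight_ge0].
Qed.

Lemma hausdorff_measure_ge0 (A : set E) : 0 <= hausdorff_measure k.+1 A.
Proof.
apply: (le_trans _ (hausdorff_pre_le A ltr01)); apply: mu_ext_ge0 => X.
exact: small_weight_ge0.
Qed.

Lemma le_hausdorff_measure :
  {homo (@hausdorff_measure R D k.+1) : A B / A `<=` B >-> A <= B}.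
Proof.
move=> A B AB; rewrite !hausdorff_measureE; apply: ge_ereal_sup => _ [d d0 <-].
apply: (@le_trans _ _ (hausdorff_pre d B)); first exact: le_mu_ext.
by apply: ereal_sup_ubound; exists d.
Qed.

Lemma hausdorff_measure_sigma_subadditive :
  sigma_subadditive (@hausdorff_measure R D k.+1).
Proof.
move=> F; rewrite {1}hausdorff_measureE; apply: ge_ereal_sup => _ [d d0 <-].
apply: (le_trans (mu_ext_sigma_subadditive _ _)); first exact: small_weight_ge0.
apply: lee_nneseries => i _.
  by move=> _; apply: mu_ext_ge0 => X; exact: small_weight_ge0.
exact: hausdorff_pre_le.
Qed.

HB.instance Definition _ := isOuterMeasure.Build R E
  (@hausdorff_measure R D k.+1) hausdorff_measure0 hausdorff_measure_ge0
  le_hausdorff_measure hausdorff_measure_sigma_subadditive.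

(** A set of diameter smaller than the gap between [A] and [B] cannot meet
   both, so a fine covering of the union splits into two coverings. *)
Lemma hausdorff_measure_separated (A B : set E) (e : R) : (0 < e)%R ->
  (forall a b, A a -> B b -> (e <= enorm (a - b))%R) ->
  hausdorff_measure k.+1 A + hausdorff_measure k.+1 B
    <= hausdorff_measure k.+1 (A `|` B).
Proof.
move=> e0 ABe.
have key d : (0 < d)%R -> (d < e)%R ->
    hausdorff_pre d A + hausdorff_pre d B <= hausdorff_pre d (A `|` B).
  move=> d0 de; rewrite -(hausdorff_preE d (_ `|` _)).
  apply: le_ereal_inf_tmp => _ [F [ABF Fd] <-].
  pose G (C : set E) i := if pselect (F i `&` C !=set0) then F i else set0.
  have G_cover C : C `<=` A `|` B -> covering_of C d (G C).
    move=> CAB; split; last first.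
      by move=> i; rewrite /G; case: pselect => //= _; rewrite diameter0 lee_fin ltW.
    move=> x Cx; have [i _ Fix] := ABF _ (CAB _ Cx); exists i => //.
    by rewrite /G; case: pselect => //= -[]; exists x.
  have G_pre C : C `<=` A `|` B ->
      hausdorff_pre d C <= \sum_(0 <= i <oo) c%:E * diameter (G C i) ^+ k.+1.
    move=> /G_cover CG; rewrite -hausdorff_preE; apply: ereal_inf_lbound.
    by exists (G C).
  apply: (le_trans (leeD (G_pre A _) (G_pre B _))); [by left|by right|].
  rewrite -nneseriesD; [|by move=> *; exact: c_diam_ge0..].
  apply: lee_nneseries => i _; first by move=> _; rewrite adde_ge0// c_diam_ge0.
  have z : c%:E * diameter (set0 : set E) ^+ k.+1 = 0.
    by rewrite diameter0 expeS mul0e mule0.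
  rewrite /G; case: pselect => FA /=; case: pselect => FB /=; rewrite ?z ?adde0 ?add0e//.
    case: FA FB => a [Fa Aa] [b [Fb Bb]].
    have := le_trans (enorm_diameter Fa Fb) (Fd i).
    by rewrite lee_fin => /(le_trans (ABe _ _ Aa Bb)); rewrite leNgt de.
  exact: c_diam_ge0.
have [->|fin] := eqVneq (hausdorff_measure k.+1 (A `|` B)) +oo; first exact: leey.
set S := hausdorff_measure k.+1 (A `|` B) in fin *.
have Sfin : S \is a fin_num.
  by rewrite ge0_fin_numE ?hausdorff_measure_ge0// lt_neqAle fin leey.
have Bfin : hausdorff_measure k.+1 B \is a fin_num.
  rewrite ge0_fin_numE ?hausdorff_measure_ge0//.
  rewrite (le_lt_trans (le_hausdorff_measure (@subsetUr _ A B)))//.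
  by rewrite -/S -ge0_fin_numE// hausdorff_measure_ge0.
have pfin d C : (0 < d)%R -> C `<=` A `|` B -> hausdorff_pre d C \is a fin_num.
  move=> d0 CAB; rewrite ge0_fin_numE; last first.
    by apply: mu_ext_ge0 => X; exact: small_weight_ge0.
  apply: (le_lt_trans (hausdorff_pre_le _ d0)).
  rewrite (le_lt_trans (le_hausdorff_measure CAB))//.
  by rewrite -/S -ge0_fin_numE// hausdorff_measure_ge0.
rewrite -leeBrDr// {1}hausdorff_measureE; apply: ge_ereal_sup => _ [d /= d0 <-].
have Ad := pfin d A d0 (@subsetUl _ A B).
rewrite leeBrDr// -leeBrDl//.
rewrite {1}hausdorff_measureE; apply: ge_ereal_sup => _ [d' /= d'0 <-].
rewrite leeBrDl//.
pose m : R := (Num.min (Num.min d d') (e / 2))%R.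
have m0 : (0 < m)%R by rewrite !lt_min d0 d'0 divr_gt0.
have me : (m < e)%R by rewrite gt_min; apply/orP; right; rewrite ltr_pdivrMr// ltr_pMr// ltr1n.
apply: (@le_trans _ _ (hausdorff_pre m A + hausdorff_pre m B)).
  by rewrite leeD//; apply: hausdorff_pre_anti; rewrite !ge_min lexx ?orbT.
exact: (le_trans (key _ m0 me) (hausdorff_pre_le _ m0)).
Qed.

End hausdorff_outer.

Section hausdorff_borel.
Context {R : realType} {D : nat} (k : nat).
Local Notation E := 'rV[R]_D.
Local Notation H := (@hausdorff_measure R D k.+1).

(** Hausdorff measure adds over sets at positive distance, hence over sets
   separated by the distance to a closed set. *)
Lemma closed_caratheodory (C : set E) : closed C -> H.-caratheodory C.
Proof.
move=> Ccl; have [->|/set0P[c0 Cc0]] := eqVneq C set0.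
  exact: caratheodory_measurable_set0.
pose S x : set R := [set enorm (x - c) | c in C].
have Slb x : has_lbound (S x) by exists 0 => _ [c _ <-]; exact: enorm_ge0.
have S0 x : S x !=set0 by exists (enorm (x - c0)), c0.
pose f x := inf (S x).
have fLip x y : f x - enorm (x - y) <= f y.
  apply: lb_le_inf => // _ [c Cc <-]; rewrite lerBlDl.
  apply: (@le_trans _ _ (enorm (x - c))); last exact: ler_enorm_distD.
  by apply: ge_inf => //; exists c.
have -> : C = [set x | f x <= 0].
  apply/seteqP; split => x /=.
    move=> Cx; rewrite -[leRHS](@enorm0 R D) -(subrr x).
    by apply: ge_inf => //; exists x.
  move=> fx; rewrite closure_id in Ccl; rewrite Ccl => B /nbhs_ballP[e /= e0 Be].
  have [_ [c Cc <-] ce] := inf_adherent e0 (conj (S0 x) (Slb x)).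
  exists c; split => //; apply: Be; rewrite -ball_normE /=.
  by rewrite (le_lt_trans (norm_le_enorm _))// (lt_le_trans ce)// gerDr.
apply: caratheodory_separated => A B a b ab Aa Bb.
apply: (@hausdorff_measure_separated _ _ _ _ _ (b - a)); first by rewrite subr_gt0.
move=> x y Ax By; have := fLip y x; have := Aa _ Ax; have := Bb _ By.
by rewrite enormB; lra.
Qed.

Lemma borel_caratheodory (A : set (borel_rV R D)) :
  measurable A -> H.-caratheodory A.
Proof.
apply: smallest_sub; last first.
  move=> U Uo; rewrite -[U]setCK; apply: caratheodory_measurable_setC.
  by apply: closed_caratheodory; exact: open_closedC.
split.
- exact: caratheodory_measurable_set0.
- by move=> B mB; rewrite setTD; exact: caratheodory_measurable_setC.
- by move=> F mF; exact: caratheodory_measurable_bigcup.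
Qed.

Local Notation HB := (@hausdorff_measure R D k.+1 : set (borel_rV R D) -> \bar R).

Lemma hausdorff_semi_sigma_additive : semi_sigma_additive HB.
Proof.
move=> F mF tF mUF.
have := @caratheodory_measure_sigma_additive R E H F.
by apply => [n|//|]; exact: borel_caratheodory.
Qed.

HB.instance Definition _ := isMeasure.Build _ (borel_rV R D) R
  HB (@hausdorff_measure0 R D k) (@hausdorff_measure_ge0 R D k)
  hausdorff_semi_sigma_additive.

End hausdorff_borel.

Section isometry.
Context {R : realType} {D : nat} (k : nat).
Local Notation E := 'rV[R]_D.
Local Notation H := (@hausdorff_measure R D k.+1).

(** Coverings are pulled back to coverings by sets of the same diameters. *)
Lemma hausdorff_measure_isometry (g : E -> E) (A : set E) :
  (forall x y, enorm (g x - g y) = enorm (x - y)) -> involutive g ->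
  H (g @^-1` A) = H A.
Proof.
move=> gi gg.
suff half B : (H (g @^-1` B) <= H B)%E.
  apply/eqP; rewrite eq_le half/=.
  rewrite {1}(_ : A = g @^-1` (g @^-1` A)) ?half//.
  by apply/seteqP; split => x /=; rewrite gg.
apply: ge_ereal_sup => _ [del d0 <-]; apply: le_ereal_sup_tmp.
eexists; first by exists del.
apply: le_ereal_inf_tmp => _ [F [BF Fd] <-].
have diam i : (diameter (g @^-1` F i) <= diameter (F i))%E.
  rewrite /diameter ge_max !le_max lexx/=; apply/orP; right.
  apply: ge_ereal_sup => _ [[x y] [Fx Fy] <-] /=.
  by apply: ereal_sup_ubound; exists (g x, g y) => //=; rewrite gi.
apply: (@le_trans _ _ (\sum_(0 <= i <oo) (unit_ball_volume k.+1 / 2 ^+ k.+1)%:E *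
    diameter (g @^-1` F i) ^+ k.+1)%E).
  apply: ereal_inf_lbound; exists (fun i => g @^-1` F i) => //; split.
    by move=> x /BF[i _ Fi]; exists i.
  by move=> i; exact: le_trans (diam i) (Fd i).
apply: lee_nneseries => i _; first by move=> _; exact: c_diam_ge0.
have c0 := @c_gt0 R k.
rewrite lee_pmul2l ?lte_fin//.
have : (0 <= diameter (g @^-1` F i))%E by exact: diameter_ge0.
elim: (k.+1) => [|n IH] h0; first by rewrite !expe0.
by rewrite !expeS lee_pmul ?IH ?expe_ge0.
Qed.

End isometry.

(** * Hausdorff measure of flat boxes *)

Section counting.

Lemma card_interval_le (N m : nat) (T : {set 'I_N}) :
  (forall x y, x \in T -> y \in T -> (x <= y + m)%N) -> (#|T| <= m.+1)%N.
Proof.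
move=> Tm; have [->|/set0Pn[x0 x0T]] := eqVneq T finset.set0.
  by rewrite cards0.
have [a aT amin] := @arg_minnP _ x0 (mem T) (@nat_of_ord N) x0T.
have sub x : x \in T -> (x - a < m.+1)%N.
  by move=> xT; rewrite ltnS leq_subLR Tm.
rewrite -[m.+1]card_ord.
apply: (@leq_card_in _ _ (fun x : 'I_N => inord (x - a) : 'I_m.+1)).
move=> x y xT yT /(congr1 val); rewrite /= !inordK ?sub// => xy.
apply/val_inj => /=.
by rewrite -(subnK (amin x xT)) -(subnK (amin y yT)) xy.
Qed.

(** On [S] each coordinate takes at most [m + 1] values. *)
Lemma card_box_le (d N m : nat) (S : {set {ffun 'I_d -> 'I_N}}) :
  (forall k l j, k \in S -> l \in S -> (k j <= l j + m)%N) ->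
  (#|S| <= m.+1 ^ d)%N.
Proof.
move=> Sm; pose T j := [set k j | k : {ffun 'I_d -> 'I_N} in S]%SET.
apply: (@leq_trans #|family (fun j => mem (T j))|).
  by apply/subset_leq_card/fintype.subsetP => k kS; apply/familyP => j; exact: imset_f.
rewrite card_family foldrE big_map big_enum/= -[d in (_ ^ d)%N]card_ord.
rewrite -prod_nat_const; apply: leq_prod => j _; apply: card_interval_le.
by move=> _ _ /imsetP[k kS ->] /imsetP[l lS ->]; exact: Sm.
Qed.

End counting.

Lemma eseries_finite (R : realType) (f : nat -> \bar R) N :
  (forall i, (0 <= f i)%E) -> (forall i, (N <= i)%N -> f i = 0%E) ->
  (\sum_(0 <= i <oo) f i = \sum_(0 <= i < N) f i)%E.
Proof.
move=> f0 fN; rewrite (nneseries_split 0 N)// add0n eseries0 ?adde0// => i Ni _.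
exact: fN.
Qed.

Lemma exprnD_le (R : realType) (x e : R) n :
  0 <= x <= 1 -> 0 <= e <= 1 -> (x + e) ^+ n <= x ^+ n + (2 ^+ n - 1) * e.
Proof.
move=> /andP[x0 x1] /andP[e0 e1]; elim: n => [|n IH].
  by rewrite !expr0; lra.
rewrite exprS (le_trans (ler_wpM2l (addr_ge0 x0 e0) IH))//.
have xn : x ^+ n <= 1 by rewrite exprn_ile1.
have xn0 : 0 <= x ^+ n by rewrite exprn_ge0.
have p1 : 1 <= 2 ^+ n :> R by rewrite exprn_ege1// ler1n.
rewrite !exprS; set X := x ^+ n in IH xn xn0 *; set P := 2 ^+ n in p1 IH *.
have h1 : 0 <= (P - 1) * e * (1 - x) by rewrite !mulr_ge0 ?subr_ge0.
have h2 : 0 <= e * (1 - X) by rewrite !mulr_ge0 ?subr_ge0.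
have h3 : 0 <= (P - 1) * e * (1 - e) by rewrite !mulr_ge0 ?subr_ge0.
lra.
Qed.

Section cubes.
Context {R : realType} {D : nat} (k : nat).
Local Notation E := 'rV[R]_D.
Local Notation d := k.+1.
Hypothesis dD : (d <= D)%N.

Definition flat_box (lo hi : 'I_D -> R) : set E :=
  [set x | flat d x /\ forall i : 'I_D, (i < d)%N -> lo i <= x ord0 i <= hi i].

Definition flat_coord (i : 'I_d) : 'I_D := widen_ord dD i.

Definition from_flat (u : 'I_d -> R) : E :=
  \row_(j < D) if insub (val j) is Some i then u i else 0.

Lemma from_flat_coord u i : from_flat u ord0 (flat_coord i) = u i.
Proof.
rewrite mxE /flat_coord /= (_ : insub _ = Some i)//.
by rewrite -[in RHS](valK i).
Qed.

Lemma from_flat_out u (j : 'I_D) : (d <= j)%N -> from_flat u ord0 j = 0.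
Proof. by move=> dj; rewrite mxE insubF// ltnNge dj. Qed.

Lemma flat_coordP (i : 'I_D) : (i < d)%N -> exists j, i = flat_coord j.
Proof. by move=> id; exists (Ordinal id); apply/val_inj. Qed.

(** Grid points of step [s / N] in the cube are shared out between the
   covering sets, and a set of diameter [delta] takes at most
   [(delta * N / s + 1) ^ d] of them. *)
Lemma finite_cover_cube (lo : 'I_D -> R) (s : R) (N0 : nat) (delta e : nat -> R)
    (O : nat -> set E) : 0 < s ->
  (forall i, 0 <= delta i) -> (forall i, 0 < e i) ->
  (forall i x y j, O i x -> O i y -> `|x ord0 j - y ord0 j| <= delta i + e i) ->
  flat_box lo (fun i => lo i + s) `<=` \bigcup_(i < N0) O i ->
  s ^+ d <= \sum_(i < N0) (delta i + 2 * e i) ^+ d.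
Proof.
move=> s0 delta0 e0 Odiam Ocov.
have [N [N_gt0 Ne]] : exists N : nat, (0 < N)%N /\
    forall i, (i < N0)%N -> 1 <= N%:R * e i / s.
  have [M HM] : exists M : R, forall i, (i < N0)%N -> s / e i <= M.
    exists (\sum_(i < N0) s / e i) => i iN0.
    rewrite (bigD1 (Ordinal iN0))//= lerDl sumr_ge0// => j _.
    by rewrite divr_ge0// ltW.
  exists (Num.truncn M).+1; split => // i iN0.
  rewrite ler_pdivlMr// mul1r -ler_pdivrMr//.
  by rewrite (le_trans (HM _ iN0))// ltW// truncnS_gt.
have N0R : 0 < N%:R :> R by rewrite ltr0n.
pose x (f : {ffun 'I_d -> 'I_N}) : E :=
  from_flat (fun i => lo (flat_coord i) + s * (f i)%:R / N%:R).
have xbox f : flat_box lo (fun i => lo i + s) (x f).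
  split=> [j|_ /flat_coordP[i ->]]; first exact: from_flat_out.
  rewrite from_flat_coord lerDl lerD2l; apply/andP; split.
    by rewrite divr_ge0// mulr_ge0// ltW.
  by rewrite ler_pdivrMr// ler_pM2l// ler_nat ltnW.
pose S i := [set f | `[< O i (x f) >]]%SET.
have Scard i : (i < N0)%N -> (#|S i|%:R <= (N%:R / s * (delta i + 2 * e i)) ^+ d :> R).
  move=> iN0.
  pose m := Num.truncn (N%:R / s * (delta i + e i)).
  have Nse : 0 <= N%:R / s * (delta i + e i).
    by rewrite mulr_ge0 ?divr_ge0 ?addr_ge0 ?(ltW (e0 _))// ltW.
  have /card_box_le : forall f g j, f \in S i -> g \in S i -> (f j <= g j + m)%N.
    move=> f g j; rewrite /S !finset.in_set => /asboolP Of /asboolP Og.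
    have := Odiam _ _ _ (flat_coord j) Of Og; rewrite !from_flat_coord.
    move=> h; have {h} := le_trans (ler_norm _) h.
    have Ns0 : 0 < N%:R / s by rewrite divr_gt0.
    rewrite -(ler_pM2l Ns0) => h.
    rewrite -leq_subLR /m truncn_ge_nat//.
    have [fg|gf] := leqP (f j) (g j); first by rewrite (eqP fg).
    apply: le_trans h; rewrite natrB ?(ltnW gf)// le_eqVlt; apply/orP; left.
    by apply/eqP; field; rewrite !gt_eqF.
  rewrite -(ler_nat R) => /le_trans; apply; rewrite natrX lerXn2r ?nnegrE//.
    by rewrite mulr_ge0 ?divr_ge0 ?addr_ge0 ?mulr_ge0 ?(ltW (e0 _))// ltW.
  rewrite -natr1; have : m%:R <= N%:R / s * (delta i + e i) by rewrite truncn_le.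
  have := Ne _ iN0.
  rewrite (_ : N%:R / s * (delta i + 2 * e i) =
    N%:R / s * (delta i + e i) + N%:R * e i / s); last by ring.
  by move: (N%:R * e i / s) (N%:R / s * _) m => a b m' h1 h2; lra.
have : (N ^ d <= \sum_(i < N0) #|S i|)%N.
  have <- : #|{ffun 'I_d -> 'I_N}| = (N ^ d)%N by rewrite card_ffun !card_ord.
  rewrite -sum1_card.
  under [leqRHS]eq_bigr do rewrite -sum1_card big_mkcond/=.
  rewrite exchange_big/=; apply: leq_sum => f _.
  have [i iN0 Oi] := Ocov _ (xbox f).
  by rewrite (bigD1 (Ordinal iN0))//= finset.in_set asboolT.
rewrite -(ler_nat R) natrX natr_sum => h.
have {}h : N%:R ^+ d <= \sum_(i < N0) (N%:R / s * (delta i + 2 * e i)) ^+ d :> R.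
  by rewrite (le_trans h)//; apply: ler_sum => i _; exact: Scard.
move: h; under eq_bigr do rewrite exprMn.
rewrite -mulr_sumr expr_div_n mulrAC ler_pdivlMr ?exprn_gt0//.
by rewrite ler_pM2l// exprn_gt0.
Qed.

End cubes.

Section cube_lower.
Context {R : realType} {D : nat} (k : nat).
Local Notation E := 'rV[R]_D.
Local Notation d := k.+1.
Local Notation H := (@hausdorff_measure R D k.+1).
Local Notation c := (unit_ball_volume k.+1 / 2 ^+ k.+1 : R)%R.
Hypothesis dD : (d <= D)%N.

Lemma compact_flat_box (lo hi : 'I_D -> R) : compact (flat_box k lo hi : set E).
Proof.
have -> : (flat_box k lo hi : set E) =
    [set x : E | forall i : 'I_D, [set` if (i < d)%N then `[lo i, hi i] else `[0, 0]]%R (x ord0 i)].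
  apply/seteqP; split=> x /=.
    move=> [fx bx] i; case: ltnP => id; first by rewrite in_itv/= bx.
    by rewrite in_itv/= fx// lexx.
  move=> bx; split=> i id; have := bx i.
    by rewrite ltnNge id/= in_itv/= => xi; apply/eqP; rewrite eq_le andbC.
  by rewrite id in_itv.
apply: (@rV_compact R D (fun i : 'I_D =>
  [set` if (i < d)%N then `[lo i, hi i] else `[0, 0]]%R)) => i.
by case: ifP => _; exact: segment_compact.
Qed.

(** The sets of a covering are enlarged to open sets, finitely many of which
   cover the compact cube. The enlargements decrease geometrically, which keeps
   their total contribution below any given [eps]. *)
Lemma hausdorff_cube_ge (lo : 'I_D -> R) (s : R) : 0 < s ->
  ((c * s ^+ d)%:E <= H (flat_box k lo (fun i => (lo i + s)%R)))%E.
Proof.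
move=> s0; apply: (le_trans _ (hausdorff_pre_le _ _ (@ltr01 R))).
rewrite -hausdorff_preE; apply: le_ereal_inf_tmp => _ [F [QF Fd] <-].
pose delta i := fine (diameter (F i)).
have Fdelta i : diameter (F i) = (delta i)%:E.
  by rewrite /delta fineK// ge0_fin_numE ?diameter_ge0// (le_lt_trans (Fd i))// ltry.
have delta0 i : 0 <= delta i by rewrite -lee_fin -Fdelta diameter_ge0.
have delta1 i : delta i <= 1 by rewrite -lee_fin -Fdelta.
have -> : (\sum_(0 <= i <oo) c%:E * diameter (F i) ^+ k.+1 =
    \sum_(0 <= i <oo) (c * delta i ^+ d)%:E)%E.
  by apply: eq_eseriesr => i _; rewrite Fdelta -EFin_expe EFinM.
apply/lee_addgt0Pr => eps eps0.
(* the margin [2 ^ d] is the one of [exprnD_le] *)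
pose eta := Num.min 1 (eps / (c * 2 ^+ d)).
have c0 : 0 < c by exact: c_gt0.
have eta0 : 0 < eta by rewrite lt_min ltr01 divr_gt0// mulr_gt0// exprn_gt0.
pose e i := eta / 2 ^+ i.+2 : R.
have e0 i : 0 < e i by rewrite divr_gt0// exprn_gt0.
pose O i := \bigcup_(f in F i) ball f (e i / 2).
have Oopen i : open (O i) by apply: bigcup_open => f _; exact: ball_open.
have QO : flat_box k lo (fun i => lo i + s) `<=` \bigcup_(i in setT) O i.
  move=> x /QF[i _ Fix]; exists i => //; exists x => //.
  by apply: ballxx; rewrite divr_gt0.
have := @compact_flat_box lo (fun i => lo i + s).
rewrite compact_cover => /(_ nat setT O (fun i _ => Oopen i) QO)[J _ QJ].
pose N0 := (\max_(i <- finmap.enum_fset J) i).+1.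
have QN0 : flat_box k lo (fun i => lo i + s) `<=` \bigcup_(i < N0) O i.
  move=> x /QJ[i iJ Oix]; exists i => //=; rewrite ltnS.
  exact: (@leq_bigmax_seq _ _ xpredT id).
have Odiam i x y j : O i x -> O i y -> `|x ord0 j - y ord0 j| <= delta i + e i.
  move=> [f Ff fx] [g Fg gy].
  have := enorm_diameter Ff Fg; rewrite Fdelta lee_fin => fg.
  have h1 : `|(f - x) ord0 j| < e i / 2.
    by apply: le_lt_trans (coord_le_norm _ _) _; move: fx; rewrite -ball_normE.
  have h2 : `|(g - y) ord0 j| < e i / 2.
    by apply: le_lt_trans (coord_le_norm _ _) _; move: gy; rewrite -ball_normE.
  have h3 := le_trans (coord_le_enorm (f - g) j) fg.
  move: h1 h2 h3; rewrite !mxE !ltr_norml !ler_norml => h1 h2 h3; lra.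
have := finite_cover_cube dD s0 delta0 e0 Odiam QN0 => h.
have {}h : s ^+ d <= \sum_(i < N0) delta i ^+ d + \sum_(i < N0) 2 ^+ d * (eta / 2 ^+ i.+1).
  apply: (le_trans h); rewrite -big_split; apply: ler_sum => i _ /=.
  have e2 : 2 * e i = eta / 2 ^+ i.+1.
    by rewrite /e (exprS _ i.+1); field; rewrite expf_neq0.
  have e2_1 : 0 <= 2 * e i <= 1.
    rewrite mulr_ge0 ?(ltW (e0 _))//= e2 ler_pdivrMr ?exprn_gt0// mul1r.
    by rewrite (@le_trans _ _ 1)// ?ge_min ?lexx// exprn_ege1// ler1n.
  rewrite -e2; apply: (le_trans (exprnD_le _ _ e2_1)); first by rewrite delta0 delta1.
  by rewrite lerD2l ler_wpM2r ?(andP e2_1).1//; lra.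
have geo : \sum_(i < N0) 2 ^+ d * (eta / 2 ^+ i.+1) <= 2 ^+ d * eta.
  rewrite -mulr_sumr ler_pM2l ?exprn_gt0// -mulr_sumr ger_pMr//.
  suff -> : \sum_(i < N0) (2 ^+ i.+1)^-1 = 1 - (2 ^+ N0)^-1 :> R.
    by rewrite gerBl invr_ge0 exprn_ge0.
  elim: (N0) => [|m IH]; first by rewrite big_ord0 expr0 invr1 subrr.
  by rewrite big_ord_recr/= IH (exprS _ m); field; rewrite expf_neq0.
have etaeps : c * (2 ^+ d * eta) <= eps.
  have c2 : 0 < c * 2 ^+ d by rewrite mulr_gt0// exprn_gt0.
  by rewrite mulrA mulrC -ler_pdivlMr// ge_min lexx orbT.
apply: (@le_trans _ _ (\sum_(0 <= i < N0) (c * delta i ^+ d)%:E + eps%:E)%E).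
  rewrite big_mkord sumEFin -EFinD lee_fin -mulr_sumr.
  apply: le_trans (_ : _ <= c * (\sum_(i < N0) delta i ^+ d + 2 ^+ d * eta)) _.
    by rewrite ler_pM2l// (le_trans h)// lerD2l.
  by rewrite mulrDr lerD2l.
rewrite leeD2r//; apply: nneseries_lim_ge => i _ _.
by rewrite lee_fin mulr_ge0 ?(ltW c0)// exprn_ge0.
Qed.

End cube_lower.

Lemma lee_expe2r (R : realType) (x y : \bar R) n :
  (0 <= x -> x <= y -> x ^+ n <= y ^+ n)%E.
Proof.
move=> x0 xy; elim: n => [|n IH]; first by rewrite !expe0.
by rewrite !expeS lee_pmul// expe_ge0.
Qed.

Section box_upper.
Context {R : realType} {D : nat} (k : nat).
Local Notation E := 'rV[R]_D.
Local Notation d := k.+1.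
Local Notation H := (@hausdorff_measure R D k.+1).
Local Notation c := (unit_ball_volume k.+1 / 2 ^+ k.+1 : R)%R.
Hypothesis dD : (d <= D)%N.

Lemma dot_flat (x y : E) : flat d x ->
  dot x y = \sum_(i < d) x ord0 (flat_coord dD i) * y ord0 (flat_coord dD i).
Proof.
move=> fx; rewrite /dot (bigID (fun i : 'I_D => (i < d)%N))/=.
rewrite [X in _ + X]big1 ?addr0; last first.
  by move=> i; rewrite -leqNgt => di; rewrite fx// mul0r.
by rewrite (big_ord_narrow dD).
Qed.

(** The box is cut into cubes of side [s], smaller than each side of the box:
   at most [2 * a i / s] of them are needed in direction [i], and each has
   diameter at most [d * s]. *)
Lemma hausdorff_box_le (lo a : 'I_D -> R) : (forall i, 0 < a i) ->
  (H (flat_box k lo (fun i => lo i + a i)%R) <=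
    (c * (2 * d%:R) ^+ d * \prod_(i < d) a (flat_coord dD i))%:E)%E.
Proof.
move=> a0; rewrite hausdorff_measureE; apply: ge_ereal_sup => _ [del /= del0 <-].
have [s [s0 sdel sa]] : exists s, [/\ 0 < s, d%:R * s <= del &
    forall i : 'I_d, s <= a (flat_coord dD i)].
  exists (\big[Num.min/(del / d%:R)]_(i < d) a (flat_coord dD i)); split.
  - by apply/bigmin_gtP; split => // ; rewrite divr_gt0.
  - by rewrite mulrC -ler_pdivlMr//; exact: bigmin_le_id.
  - by move=> i; apply: bigmin_le_cond.
pose t (i : 'I_d) := Num.truncn (a (flat_coord dD i) / s).
pose m := (\max_(i < d) t i).+1.
pose T (i : 'I_d) := [pred j : 'I_m | (j <= t i)%N].
pose A := family T.
pose C (f : {ffun 'I_d -> 'I_m}) : set E := flat_box k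
  (fun i => if insub (val i) is Some i' then lo i + s * (f i')%:R else 0)
  (fun i => if insub (val i) is Some i' then lo i + s * (f i').+1%:R else 0).
have CE f x : C f x -> flat d x /\ forall i : 'I_d,
    lo (flat_coord dD i) + s * (f i)%:R <= x ord0 (flat_coord dD i)
    <= lo (flat_coord dD i) + s * (f i).+1%:R.
  by move=> [fx bx]; split => // i; have := bx (flat_coord dD i) (ltn_ord i); rewrite valK.
have Cdiam f : (diameter (C f) <= (d%:R * s)%:E)%E.
  apply: diameter_le => [|x y /CE[fx bx] /CE[fy yb]]; first by rewrite mulr_ge0// ltW.
  rewrite enorm_le ?mulr_ge0//; last exact: ltW.
  rewrite dot_flat; last exact: flat_sub.
  apply: (@le_trans _ _ (\sum_(i < d) s ^+ 2)).
    apply: ler_sum => i _; rewrite -expr2 -real_normK ?num_real// !mxE.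
    rewrite lerXn2r ?nnegrE ?(ltW s0)// ler_norml.
    have := bx i; have := yb i; rewrite -natr1 mulrDr mulr1.
    move: (s * (f i)%:R) => u h1 h2; lra.
  rewrite sumr_const card_ord -[leLHS]mulr_natl exprMn ler_wpM2r ?sqr_ge0//.
  by rewrite expr2 ler_peMl// ler1n.
pose F (n : nat) : set E :=
  if insub n : option 'I_#|A| is Some j then C (enum_val j) else set0.
have Fcov : covering_of (flat_box k lo (fun i => lo i + a i)) del F.
  split; last first.
    move=> n; rewrite /F; case: insubP => [j _ _|_].
      by rewrite (le_trans (Cdiam _))// lee_fin.
    by rewrite diameter0 lee_fin ltW.
  move=> x [fx bx].
  pose u (i : 'I_d) := (x ord0 (flat_coord dD i) - lo (flat_coord dD i)) / s.
  have u0 i : 0 <= u i.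
    by rewrite divr_ge0 ?(ltW s0)// subr_ge0; have /andP[] := bx (flat_coord dD i) (ltn_ord i).
  have ut i : (Num.truncn (u i) <= t i)%N.
    apply: le_truncn; rewrite ler_pM2r ?invr_gt0// lerBlDl.
    by have /andP[] := bx (flat_coord dD i) (ltn_ord i).
  have um i : (Num.truncn (u i) < m)%N.
    by rewrite ltnS (leq_trans (ut i))//; exact: leq_bigmax.
  pose f : {ffun 'I_d -> 'I_m} := [ffun i => Ordinal (um i)].
  have fA : f \in A by apply/familyP => i; rewrite ffunE; exact: ut.
  exists (enum_rank_in fA f) => //.
  rewrite /F valK enum_rankK_in//; split => // i id; rewrite insubT ffunE /=.
  have /andP[] := truncn_itv (u0 (Sub (val i) id)).
  rewrite ler_pdivlMr// ltr_pdivrMr// /u.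
  have -> : flat_coord dD (Sub (val i) id) = i by apply/val_inj.
  by rewrite !(mulrC s) lerBrDl ltrBlDl => -> /ltW ->.
have cardA : #|A|%:R <= \prod_(i < d) (2 * a (flat_coord dD i) / s) :> R.
  apply: (@le_trans _ _ (\prod_(i < d) (t i).+1)%:R).
    rewrite ler_nat card_family foldrE big_map big_enum/=; apply: leq_prod => i _.
    rewrite -cardsE; apply: card_interval_le => x y; rewrite !finset.in_set => xt yt.
    by rewrite (leq_trans xt)// leq_addl.
  rewrite natr_prod; apply: ler_prod => i _; rewrite ler0n/= -natr1.
  have as1 : 1 <= a (flat_coord dD i) / s by rewrite ler_pdivlMr// mul1r.
  have : (t i)%:R <= a (flat_coord dD i) / s by rewrite /t truncn_le; exact: le_trans ler01 as1.
  by move=> h; rewrite -mulrA; lra.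
rewrite -hausdorff_preE.
apply: (@le_trans _ _ (\sum_(0 <= i <oo) c%:E * diameter (F i) ^+ d)%E).
  by apply: ereal_inf_lbound; exists F.
rewrite (@eseries_finite _ _ #|A|); last 2 first.
- by move=> i; exact: c_diam_ge0.
- move=> i Ai; rewrite /F insubF ?diameter0 ?expeS ?mul0e ?mule0//.
  by rewrite ltnNge Ai.
have c0 : 0 < c by exact: c_gt0.
apply: (@le_trans _ _ (\sum_(0 <= i < #|A|) (c * (d%:R * s) ^+ d)%:E)%E).
  apply: lee_sum => i _; rewrite (EFinM c) lee_pmul2l ?lte_fin// EFin_expe.
  apply: lee_expe2r; first exact: diameter_ge0.
  rewrite /F; case: insub => [j|]; first exact: Cdiam.
  by rewrite diameter0 lee_fin mulr_ge0// ltW.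
rewrite big_mkord sumEFin lee_fin sumr_const card_ord -[leLHS]mulr_natr.
apply: (le_trans (ler_wpM2l _ cardA)).
  by rewrite mulr_ge0 ?(ltW c0)// exprn_ge0// mulr_ge0// ltW.
rewrite le_eqVlt; apply/orP; left; apply/eqP.
rewrite (eq_bigr (fun i => (2 / s) * a (flat_coord dD i))); last first.
  by move=> i _; rewrite mulrAC.
rewrite big_split/= prodr_const card_ord !exprMn exprVn.
by field; rewrite !expf_neq0// gt_eqF.
Qed.

End box_upper.

(** * Calculus of functions of class C^k *)

Section differentiable_local.
Context {R : realType} {V W : normedModType R}.

Lemma near0_diff (e : V -> W) x : (\near x, e x = 0) ->
  continuous (0 : V -> W) /\ e \o shift x = cst (e x) + (0 : V -> W) +o_ 0 id.
Proof.
move=> ex; split; first by move=> y; exact: cvg_cst.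
have ex0 : e x = 0 by exact: nbhs_singleton ex.
apply/eqaddoP => _/posnumP[eps]; rewrite ex0.
move: ex; rewrite [X in X -> _](near_shift 0 x) subr0 => ex.
near=> h; rewrite !fctE /=.
rewrite [X in _ - X](_ : _ = 0) ?subr0; last by rewrite add0r.
have -> : e (h + x) = 0 by near: h.
by rewrite normr0 mulr_ge0.
Unshelve. all: by end_near. Qed.

(** Differentiability is local, because a function vanishing near a point is
   differentiable there. *)
Lemma near_eq_differentiable (f g : V -> W) x : (\near x, f x = g x) ->
  differentiable f x -> differentiable g x.
Proof.
move=> fg df; rewrite (_ : g = f + (g - f)); last by rewrite addrC subrK.
apply: differentiableD => //.
have e0 : \near x, (g - f) x = 0.
  by near=> y; rewrite !fctE; apply/eqP; rewrite subr_eq0 eq_sym; apply/eqP; near: y.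
have [c h] := near0_diff e0.
apply/diff_locallyP.
by rewrite (@diff_unique _ _ _ _ (\0 : {linear V -> W})).
Unshelve. all: by end_near. Qed.
End differentiable_local.

Section smooth_scalar.
Context {R : realType} {D : nat}.
Local Notation E := 'rV[R]_D.
Implicit Types (U : set E) (f g : E -> R).

(** Scalar counterpart of [C_on]. Scalar functions can be multiplied and
   inverted, and a map is of class C^k as soon as its coordinates are
   ([smooth_on_C_on]). *)
Fixpoint smooth_on (k : nat) U f : Prop :=
  match k with
  | 0 => forall x, U x -> {for x, continuous f}
  | k'.+1 => (forall x, U x -> differentiable f x) /\
             (forall v : E, smooth_on k' U (fun x => 'D_v f x))
  end.

Context {U : set E}.
Hypothesis Uo : open U.

Lemma near_open (P : E -> Prop) x : U x -> (forall y, U y -> P y) -> \near x, P x.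
Proof.
move=> Ux UP; near=> y; apply: UP; near: y; exact: open_nbhs_nbhs.
Unshelve. all: by end_near. Qed.

Lemma smooth_on_ext k f g : (forall x, U x -> f x = g x) ->
  smooth_on k U f -> smooth_on k U g.
Proof.
elim: k f g => [|k IH] f g fg /=.
  move=> fc x Ux; have := fc x Ux; rewrite /prop_for /continuous_at -fg//.
  move=> h; apply: cvg_trans h; apply: (@near_eq_cvg _ _ (nbhs x)).
  by apply: (near_open Ux) => y Uy; rewrite fg.
move=> [fd fD]; split=> [x Ux|v].
  by apply: near_eq_differentiable (fd x Ux); exact: (near_open Ux).
apply: IH (fD v) => x Ux; apply: near_eq_derive; exact: (near_open Ux).
Qed.

Lemma smooth_onW k f : smooth_on k.+1 U f -> smooth_on k U f.
Proof.
elim: k f => [|k IH] f [fd fD] /=.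
  by move=> x Ux; apply: differentiable_continuous; exact: fd.
by split=> // v; apply: IH; exact: fD.
Qed.

Lemma smooth_on_cst k a : smooth_on k U (cst a).
Proof.
elim: k a => [|k IH] a /=; first by move=> x _; exact: cst_continuous.
split=> [x _|v]; first exact: differentiable_cst.
by apply: smooth_on_ext (IH 0) => x _; rewrite derive_cst.
Qed.

Lemma smooth_on_coord k (i : 'I_D) : smooth_on k U (fun x => x ord0 i).
Proof.
case: k => [|k] /=; first by move=> x _; exact: coord_continuous.
split=> [x _|v]; first exact: differentiable_coord.
apply: smooth_on_ext (smooth_on_cst k (v ord0 i)) => x _.
rewrite deriveE; last exact: differentiable_coord.
have @l : {linear E -> R}.
  by exists (fun N : E => N ord0 i); do 2![eexists]; do ?[constructor];
     rewrite ?mxE// => ? *; rewrite ?mxE//; move=> ?; rewrite !mxE.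
rewrite (_ : (fun _ => _) = l)// diff_lin//; exact: coord_continuous.
Qed.

Lemma smooth_onD k f g : smooth_on k U f -> smooth_on k U g ->
  smooth_on k U (fun x => f x + g x).
Proof.
elim: k f g => [|k IH] f g /=; first by move=> fc gc x Ux; exact: cvgD (fc x Ux) (gc x Ux).
move=> [fd fD] [gd gD]; split=> [x Ux|v].
  by apply: differentiableD; [exact: fd|exact: gd].
apply: smooth_on_ext (IH _ _ (fD v) (gD v)) => x Ux.
by rewrite (@deriveD _ _ _ f g)//; apply: diff_derivable; [exact: fd|exact: gd].
Qed.

Lemma smooth_onM k f g : smooth_on k U f -> smooth_on k U g ->
  smooth_on k U (fun x => f x * g x).
Proof.
elim: k f g => [|k IH] f g; first by move=> fc gc x Ux; exact: cvgM (fc x Ux) (gc x Ux).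
move=> sf sg; have [[fd fD] [gd gD]] := (sf, sg); split=> [x Ux|v].
  by apply: differentiableM; [exact: fd|exact: gd].
have := smooth_onD (IH _ _ (smooth_onW sf) (gD v)) (IH _ _ (smooth_onW sg) (fD v)).
apply: smooth_on_ext => x Ux.
by rewrite (@deriveM _ _ f g)//; apply: diff_derivable; [exact: fd|exact: gd].
Qed.

Lemma smooth_onN k f : smooth_on k U f -> smooth_on k U (fun x => - f x).
Proof.
move=> sf; apply: smooth_on_ext (smooth_onM (smooth_on_cst k (-1)) sf) => x _.
by rewrite mulN1r.
Qed.

Lemma smooth_onB k f g : smooth_on k U f -> smooth_on k U g ->
  smooth_on k U (fun x => f x - g x).
Proof. by move=> sf sg; apply: smooth_onD => //; exact: smooth_onN. Qed.

Lemma smooth_on_sum k (I : Type) (s : seq I) (P : pred I) (f : I -> E -> R) :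
  (forall i, smooth_on k U (f i)) ->
  smooth_on k U (fun x => \sum_(i <- s | P i) f i x).
Proof.
move=> sf; elim: s => [|i s IH].
  by apply: smooth_on_ext (smooth_on_cst k 0) => x _; rewrite big_nil.
have [Pi|nPi] := boolP (P i).
  by apply: smooth_on_ext (smooth_onD (sf i) IH) => x _; rewrite big_cons Pi.
by apply: smooth_on_ext IH => x _; rewrite big_cons (negbTE nPi).
Qed.

Lemma smooth_onX k f n : smooth_on k U f -> smooth_on k U (fun x => f x ^+ n).
Proof.
move=> sf; elim: n => [|n IH]; first exact: smooth_on_cst.
by apply: smooth_on_ext (smooth_onM sf IH) => x _; rewrite exprS.
Qed.

Lemma smooth_onV k f : (forall x, U x -> f x != 0) -> smooth_on k U f ->
  smooth_on k U (fun x => (f x)^-1).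
Proof.
move=> f0; elim: k => [|k IH].
  by move=> fc x Ux; apply: cvgV (fc x Ux); exact: f0.
move=> sf; have [fd fD] := sf; split=> [x Ux|v].
  by apply: differentiableV; [exact: fd|exact: f0].
have sV := IH (smooth_onW sf).
have := smooth_onM (smooth_onN (smooth_onM sV sV)) (fD v).
apply: smooth_on_ext => x Ux.
rewrite (@deriveV _ _ f); [|exact: f0|by apply: diff_derivable; exact: fd].
by rewrite -exprVn expr2.
Qed.

Lemma pos_part_powerS_derive n (u : R) :
  is_derive u 1 (fun u => Num.max 0 u ^+ n.+2) (n.+2%:R * Num.max 0 u ^+ n.+1).
Proof.
have [u0|u0] := ltP u 0.
- rewrite expr0n/= mulr0.
  apply: (@near_eq_is_derive _ _ _ (cst 0)).
  near=> y; rewrite /cst max_l ?expr0n//.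
  by rewrite ltW//; near: y; exact: lt_nbhsl.
move: u0; rewrite le_eqVlt => /predU1P[<-|u0].
  rewrite expr0n/= mulr0.
  have lim0 : (fun h : R => h^-1 *: (Num.max 0 ((h *: 1 + 0) : R) ^+ n.+2 -
      Num.max 0 (0 : R) ^+ n.+2 : R)) @ 0^' --> (0 : R).
    apply: (@cvg_trans _ ((fun h : R => Num.max 0 h ^+ n.+1) @ 0^')).
      apply: near_eq_cvg; near=> h.
      have h0 : h != 0 by near: h; exact: nbhs_dnbhs_neq.
      rewrite maxxx expr0n/= subr0 addr0 [h *: 1]mulr1 /GRing.scale/=.
      have [hn|hp] := ltP h 0; first by rewrite !expr0n/= ?mulr0.
      by rewrite (exprS _ n.+1) mulrA mulVf// mul1r.
    apply: cvg_within_filter.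
    have : {for (0:R), continuous (fun h : R => Num.max 0 h ^+ n.+1)}.
      apply: (@continuous_comp _ _ _ (fun h : R => Num.max 0 h)
        (fun y : R => y ^+ n.+1)); last exact: exprn_continuous.
      by apply: continuous_max; [exact: cvg_cst|exact: cvg_id].
    by rewrite /prop_for /continuous_at maxxx expr0n.
  apply: DeriveDef; first by apply/cvg_ex; exists 0.
  exact: cvg_lim lim0.
apply: (@near_eq_is_derive _ R R (fun y : R => y ^+ n.+2)).
  near=> y; rewrite max_r//; rewrite ltW//; near: y; exact: lt_nbhsr.
apply: DeriveDef; first exact: exprn_derivable.
by rewrite exp_derive /GRing.scale/= mulr1.
Unshelve. all: by end_near. Qed.

(** Each derivative lowers by one the exponent of the positive part, which is
   itself continuous. *)
Lemma smooth_on_pos_powerS k f : smooth_on k U f ->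
  smooth_on k U (fun x => Num.max 0 (f x) ^+ k.+1).
Proof.
elim: k => [|k IH] sf.
  move=> x Ux; apply: (@continuous_comp _ _ _ (fun x => Num.max 0 (f x))
    (fun y : R => y ^+ 1)); last exact: exprn_continuous.
  apply: (@continuous_max _ _ (fun=> 0)); last exact: sf.
  exact: cst_continuous.
have [fd fD] := sf.
pose g u : R := Num.max 0 u ^+ k.+2.
have gd u : differentiable g u.
  by apply/derivable1_diffP; have [h _] := pos_part_powerS_derive k u; exact: h.
have gD u v : 'd g u v = (k.+2%:R * Num.max 0 u ^+ k.+1) * v.
  rewrite diff1E// /GRing.scale/= mulrC; congr (_ * _).
  by rewrite derive1E; have [_ ->] := pos_part_powerS_derive k u.
split=> [x Ux|v].
  exact: (differentiable_comp (fd x Ux) (gd _)).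
have := smooth_onM (smooth_onM (smooth_on_cst k k.+2%:R) (IH (smooth_onW sf))) (fD v).
apply: smooth_on_ext => x Ux.
rewrite -[RHS]/('D_v (g \o f) x) [RHS]deriveE; last exact: (differentiable_comp (fd x Ux) (gd _)).
by rewrite diff_comp//; [rewrite /= gD -deriveE//; exact: fd|exact: fd].
Qed.

Lemma smooth_on_C_on k (F : E -> E) :
  (forall i, smooth_on k U (fun x => F x ord0 i)) -> C_on k U F.
Proof.
have FE (G : E -> E) : G = (\sum_(i < D) (fun x => G x ord0 i *: delta_mx ord0 i)).
  by apply/funext => x; rewrite fct_sumE -row_sum_delta.
elim: k F => [|k IH] F Fi.
  move=> x Ux.
  rewrite (FE F); apply: (big_ind (fun h : E -> E => {for x, continuous h})).
  - exact: cst_continuous.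
  - by move=> h1 h2 c1 c2; exact: continuousD.
  - move=> i _; have h : {for x, continuous (fun y => F y ord0 i)} := Fi i x Ux.
    by apply: (@cvgZr_tmp _ _ _ (nbhs x)); exact: h.
have Fd x : U x -> differentiable F x.
  move=> Ux; rewrite (FE F); apply: differentiable_sum => i.
  by apply: differentiableZl; exact: (Fi i).1.
split=> // v; apply: IH => i; apply: smooth_on_ext ((Fi i).2 v) => x Ux.
by rewrite derive_mx ?mxE//; apply: diff_derivable; exact: Fd.
Qed.

End smooth_scalar.

(** * The profile of the bump *)

Section bump_profile.
Context {R : realType}.
Implicit Types a b n : R.

(** The bump is the cube of this function of the distance to the axis. *)
Definition tent a : R := Num.max 0 (1 - a ^+ 2).

Lemma tent_ge0 a : 0 <= tent a.
Proof. by rewrite le_max lexx. Qed.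

Lemma tent_le1 a : tent a <= 1.
Proof. by rewrite ge_max ler01 lerBlDr lerDl sqr_ge0. Qed.

Lemma tentE_in a : 0 <= a <= 1 -> tent a = 1 - a ^+ 2.
Proof. by move=> /andP[a0 a1]; rewrite /tent max_r// subr_ge0 expr_le1. Qed.

Lemma tentE_out a : 1 <= a -> tent a = 0.
Proof. by move=> a1; rewrite /tent max_l// subr_le0 exprn_ege1. Qed.

Lemma tent_lip a b n : 0 <= a -> 0 <= b -> `|a - b| <= n ->
  `|tent b - tent a| <= 2 * n.
Proof.
move=> a0 b0 abn; have n0 : 0 <= n by exact: le_trans abn.
move: abn; rewrite ler_norml => /andP[h1 h2]; rewrite ler_norml.
have [a1|a1] := leP a 1; have [b1|b1] := leP b 1.
- have ab : 0 <= a + b by lra.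
  have ab2 : 0 <= 2 - (a + b) by lra.
  have n1 : 0 <= n + (a - b) by lra.
  have n2 : 0 <= n - (a - b) by lra.
  have := mulr_ge0 n1 ab; have := mulr_ge0 n2 ab; have := mulr_ge0 n0 ab2.
  by rewrite !tentE_in ?a0 ?b0// => *; apply/andP; split; lra.
- by rewrite (tentE_out (ltW b1)) tentE_in ?a0//; apply/andP; split; nra.
- by rewrite (tentE_out (ltW a1)) tentE_in ?b0//; apply/andP; split; nra.
- by rewrite (tentE_out (ltW a1)) (tentE_out (ltW b1)); apply/andP; split; lra.
Qed.

Lemma tent_cube_lip a b n : 0 <= a -> 0 <= b -> `|a - b| <= n ->
  `|tent b ^+ 3 - tent a ^+ 3| <= 6 * n.
Proof.
move=> a0 b0 abn; have := tent_lip a0 b0 abn.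
have := tent_ge0 a; have := tent_le1 a; have := tent_ge0 b; have := tent_le1 b.
set p := tent a; set q := tent b => q1 q0 p1 p0 pq.
have -> : q ^+ 3 - p ^+ 3 = (q - p) * (q ^+ 2 + p * q + p ^+ 2) by ring.
have qp0 : 0 <= p * q by rewrite mulr_ge0.
have m0 : 0 <= q ^+ 2 + p * q + p ^+ 2 by rewrite !addr_ge0 ?sqr_ge0.
have m3 : q ^+ 2 + p * q + p ^+ 2 <= 3.
  by rewrite (_ : 3 = 1 + 1 + 1) ?lerD ?expr_le1 ?mulr_ile1//; ring.
rewrite normrM (ger0_norm m0) mulrC.
apply: (le_trans (ler_wpM2r (normr_ge0 _) m3)); lra.
Qed.

(** The Taylor remainder of a cube is quadratic; when [tent] vanishes at one of
   the two points, its value at the other one is at most [2 * n]. *)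
Lemma tent_cube_taylor a b n : 0 <= a -> 0 <= b -> `|a - b| <= n ->
  `|tent b ^+ 3 - tent a ^+ 3 + 3 * tent a ^+ 2 * (b ^+ 2 - a ^+ 2)| <= 15 * n ^+ 2.
Proof.
move=> a0 b0 abn; have n0 : 0 <= n by exact: le_trans abn.
move: abn; rewrite ler_norml => /andP[h1 h2]; rewrite ler_norml.
have [a1|a1] := leP a 1; have [b1|b1] := leP b 1.
- rewrite !tentE_in ?a0 ?b0//.
  have -> : (1 - b ^+ 2) ^+ 3 - (1 - a ^+ 2) ^+ 3 + 3 * (1 - a ^+ 2) ^+ 2 * (b ^+ 2 - a ^+ 2)
      = (b - a) ^+ 2 * ((b + a) ^+ 2 * (3 - 2 * a ^+ 2 - b ^+ 2)) by ring.
  have ba : 0 <= (b - a) ^+ 2 <= n ^+ 2 by rewrite sqr_ge0/=; nra.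
  have u : 0 <= (b + a) ^+ 2 <= 4 by apply/andP; split; nra.
  have v : 0 <= 3 - 2 * a ^+ 2 - b ^+ 2 <= 3 by apply/andP; split; nra.
  have : 0 <= (b + a) ^+ 2 * (3 - 2 * a ^+ 2 - b ^+ 2) <= 12 by apply/andP; split; nra.
  move: (_ * _) ((b - a) ^+ 2) ba => p q /andP[q0 q1] /andP[p0 p1].
  by apply/andP; split; nra.
- rewrite (tentE_out (ltW b1)) tentE_in ?a0//.
  have p0 : 0 <= 1 - a ^+ 2 <= 1 by apply/andP; split; nra.
  have pn : 1 - a ^+ 2 <= 2 * n by nra.
  have dl : 0 <= b ^+ 2 - a ^+ 2 <= 2 * n + n ^+ 2 by apply/andP; split; nra.
  have ap : 1 - a ^+ 2 <= b ^+ 2 - a ^+ 2 by nra.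
  move: (1 - _) (b ^+ 2 - _) p0 pn dl ap => p q /andP[p0 p1] pn /andP[q0 qn] pq.
  have pp : p ^+ 2 <= 2 * n by nra.
  have pp4 : p ^+ 2 * (2 * n) <= 4 * n ^+ 2 by nra.
  have pp1 : p ^+ 2 <= 1 by nra.
  have pp5 : p ^+ 2 * n ^+ 2 <= n ^+ 2 by nra.
  have key : p ^+ 2 * q <= 5 * n ^+ 2.
    by apply: le_trans (_ : _ <= p ^+ 2 * (2 * n + n ^+ 2)) _; nra.
  have pq0 : p ^+ 3 <= p ^+ 2 * q by rewrite exprSr; nra.
  have p3 : 0 <= p ^+ 3 by rewrite exprn_ge0.
  by apply/andP; split; nra.
- rewrite (tentE_out (ltW a1)) tentE_in ?b0//.
  have p0 : 0 <= 1 - b ^+ 2 <= 1 by apply/andP; split; nra.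
  have pn : 1 - b ^+ 2 <= 2 * n by nra.
  move: (1 - b ^+ 2) p0 pn => p /andP[p0 p1] pn.
  have p3 : 0 <= p ^+ 3 by rewrite exprn_ge0.
  have pp : p ^+ 2 <= 4 * n ^+ 2 by nra.
  have p32 : p ^+ 3 <= p ^+ 2 by rewrite exprS; nra.
  by rewrite !expr0n/=; apply/andP; split; nra.
- rewrite (tentE_out (ltW a1)) (tentE_out (ltW b1)) !expr0n/=.
  by apply/andP; split; nra.
Qed.

End bump_profile.

(** * The ball sheared by a bump *)

Section body.
Context {R : realType} {D : nat} {k : nat}.
Local Notation E := 'rV[R]_D.
Local Notation d := k.+1.
Hypothesis dD : (d <= D)%N.
Implicit Types (x y z v : E).

(** The axis of the bodies is the last flat coordinate, which is also the one
   bounded below in the model half-space. *)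
Definition star : 'I_D := Ordinal dD.

Definition pole_vec : E := delta_mx ord0 star.

Definition height x : R := x ord0 star.

Definition lateral x : E := \row_j if (j < k)%N then x ord0 j else 0.

Lemma hgtD x y : height (x + y) = height x + height y. Proof. by rewrite /height mxE. Qed.
Lemma hgtZ a x : height (a *: x) = a * height x. Proof. by rewrite /height mxE. Qed.
Lemma hgt_pole : height pole_vec = 1. Proof. by rewrite /height mxE !eqxx. Qed.
Lemma hgt_lat x : height (lateral x) = 0. Proof. by rewrite /height mxE /= ltnn. Qed.

Lemma latD x y : lateral (x + y) = lateral x + lateral y.
Proof. by apply/rowP => j; rewrite !mxE; case: ifP; rewrite ?addr0. Qed.
Lemma latZ a x : lateral (a *: x) = a *: lateral x.
Proof. by apply/rowP => j; rewrite !mxE; case: ifP; rewrite ?mulr0. Qed.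
Lemma lat_pole : lateral pole_vec = 0.
Proof.
apply/rowP => j; rewrite !mxE; case: ifP => // jk; rewrite eqxx/=.
by case: eqP => // js; move: jk; rewrite js /= ltnn.
Qed.
Lemma lat_lat x : lateral (lateral x) = lateral x.
Proof. by apply/rowP => j; rewrite !mxE; case: (j < k)%N. Qed.

Lemma flat_decomp x : flat d x -> x = height x *: pole_vec + lateral x.
Proof.
move=> fx; apply/rowP => j; rewrite !mxE eqxx/=.
have [->|js] := eqVneq j star; first by rewrite /= ltnn mulr1 addr0.
rewrite mulr0 add0r; case: ltnP => // kj; apply: fx.
by rewrite ltn_neqAle kj andbT; apply: contra js => /eqP jk; apply/eqP/val_inj.
Qed.

Lemma flat_pole : flat d pole_vec.
Proof.
move=> i di; rewrite mxE eqxx/=; case: eqP => // /(congr1 val)/= is_.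
by move: di; rewrite is_ ltnn.
Qed.

Lemma flat_lat x : flat d (lateral x).
Proof. by move=> i di; rewrite mxE ltnNge (ltnW di). Qed.

Lemma dot_pole x : dot pole_vec x = height x.
Proof.
rewrite /dot (bigD1 star)//= big1 ?addr0; last first.
  by move=> j js; rewrite mxE eqxx/= (negbTE js) mul0r.
by rewrite mxE !eqxx mul1r.
Qed.

Lemma dot_lat x y : dot (lateral x) y = dot (lateral x) (lateral y).
Proof. by apply: eq_bigr => j _; rewrite !mxE; case: ifP => // _; rewrite !mul0r. Qed.

Lemma dot_decomp x y : flat d x ->
  dot x y = height x * height y + dot (lateral x) (lateral y).
Proof.
by move=> fx; rewrite {1}(flat_decomp fx) dotDl dotZl dot_pole dot_lat.
Qed.

Context {r rho : R} (eps : R).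
Hypotheses (r0 : 0 < r) (rho0 : 0 < rho) (rhor : rho <= r / 2)
  (epsr : `|eps| <= rho ^+ 2 / (100 * r)).

Definition bump_tent x : R := tent (enorm (lateral x) / rho).
Definition bump_fun x : R := eps * bump_tent x ^+ 3.
Definition lifted_height x : R := height x + bump_fun x.
(** On flat vectors, the squared norm after translating each line parallel to
   the axis by the bump. *)
Definition level_fun x : R := lifted_height x ^+ 2 + dot (lateral x) (lateral x).
Definition kappa x : R := 2 - 12 * lifted_height x * eps / rho ^+ 2 * bump_tent x ^+ 2.
(** The gradient of [level_fun]; its lateral part [kappa] adds up the derivatives
   of the squared norm and of the bump. *)
Definition level_grad x : E := (2 * lifted_height x) *: pole_vec + kappa x *: lateral x.

Lemma flat_grad x : flat d (level_grad x).
Proof. by apply: flatD; apply: flatZ; [exact: flat_pole|exact: flat_lat]. Qed.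

Lemma hgt_grad x : height (level_grad x) = 2 * lifted_height x.
Proof. by rewrite hgtD !hgtZ hgt_pole hgt_lat mulr1 mulr0 addr0. Qed.

Lemma lat_grad x : lateral (level_grad x) = kappa x *: lateral x.
Proof. by rewrite latD !latZ lat_pole lat_lat scaler0 add0r. Qed.

Lemma dot_grad x v : dot (level_grad x) v =
  2 * lifted_height x * height v + kappa x * dot (lateral x) (lateral v).
Proof. by rewrite dotDl !dotZl dot_pole dot_lat. Qed.

Lemma eps_rho : `|eps| / rho ^+ 2 <= 1 / (100 * r).
Proof.
by rewrite ler_pdivrMr ?exprn_gt0// mul1r mulrC.
Qed.

Lemma bump_bound x : `|bump_fun x| <= `|eps|.
Proof.
rewrite normrM -[leRHS]mulr1 ler_wpM2l//.
by rewrite ger0_norm ?exprn_ile1 ?exprn_ge0// ?tent_ge0 ?tent_le1.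
Qed.

Lemma eps_small : `|eps| <= r / 400.
Proof.
apply: (le_trans epsr); rewrite ler_pdivrMr; last by rewrite mulr_gt0.
have : rho ^+ 2 <= (r / 2) ^+ 2 by rewrite lerXn2r// nnegrE ?divr_ge0// ltW.
by rewrite expr_div_n => h; apply: (le_trans h); lra.
Qed.

Lemma kappa_bound x : `|lifted_height x| <= 2 * r -> 7 / 4 <= kappa x.
Proof.
move=> ax; rewrite /kappa.
rewrite (_ : 12 * _ * _ / _ * _ =
  12 * (lifted_height x * (eps / rho ^+ 2) * bump_tent x ^+ 2)); last by ring.
have : `|lifted_height x * (eps / rho ^+ 2)| <= 1 / 50.
  have -> : 1 / 50 = 2 * r * (1 / (100 * r)) by field; rewrite gt_eqF.
  rewrite normrM ler_pM// normrM (ger0_norm (_ : 0 <= (rho ^+ 2)^-1)) ?eps_rho//.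
  by rewrite invr_ge0 exprn_ge0// ltW.
have : 0 <= bump_tent x ^+ 2 by rewrite exprn_ge0// tent_ge0.
have : bump_tent x ^+ 2 <= 1 by rewrite exprn_ile1// ?tent_ge0 ?tent_le1.
move: (lifted_height x * _) (bump_tent x ^+ 2) => a b b1 b0; rewrite ler_norml => /andP[_ a1].
have : a * b <= 1 / 50 * b by rewrite ler_wpM2r.
lra.
Qed.

(** Two-sided second order expansion: the bump is so flat that the level
   function keeps a Hessian between 0 and 4, as for the round ball. *)
Lemma level_taylor x v : `|lifted_height x| <= 2 * r ->
  0 <= level_fun (x + v) - level_fun x - dot (level_grad x) v
    <= 2 * (height v ^+ 2 + dot (lateral v) (lateral v)).
Proof.
move=> ax; rewrite dot_grad.
pose al := enorm (lateral x) / rho; pose be := enorm (lateral (x + v)) / rho.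
pose n := enorm (lateral v) / rho.
have al0 : 0 <= al by rewrite divr_ge0 ?enorm_ge0 ?ltW.
have be0 : 0 <= be by rewrite divr_ge0 ?enorm_ge0 ?ltW.
have n0 : 0 <= n by rewrite divr_ge0 ?enorm_ge0 ?ltW.
have abn : `|al - be| <= n.
  rewrite -mulrBl normrM (gtr0_norm (_ : 0 < rho^-1)) ?invr_gt0//.
  rewrite ler_pM2r ?invr_gt0// ler_norml.
  have h1 := ler_enormD (lateral x) (lateral v).
  have h2 := ler_enormD (lateral x + lateral v) (- lateral v).
  by move: h1 h2; rewrite addrK enormN -latD => h1 h2; apply/andP; split; lra.
have := tent_cube_taylor al0 be0 abn; have := tent_cube_lip al0 be0 abn.
rewrite -/(bump_tent x) -/(bump_tent (x + v)).
set m := bump_tent x; set m' := bump_tent (x + v) => lip tay.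
have m0 : 0 <= m by exact: tent_ge0.
have m1 : m <= 1 by exact: tent_le1.
pose q := eps * (m' ^+ 3 - m ^+ 3).
pose e := eps * (m' ^+ 3 - m ^+ 3 + 3 * m ^+ 2 * (be ^+ 2 - al ^+ 2))
  - eps * (3 * m ^+ 2 * n ^+ 2).
have Nn : dot (lateral v) (lateral v) = rho ^+ 2 * n ^+ 2.
  by rewrite -sqr_enorm exprMn exprVn mulrCA divff ?mulr1// expf_neq0// gt_eqF.
have Yv : 2 * dot (lateral x) (lateral v) = rho ^+ 2 * (be ^+ 2 - al ^+ 2 - n ^+ 2).
  rewrite !exprMn !sqr_enorm exprVn latD !(dotDl, dotDr) (dotC (lateral v) (lateral x)).
  by field; rewrite gt_eqF.
have expand : level_fun (x + v) - level_fun x -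
    (2 * lifted_height x * height v + kappa x * dot (lateral x) (lateral v))
    = 2 * lifted_height x * e + (height v + q) ^+ 2 + dot (lateral v) (lateral v).
  have -> : level_fun (x + v) = (lifted_height x + (height v + q)) ^+ 2 +
      (dot (lateral x) (lateral x) + 2 * dot (lateral x) (lateral v) + dot (lateral v) (lateral v)).
    rewrite /level_fun /lifted_height /bump_fun -/m -/m' hgtD latD.
    rewrite !(dotDl, dotDr) (dotC (lateral v) (lateral x)) /q.
    by ring.
  have -> : kappa x * dot (lateral x) (lateral v) = 2 * dot (lateral x) (lateral v) -
      6 * lifted_height x * eps / rho ^+ 2 * m ^+ 2 * (2 * dot (lateral x) (lateral v)).
    by rewrite /kappa -/m; ring.
  rewrite {3}Yv /level_fun /e /q; move: (dot _ _) (dot _ _) (dot _ _) => X Y Z.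
  by field; rewrite gt_eqF.
have er : `|eps| = `|eps| / rho ^+ 2 * rho ^+ 2 by rewrite divfK// expf_neq0// gt_eqF.
have rho20 : 0 < rho ^+ 2 by rewrite exprn_gt0.
have e_le : `|2 * lifted_height x * e| <= 18 / 25 * dot (lateral v) (lateral v).
  have : `|e| <= `|eps| * (18 * n ^+ 2).
    rewrite /e -mulrBr normrM ler_wpM2l// (le_trans (ler_normB _ _))//.
    have h : `|3 * m ^+ 2 * n ^+ 2| <= 3 * n ^+ 2.
      rewrite ger0_norm; last by rewrite mulr_ge0 ?sqr_ge0// mulr_ge0 ?sqr_ge0.
      by rewrite ler_wpM2r ?sqr_ge0// ler_piMr// exprn_ile1.
    by apply: (le_trans (lerD tay h)); lra.
  have h2 := eps_rho.
  rewrite er Nn !normrM (ger0_norm (_ : 0 <= 2))// => h.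
  have h3 : `|e| <= 1 / (100 * r) * (18 * (rho ^+ 2 * n ^+ 2)).
    apply: (le_trans h).
    rewrite (_ : `|eps| / rho ^+ 2 * rho ^+ 2 * _ =
      (`|eps| / rho ^+ 2) * (18 * (rho ^+ 2 * n ^+ 2))); last by ring.
    by rewrite ler_wpM2r// mulr_ge0// mulr_ge0// sqr_ge0.
  have h4 : `|lifted_height x| * `|e| <= 2 * r * (1 / (100 * r) * (18 * (rho ^+ 2 * n ^+ 2))).
    by apply: ler_pM.
  rewrite -mulrA; apply: (@le_trans _ _
    (2 * (2 * r * (1 / (100 * r) * (18 * (rho ^+ 2 * n ^+ 2)))))).
    by rewrite ler_pM2l.
  by rewrite le_eqVlt; apply/orP; left; apply/eqP; field; rewrite gt_eqF.
have q_le : q ^+ 2 <= 1 / 1000 * dot (lateral v) (lateral v).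
  have : `|q| <= 6 / 200 * (rho * n).
    rewrite /q normrM; apply: (le_trans (ler_pM _ _ epsr lip)) => //.
    have -> : rho ^+ 2 / (100 * r) * (6 * n) = 6 / 100 * (rho / r) * (rho * n).
      by field; rewrite gt_eqF.
    have : rho / r <= 1 / 2 by rewrite ler_pdivrMr// mul1r mulrC.
    move: (rho / r) => t ht; apply: ler_wpM2r; first by rewrite mulr_ge0// ltW.
    lra.
  move=> hq; have rn0 : 0 <= rho * n by rewrite mulr_ge0// ltW.
  have : `|q| ^+ 2 <= (6 / 200 * (rho * n)) ^+ 2.
    by rewrite lerXn2r// nnegrE mulr_ge0.
  rewrite real_normK ?num_real// => h; apply: (le_trans h).
  by rewrite Nn -exprMn exprMn; have := sqr_ge0 (rho * n); lra.
have v0 : 0 <= dot (lateral v) (lateral v) by exact: dot_ge0.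
rewrite expand; move: e_le; rewrite ler_norml => /andP[e1 e2].
have := sqr_ge0 (height v + q); have := sqr_ge0 (height v - q).
rewrite !sqrrD sqrrN => h1 h2.
by apply/andP; split; lra.
Qed.

End body.

Section body_geometry.
Context {R : realType} {D : nat} {k : nat}.
Local Notation E := 'rV[R]_D.
Local Notation d := k.+1.
Hypothesis dD : (d <= D)%N.
Implicit Types (x y z v m : E).
Context {r rho : R} (eps : R).
Hypotheses (r0 : 0 < r) (rho0 : 0 < rho) (rhor : rho <= r / 2)
  (epsr : `|eps| <= rho ^+ 2 / (100 * r)).

Local Notation hgt := (height dD).
Local Notation lat := (@lateral R D k).
Local Notation lift := (lifted_height dD (rho := rho) eps).
Local Notation level := (level_fun dD (rho := rho) eps).
Local Notation grad := (level_grad dD (rho := rho) eps).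
Local Notation bump := (@bump_fun R D k rho eps).

Definition body : set E := [set x | flat d x /\ level x <= r ^+ 2].
Definition rim : set E := [set x | flat d x /\ level x = r ^+ 2].

Lemma rim_body : rim `<=` body.
Proof. by move=> x [fx lx]; split => //; rewrite lx. Qed.

Lemma lift_body x : level x <= r ^+ 2 -> `|lift x| <= r.
Proof.
move=> lx; rewrite -ler_sqr ?nnegrE ?(ltW r0)// real_normK ?num_real//.
by apply: le_trans lx; rewrite lerDl dot_ge0.
Qed.

Lemma hgt_body x : level x <= r ^+ 2 -> `|hgt x| <= r + `|eps|.
Proof.
move=> lx; rewrite (_ : hgt x = lift x - bump x); last by rewrite /lifted_height addrK.
by rewrite (le_trans (ler_normB _ _))// lerD ?lift_body ?bump_bound.
Qed.

(** The convex hull of the body stays in the region where [level_taylor]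
   applies. *)
Lemma lift_hull z a b : `|a| <= r + `|eps| -> `|b| <= r + `|eps| ->
  (exists2 t, 0 <= t <= 1 & hgt z = t * a + (1 - t) * b) -> `|lift z| <= 2 * r.
Proof.
move=> ha hb [t /andP[t0 t1] ht].
have hz : `|hgt z| <= r + `|eps|.
  rewrite ht (le_trans (ler_normD _ _))// !normrM (ger0_norm t0).
  rewrite (ger0_norm (_ : 0 <= 1 - t)) ?subr_ge0//.
  have : t * `|a| <= t * (r + `|eps|) by rewrite ler_wpM2l.
  have : (1 - t) * `|b| <= (1 - t) * (r + `|eps|) by rewrite ler_wpM2l ?subr_ge0.
  lra.
have es : `|eps| <= r / 400 := eps_small r0 rho0 rhor epsr.
have h : r + `|eps| + `|eps| <= 2 * r by have := r0; lra.
apply: (le_trans (ler_normD _ _)); apply: le_trans (lerD hz (bump_bound _ _)) h.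
Qed.

(** The tangent plane at the intermediate point lies below the graph at both
   ends. *)
Lemma level_convex x y t : body x -> body y -> 0 <= t <= 1 ->
  level (t *: x + (1 - t) *: y) <= t * level x + (1 - t) * level y.
Proof.
move=> [fx lx] [fy ly] t01.
set z := t *: x + _; have az : `|lift z| <= 2 * r.
  apply: (lift_hull (hgt_body lx) (hgt_body ly)); exists t => //.
  by rewrite /z hgtD !hgtZ.
have hx := level_taylor r0 rho0 rhor epsr (x - z) az.
have hy := level_taylor r0 rho0 rhor epsr (y - z) az.
move: hx hy; rewrite !(addrC z) !subrK => /andP[hx _] /andP[hy _].
have zxy : t * dot (grad z) (x - z) + (1 - t) * dot (grad z) (y - z) = 0.
  rewrite -!dotZr -dotDr (_ : _ + _ = 0) ?dot0r//.
  by apply/rowP => i; rewrite /z !mxE; ring.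
case/andP: t01 => t0 t1.
have t1' : 0 <= 1 - t by rewrite subr_ge0.
have := mulr_ge0 t0 hx; have := mulr_ge0 t1' hy.
lra.
Qed.

Lemma body_convex x y t : body x -> body y -> 0 <= t <= 1 ->
  body (t *: x + (1 - t) *: y).
Proof.
move=> bx by_ t01; have [[fx lx] [fy ly]] := (bx, by_); have /andP[t0 t1] := t01.
split; first by apply: flatD; exact: flatZ.
apply: (le_trans (level_convex bx by_ t01)).
have t1' : 0 <= 1 - t by rewrite subr_ge0.
have := ler_wpM2l t0 lx; have := ler_wpM2l t1' ly; lra.
Qed.

Lemma dot_body x : body x -> dot x x <= (4 * r) ^+ 2.
Proof.
move=> [fx lx]; rewrite (@dot_decomp R D k dD _ _ fx).
have h1 : `|hgt x| <= 2 * r.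
  by apply: (le_trans (hgt_body lx)); have := r0; have := eps_small r0 rho0 rhor epsr; lra.
have h2 : dot (lat x) (lat x) <= r ^+ 2.
  by apply: le_trans lx; rewrite lerDr sqr_ge0.
have : `|hgt x| ^+ 2 <= (2 * r) ^+ 2.
  by rewrite lerXn2r// nnegrE mulr_ge0 ?ltW.
rewrite real_normK ?num_real// -expr2 !exprMn; have := sqr_ge0 r; lra.
Qed.

Lemma dot_grad_rim x : rim x -> r ^+ 2 <= dot (grad x) (grad x).
Proof.
move=> [fx lx].
have ax : `|lift x| <= 2 * r.
  by rewrite (le_trans (lift_body _)) ?lx//; have := r0; lra.
have kx := kappa_bound r0 rho0 epsr ax.
rewrite dot_grad hgt_grad lat_grad dotZr -lx /level_fun.
have := dot_ge0 (lat x); have := sqr_ge0 (lift x).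
move: (kappa _ _ _) kx (dot _ _) (lifted_height _ _ _) => K K1 X a a0 X0.
have : 49 / 16 * X <= K * (K * X) by rewrite mulrA ler_wpM2r//; nra.
lra.
Qed.

Lemma smooth_bump (U : set E) (F : E -> E) : open U ->
  (forall i, smooth_on 2 U (fun x => F x ord0 i)) ->
  smooth_on 2 U (fun x => bump (F x)).
Proof.
move=> Uo sF; have sl i : smooth_on 2 U (fun x => lat (F x) ord0 i).
  have [ik|ik] := boolP (i < k)%N.
    by apply: smooth_on_ext (sF i) => // x _; rewrite mxE ik.
  by apply: smooth_on_ext (smooth_on_cst Uo 2 0) => // x _; rewrite mxE (negbTE ik).
have : smooth_on 2 U (fun x =>
    1 - (\sum_(i < D) lat (F x) ord0 i * lat (F x) ord0 i) * (rho ^+ 2)^-1).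
  apply: (smooth_onB Uo (smooth_on_cst Uo 2 1)).
  apply: (smooth_onM Uo _ (smooth_on_cst Uo 2 _)).
  apply: (@smooth_on_sum _ _ U Uo 2 _ _ _
    (fun i x => lat (F x) ord0 i * lat (F x) ord0 i)) => i.
  exact: (smooth_onM Uo (sl i) (sl i)).
move=> /(smooth_on_pos_powerS Uo) /(smooth_onM Uo (smooth_on_cst Uo 2 eps)).
apply: smooth_on_ext => // x _; congr (_ * Num.max 0 (1 - _) ^+ 3).
by rewrite /= exprMn exprVn sqr_enorm.
Qed.

Lemma smooth_level (U : set E) : open U -> smooth_on 2 U level.
Proof.
move=> Uo.
have sc i : smooth_on 2 U (fun x => x ord0 i) by exact: smooth_on_coord.
apply: (smooth_onD Uo).
  apply: (@smooth_onX _ _ U Uo 2 _ 2); apply: (smooth_onD Uo (sc _)).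
  exact: (smooth_bump Uo sc).
apply: (@smooth_on_sum _ _ U Uo 2 _ _ _ (fun i x => lat x ord0 i * lat x ord0 i)) => i.
have [ik|ik] := boolP (i < k)%N.
  apply: smooth_on_ext (smooth_onM Uo (sc i) (sc i)) => // x _.
  by rewrite mxE ik.
apply: smooth_on_ext (smooth_on_cst Uo 2 0) => // x _.
by rewrite mxE (negbTE ik) mul0r.
Qed.

Lemma level_continuous : continuous level.
Proof.
have /smooth_onW/smooth_onW/= h := smooth_level openT.
by move=> x; apply: h => //; exact: openT.
Qed.

Lemma flat_closed : closed (flat d : set E).
Proof.
have -> : (flat d : set E) = \bigcap_(i in [set i : 'I_D | (d <= i)%N])
    ((fun x : E => x ord0 i) @^-1` [set 0]).
  by apply/seteqP; split => x fx i; apply: fx.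
apply: closed_bigI => i _; apply: preimage_closed; last exact: closed_eq.
by move=> x _; exact: coord_continuous.
Qed.

Lemma body_closed : closed body.
Proof.
apply: closedI; first exact: flat_closed.
apply: (@preimage_closed _ _ level [set y | y <= r ^+ 2]).
  by move=> x _; exact: level_continuous.
exact: closed_le.
Qed.

Lemma rim_closed : closed rim.
Proof.
apply: closedI; first exact: flat_closed.
apply: (@preimage_closed _ _ level [set r ^+ 2]).
  by move=> x _; exact: level_continuous.
exact: closed_eq.
Qed.

Lemma body_bounded : bounded_set body.
Proof.
exists (4 * r); split; first exact: num_real.
move=> M rM x bx; apply: le_trans (norm_le_enorm _) _.
have M0 : 0 <= M by apply: le_trans (ltW rM); rewrite mulr_ge0// ltW.
rewrite enorm_le//; apply: (le_trans (dot_body bx)).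
by rewrite lerXn2r ?nnegrE ?mulr_ge0// ltW.
Qed.

Lemma body_compact : compact body.
Proof. exact: bounded_closed_compact body_bounded body_closed. Qed.

Lemma rim_compact : compact rim.
Proof.
by apply: subclosed_compact rim_closed body_compact _; exact: rim_body.
Qed.

End body_geometry.

(** * Reach of convex sets and of the rim *)

Section euclid_reach.
Context {R : realType} {D : nat}.
Local Notation E := 'rV[R]_D.

Lemma dot_comb (t s : R) (x y : E) :
  dot (t *: x + s *: y) (t *: x + s *: y) =
  t ^+ 2 * dot x x + 2 * t * s * dot x y + s ^+ 2 * dot y y.
Proof. by rewrite !(dotDl, dotDr, dotZl, dotZr) (dotC y x); ring. Qed.

Lemma nearest_dot (S : set E) (z x b : E) :
  (enorm (z - x))%:E = dist_to z S -> S b -> 2 * dot (z - x) (b - x) <= dot (b - x) (b - x).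
Proof.
move=> zx Sb; have := dist_to_le z Sb; rewrite -zx lee_fin.
rewrite enorm_le ?enorm_ge0// sqr_enorm.
have -> : z - b = (z - x) - (b - x) by apply/rowP => i; rewrite !mxE; ring.
rewrite (dotBl (z - x)) !(dotBr _ (z - x)) (dotC (b - x) (z - x)); lra.
Qed.

(** The midpoint of two nearest points would be nearer. *)
Lemma reach_convex (S : set E) :
  (forall x y, S x -> S y -> S ((2^-1 : R) *: x + (1 - 2^-1) *: y)) ->
  reach S = +oo%E.
Proof.
move=> Scvx; rewrite /reach (_ : [set _ | _ in _] = set0) ?ereal_inf0//.
rewrite -subset0 => t [z [x [y [Sx Sy xy zx zy]]] _].
suff : x = y by move/xy.
have h := nearest_dot zx Sy; have h' := nearest_dot zx (Scvx _ _ Sx Sy).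
have h'' := nearest_dot zy Sx.
have hm : 2^-1 *: x + (1 - 2^-1) *: y - x = 2^-1 *: (y - x).
  by apply/rowP => i; rewrite !mxE; field.
move: h'; rewrite hm !dotZr dotZl => h'.
have e : dot (z - x) (z - x) = dot (z - y) (z - y).
  by rewrite -!sqr_enorm; congr (_ ^+ 2); apply: EFin_inj; rewrite zx zy.
have e' : 2 * dot (z - x) (y - x) = dot (y - x) (y - x).
  have zxy : z - y = (z - x) - (y - x) by apply/rowP => i; rewrite !mxE; ring.
  move: e; rewrite zxy (dotBl (z - x)) !(dotBr _ (z - x)) (dotC (y - x) (z - x)); lra.
have : dot (y - x) (y - x) = 0 by have := dot_ge0 (y - x); lra.
by move=> /dot_eq0/eqP; rewrite subr_eq0 => /eqP.
Qed.

End euclid_reach.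

Section rim_reach.
Context {R : realType} {D : nat} {k : nat}.
Local Notation E := 'rV[R]_D.
Local Notation d := k.+1.
Hypothesis dD : (d <= D)%N.
Implicit Types (x y z v m : E).
Context {r rho : R} (eps : R).
Hypotheses (r0 : 0 < r) (rho0 : 0 < rho) (rhor : rho <= r / 2)
  (epsr : `|eps| <= rho ^+ 2 / (100 * r)).

Local Notation hgt := (height dD).
Local Notation pole := (pole_vec dD).
Local Notation lat := (@lateral R D k).
Local Notation lift := (lifted_height dD (rho := rho) eps).
Local Notation level := (level_fun dD (rho := rho) eps).
Local Notation grad := (level_grad dD (rho := rho) eps).
Local Notation rim := (@rim R D k dD r rho eps).

(** First order condition: otherwise the tangential part [w] of [m] would
   point to nearer points of the rim, found by the intermediate value
   theorem on the segments in the direction of the gradient. *)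
Lemma rim_normal x m : rim x -> flat d m ->
  (forall b, rim b -> 2 * dot m (b - x) <= dot (b - x) (b - x)) ->
  exists mu, m = mu *: grad x.
Proof.
move=> rx fm min_; have [fx lx] := rx.
have ax : `|lift x| <= 2 * r.
  by rewrite (le_trans (lift_body r0 _)) ?lx//; have := r0; lra.
set g := grad x; pose N := dot g g; pose P := dot m g.
have N0 : 0 < N by rewrite (lt_le_trans _ (dot_grad_rim r0 rho0 epsr rx))// exprn_gt0.
exists (P / N); pose w := m - (P / N) *: g.
suff : w = 0 by move/eqP; rewrite subr_eq0 => /eqP.
apply: contrapT => /eqP w0; pose W := dot w w.
have W0 : 0 < W by exact: dot_gt0.
have wg : dot w g = 0.
  by rewrite dotBl dotZl -/P -/N divfK ?subrr// gt_eqF.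
have mw : dot m w = W.
  rewrite (_ : m = w + (P / N) *: g); last by rewrite /w subrK.
  by rewrite dotDl dotZl (dotC g) wg mulr0 addr0.
have fg : flat d g by exact: flat_grad.
have fw : flat d w by apply: flat_sub => //; exact: flatZ.
(* [K] is such that a step [- K * t ^ 2] along [g] compensates a step [t] along [w] *)
pose K := 4 * W / N.
have K0 : 0 < K by rewrite divr_gt0// mulr_gt0.
pose Q := 2 * W + 2 * K * `|P|.
have Q0 : 0 < Q by rewrite ltr_wpDr ?mulr_gt0// mulr_ge0// mulr_ge0// ltW.
pose t := Num.min 1 (Num.min (N / (16 * W)) (W / Q)).
have t0 : 0 < t by rewrite !lt_min ltr01/= !divr_gt0// mulr_gt0.
have tt : t ^+ 2 <= t by rewrite expr2 ger_pMr// ge_min lexx.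
have t1 : t * (16 * W) <= N.
  by rewrite -ler_pdivlMr ?mulr_gt0// !ge_min lexx/= orbT.
have tQ : t * Q <= W by rewrite -ler_pdivlMr// !ge_min lexx !orbT.
have KN : K * N = 4 * W by rewrite /K divfK// gt_eqF.
have tK : t ^+ 2 * K ^+ 2 * N <= W.
  have : t ^+ 2 * (16 * W) <= N by apply: le_trans t1; rewrite ler_wpM2r// mulr_ge0// ltW.
  rewrite (_ : t ^+ 2 * K ^+ 2 * N = t ^+ 2 * (K * N) * (K * N) / N); last first.
    by field; rewrite gt_eqF.
  by rewrite KN ler_pdivrMr//; have := W0; nra.
pose f s := level (x + (t *: w + s *: g)).
have dotv s : dot (t *: w + s *: g) (t *: w + s *: g) = t ^+ 2 * W + s ^+ 2 * N.
  rewrite dot_comb wg -/W -/N; ring.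
have fv s : flat d (t *: w + s *: g) by apply: flatD; exact: flatZ.
have fs s : 0 <= f s - r ^+ 2 - s * N <= 2 * (t ^+ 2 * W + s ^+ 2 * N).
  have := level_taylor r0 rho0 rhor epsr (t *: w + s *: g) ax.
  rewrite -lx /f !expr2 -(@dot_decomp R D k dD _ _ (fv s)) dotv.
  by rewrite dotDr !dotZr (dotC _ w) wg mulr0 add0r.
have fcont : continuous f.
  move=> s.
  have gc : {for s, continuous (fun s : R => x + (t *: w + s *: g) : E)}.
    apply: cvgD; first exact: cvg_cst.
    apply: cvgD; first exact: cvg_cst.
    by apply: (@cvgZr_tmp _ _ _ (nbhs s)); exact: cvg_id.
  have lc := @level_continuous R D k dD rho eps.
  exact: (@continuous_comp _ _ _ _ level s gc (lc _)).
have s10 : - (K * t ^+ 2) <= 0 by rewrite oppr_le0 mulr_ge0 ?sqr_ge0// ltW.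
have [|s s_in fsr] := @IVT R f (- (K * t ^+ 2)) 0 (r ^+ 2) s10
    (continuous_subspaceT fcont).
  have f0 : r ^+ 2 <= f 0 by have := fs 0; rewrite mul0r; lra.
  have f1 : f (- (K * t ^+ 2)) <= r ^+ 2.
    have /andP[_] := fs (- (K * t ^+ 2)).
    have : (- (K * t ^+ 2)) ^+ 2 * N <= t ^+ 2 * W.
      rewrite sqrrN (_ : _ * N = t ^+ 2 * (t ^+ 2 * K ^+ 2 * N)); last by ring.
      by rewrite ler_wpM2l// sqr_ge0.
    have : - (K * t ^+ 2) * N = - 4 * (t ^+ 2 * W).
      have -> : - (K * t ^+ 2) * N = - (K * N * t ^+ 2) by ring.
      by rewrite KN; ring.
    by move=> -> h1 h2; have := sqr_ge0 t; lra.
  by rewrite ge_min f1/= le_max f0 orbT.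
move: s_in; rewrite in_itv/= => /andP[s1 s0].
have := min_ (x + (t *: w + s *: g)) (conj (flatD fx (fv s)) fsr).
rewrite addrC addKr dotv dotDr !dotZr mw -/P => h.
have sP : - (K * t ^+ 2 * `|P|) <= s * P.
  rewrite lerNl (le_trans (ler_norm _))// normrN normrM ler_wpM2r//.
  by rewrite ler0_norm// lerNl.
have sN : s ^+ 2 * N <= t ^+ 2 * W.
  have : s ^+ 2 <= (K * t ^+ 2) ^+ 2.
    have s1' : - s <= K * t ^+ 2 by rewrite lerNl.
    have s0' : 0 <= - s by rewrite oppr_ge0.
    by rewrite -sqrrN lerXn2r// nnegrE// (le_trans s0').
  move=> /(ler_wpM2r (ltW N0)) /le_trans; apply.
  rewrite (_ : _ * N = t ^+ 2 * (t ^+ 2 * K ^+ 2 * N)); last by ring.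
  by rewrite ler_wpM2l// sqr_ge0.
have : t * (2 * W) <= t * (t * Q) by rewrite /Q; lra.
by rewrite ler_pM2l//; lra.
Qed.

(** If [x] and [y] are nearest points of [z], the flat part of [z - x] is
   [mu *: grad x] by [rim_normal]. Since [level] takes the same value at [x] and
   at [y], its expansion along [y - x] forces [mu <= - 1 / 4], and the gradient
   has norm at least [r]. *)
Lemma rim_reach : ((r / 4)%:E <= reach rim)%E.
Proof.
apply: le_ereal_inf_tmp => _ [z [x [y [rx ry xy zx zy]]] <-].
rewrite -zx lee_fin.
pose m := hgt z *: pole + lat z - x.
have [fx lx] := rx; have [fy ly] := ry.
have fm : flat d m.
  by apply: flat_sub => //; apply: flatD; [apply: flatZ; exact: flat_pole|exact: flat_lat].
have mE v : flat d v -> dot (z - x) v = dot m v.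
  move=> fv; rewrite !dotBl; congr (_ - _).
  have -> : dot (hgt z *: pole + lat z) v = hgt z * hgt v + dot (lat z) (lat v).
    by rewrite dotDl dotZl dot_pole dot_lat.
  by rewrite dotC (@dot_decomp R D k dD _ _ fv) (dotC (lat v)) (mulrC (hgt v)).
have [|mu mmu] := @rim_normal x m rx fm.
  by move=> b rb; rewrite -mE; [exact: nearest_dot rb|apply: flat_sub => //; exact: rb.1].
have fyx : flat d (y - x) by exact: flat_sub.
have eq2 : 2 * (mu * dot (grad x) (y - x)) = dot (y - x) (y - x).
  rewrite -dotZl -mmu -mE//.
  have e : dot (z - x) (z - x) = dot (z - y) (z - y).
    by rewrite -!sqr_enorm; congr (_ ^+ 2); apply: EFin_inj; rewrite zx zy.
  have zxy : z - y = (z - x) - (y - x) by apply/rowP => i; rewrite !mxE; ring.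
  move: e; rewrite zxy (dotBl (z - x)) !(dotBr _ (z - x)) (dotC (y - x) (z - x)); lra.
have V0 : 0 < dot (y - x) (y - x).
  by apply: dot_gt0; rewrite subr_eq0; apply/eqP => yx; apply: xy.
have ax : `|lift x| <= 2 * r.
  by rewrite (le_trans (lift_body r0 _)) ?lx//; have := r0; lra.
have := level_taylor r0 rho0 rhor epsr (y - x) ax.
rewrite (_ : x + (y - x) = y); last by rewrite addrC subrK.
rewrite lx ly subrr sub0r !expr2 -(@dot_decomp R D k dD _ _ fyx).
move=> /andP[lo hi].
have N1 := dot_grad_rim r0 rho0 epsr rx.
have mu14 : mu <= - (1 / 4).
  move: eq2 V0 lo hi; move: (dot (grad x) _) (dot (y - x) _) => A V e V0 A0 AV.
  have muA : mu * A = V / 2 by lra.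
  have A0' : A < 0.
    by rewrite lt_neqAle -oppr_ge0 A0 andbT; apply/eqP => A1; move: muA V0; rewrite A1; lra.
  nra.
apply: (@le_trans _ _ (enorm m)).
  rewrite mmu enormZ; apply: (@le_trans _ _ (1 / 4 * r)); first by rewrite mul1r mulrC.
  apply: ler_pM; [by []|exact: ltW| |].
    by rewrite ler_normr; apply/orP; right; lra.
  by rewrite enorm_ge// ltW.
have mm : dot m m <= enorm (z - x) * enorm m by rewrite -mE// dot_le_enorm.
have [m0|m0] := eqVneq (enorm m) 0; first by rewrite m0 enorm_ge0.
have : 0 < enorm m by rewrite lt_neqAle eq_sym m0 enorm_ge0.
by move=> h; rewrite -(ler_pM2r h) -expr2 sqr_enorm.
Qed.

End rim_reach.

(** * Charts *)

Section maps.
Context {R : realType} {D : nat}.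
Local Notation E := 'rV[R]_D.
Implicit Types (x y z q u : E).

Definition mirror q u : E := u - (2 * dot u q / dot q q) *: q.

Lemma mirrorK q : involutive (mirror q).
Proof.
move=> u; rewrite /mirror; have [->|q0] := eqVneq q 0; first by rewrite !scaler0 !subr0.
have q1 : dot q q != 0 by rewrite gt_eqF// dot_gt0.
apply/rowP => i; rewrite dotBl dotZl !mxE.
by move: (dot u q) (dot q q) q1 => a b b0; field.
Qed.

Lemma dot_mirror q u x : dot (mirror q u) x = dot u (mirror q x).
Proof.
rewrite /mirror dotBl dotBr dotZl dotZr (dotC q x); ring.
Qed.

Lemma mirrorZ q a u : mirror q (a *: u) = a *: mirror q u.
Proof. by apply/rowP => i; rewrite /mirror dotZl !mxE; ring. Qed.

Lemma mirror0 q : mirror q 0 = 0.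
Proof. by rewrite /mirror dot0l mulr0 mul0r scale0r subr0. Qed.

(** The reflection exchanging two vectors of equal length. *)
Lemma mirror_swap x y : dot x x = dot y y -> mirror (x - y) x = y.
Proof.
move=> xy; have [->|] := eqVneq x y.
  by rewrite subrr /mirror scaler0 subr0.
rewrite -subr_eq0 => xy0; have := dot_gt0 xy0; rewrite /mirror.
have -> : dot (x - y) (x - y) = 2 * dot x (x - y).
  by rewrite dotBl !dotBr (dotC y x) -xy; ring.
move=> h; rewrite divff ?gt_eqF// scale1r; apply/rowP => i; rewrite !mxE; ring.
Qed.

Definition inversion (s : R) z : E := (s / dot z z) *: z.

Lemma dot_inversion s z : z != 0 -> dot (inversion s z) (inversion s z) = s ^+ 2 / dot z z.
Proof.
move=> z0; have := dot_gt0 z0; rewrite /inversion dotZl dotZr => h.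
by field; rewrite gt_eqF.
Qed.

Lemma inversion_neq0 s z : s != 0 -> z != 0 -> inversion s z != 0.
Proof.
move=> s0 z0; rewrite scaler_eq0 negb_or z0 andbT mulf_neq0// invr_neq0//.
by rewrite gt_eqF// dot_gt0.
Qed.

Lemma inversionK s z : s != 0 -> z != 0 -> inversion s (inversion s z) = z.
Proof.
move=> s0 z0; rewrite {1}/inversion dot_inversion// scalerA.
rewrite [X in X *: _](_ : _ = 1) ?scale1r//.
by field; rewrite s0 gt_eqF// dot_gt0.
Qed.

Lemma smooth_dot (U : set E) j (F G : E -> E) : open U ->
  (forall i, smooth_on j U (fun x => F x ord0 i)) ->
  (forall i, smooth_on j U (fun x => G x ord0 i)) ->
  smooth_on j U (fun x => dot (F x) (G x)).
Proof.
move=> Uo sF sG.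
apply: (@smooth_on_sum _ _ U Uo j _ _ _ (fun i x => F x ord0 i * G x ord0 i)) => i.
exact: (smooth_onM Uo (sF i) (sG i)).
Qed.

Lemma smooth_mirror (U : set E) j q (F : E -> E) : open U ->
  (forall i, smooth_on j U (fun x => F x ord0 i)) ->
  forall i, smooth_on j U (fun x => mirror q (F x) ord0 i).
Proof.
move=> Uo sF i.
have := smooth_onM Uo (@smooth_dot U j F (fun=> q) Uo sF (fun i => smooth_on_cst Uo j (q ord0 i)))
  (smooth_on_cst Uo j (2 / dot q q * q ord0 i)).
move=> /(smooth_onB Uo (sF i)); apply: (smooth_on_ext Uo) => x _.
rewrite /mirror /cst !mxE; ring.
Qed.

Lemma smooth_inversion (U : set E) j s (F : E -> E) : open U ->
  (forall x, U x -> F x != 0) ->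
  (forall i, smooth_on j U (fun x => F x ord0 i)) ->
  forall i, smooth_on j U (fun x => inversion s (F x) ord0 i).
Proof.
move=> Uo F0 sF i.
have sV : smooth_on j U (fun x => (dot (F x) (F x))^-1).
  apply: (smooth_onV Uo); last exact: (smooth_dot Uo sF sF).
  by move=> x Ux; rewrite gt_eqF// dot_gt0// F0.
have := smooth_onM Uo (smooth_onM Uo (smooth_on_cst Uo j s) sV) (sF i).
by apply: (smooth_on_ext Uo) => x _; rewrite !mxE.
Qed.

End maps.

Section charts.
Context {R : realType} {D : nat} {k : nat}.
Local Notation E := 'rV[R]_D.
Local Notation d := k.+1.
Hypothesis dD : (d <= D)%N.
Implicit Types (x y z v m : E).
Context {r rho : R} (eps : R).
Hypotheses (r0 : 0 < r).

Local Notation hgt := (height dD).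
Local Notation pole := (pole_vec dD).
Local Notation lat := (@lateral R D k).
Local Notation level := (level_fun dD (rho := rho) eps).
Local Notation bump := (@bump_fun R D k rho).
Local Notation rim := (@rim R D k dD r rho eps).
Local Notation body := (@body R D k dD r rho eps).

Definition shear e x : E := x + bump e x *: pole.

Lemma lat_shear e x : lat (shear e x) = lat x.
Proof. by rewrite latD latZ lat_pole scaler0 addr0. Qed.

Lemma shearK e x : shear (- e) (shear e x) = x.
Proof.
rewrite {1}/shear /bump_fun /bump_tent lat_shear mulNr scaleNr.
by rewrite /shear /bump_fun /bump_tent addrK.
Qed.

Lemma flat_shear e x : flat d x -> flat d (shear e x).
Proof. by move=> fx; apply: flatD => //; apply: flatZ; exact: flat_pole. Qed.

(** The shear maps the body onto the ball. *)
Lemma level_shear x : flat d x -> level x = dot (shear eps x) (shear eps x).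
Proof.
move=> fx; rewrite (@dot_decomp R D k dD _ _ (flat_shear eps fx)) lat_shear -expr2.
by rewrite /shear hgtD hgtZ hgt_pole mulr1.
Qed.

Lemma half_flatE x : half_flat d x <-> flat d x /\ 0 <= hgt x.
Proof.
split=> -[fx hx]; split => //; first exact: hx.
by move=> i id; rewrite (_ : i = star dD)//; apply/val_inj/succn_inj.
Qed.

Lemma smooth_shear (U : set E) e (F : E -> E) : open U ->
  (forall i, smooth_on 2 U (fun x => F x ord0 i)) ->
  forall i, smooth_on 2 U (fun x => shear e (F x) ord0 i).
Proof.
move=> Uo sF i.
have := smooth_onD Uo (sF i) (smooth_onM Uo (@smooth_bump R D k rho e U F Uo sF)
  (smooth_on_cst Uo 2 (pole ord0 i))).
by apply: (smooth_on_ext Uo) => x _; rewrite !mxE.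
Qed.

Lemma smooth_addc (U : set E) j (a : E) (F : E -> E) : open U ->
  (forall i, smooth_on j U (fun x => F x ord0 i)) ->
  forall i, smooth_on j U (fun x => (F x + a) ord0 i).
Proof.
move=> Uo sF i; have := smooth_onD Uo (sF i) (smooth_on_cst Uo j (a ord0 i)).
by apply: (smooth_on_ext Uo) => x _; rewrite !mxE.
Qed.

Lemma smooth_continuous (U : set E) (F : E -> E) : open U ->
  (forall i, smooth_on 2 U (fun x => F x ord0 i)) ->
  forall x, U x -> {for x, continuous F}.
Proof.
move=> Uo sF; have : C_on 0 U F; last by [].
apply: (smooth_on_C_on Uo) => i.
exact: (smooth_onW (smooth_onW (sF i))).
Qed.

(** At an interior point the identity, translated, is a chart. *)
Lemma chart_interior p V : body p -> open_nbhs p V ->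
  V `<=` [set x | level x < r ^+ 2] -> chart (flat d) body p V.
Proof.
move=> [fp lp] [Vo Vp] VW.
have Uo : open [set u : E | V (u + p)].
  apply: (@open_comp _ _ (fun u : E => u + p) V) => // u _.
  by apply: (@continuousD _ _ _ id (cst p)); [exact: cvg_id|exact: cst_continuous].
exists [set u | V (u + p)], (fun u => u + p); split.
- by split => //; rewrite /= add0r.
- have sid (W : set E) (Wo : open W) i : smooth_on 2 W (fun x : E => x ord0 i).
    exact: smooth_on_coord.
  exists (fun x => x - p); split; last split.
  + split=> [u //|x Vx|u _|x _]; rewrite /= ?addrK// subrK//.
  + exact: (smooth_on_C_on Uo (smooth_addc p Uo (sid _ Uo))).
  + exact: (smooth_on_C_on Vo (smooth_addc (- p) Vo (sid _ Vo))).
- by rewrite add0r.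
- apply/seteqP; split=> x.
    move=> [u [Vu fu] <-]; split => //; split; first exact: flatD.
    exact/ltW/VW.
  move=> [[fx lx] Vx]; exists (x - p); last by rewrite subrK.
  by split; rewrite /= ?subrK//; exact: flat_sub.
Qed.

(** At a rim point, straighten the bump by the shear, send the antipodal point
   to infinity by an inversion, which makes the ball a half-space, and rotate
   this half-space to the model one. *)
Lemma chart_rim p V : rim p -> open_nbhs p V ->
  V `<=` [set x | shear eps x + shear eps p != 0] -> chart (half_flat d) body p V.
Proof.
move=> [fp lp] [Vo Vp] VW.
set X := shear eps p; have fX : flat d X by exact: flat_shear.
have XX : dot X X = r ^+ 2 by rewrite -lp level_shear.
pose q := r^-1 *: X - pole; have fq : flat d q.
  by apply: flat_sub; [exact: flatZ|exact: flat_pole].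
pose A := mirror q; pose s := 4 * r ^+ 2.
have s0 : s != 0 by rewrite gt_eqF// mulr_gt0// exprn_gt0.
have AX : A X = r *: pole.
  rewrite -[X in A X]scale1r -(divff (lt0r_neq0 r0)) -scalerA.
  rewrite /A mirrorZ; congr (_ *: _); apply: mirror_swap.
  rewrite dotZl dotZr XX dot_pole hgt_pole; field; exact: lt0r_neq0.
have fA u : flat d u -> flat d (A u) by move=> fu; apply: flat_sub => //; exact: flatZ.
have fI z : flat d z -> flat d (inversion s z) by move=> fz; exact: flatZ.
have IX : inversion s (X + X) = X + X.
  rewrite /inversion -mulr2n -scaler_nat dotZl dotZr XX /s -[RHS]scale1r; congr (_ *: _).
  by field; rewrite lt0r_neq0.
pose chi u := inversion s (A u + (X + X)) - X.
pose psi u := shear (- eps) (chi u).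
pose phi x := A (inversion s (shear eps x + X) - (X + X)).
pose U1 := [set u | A u + (X + X) != 0].
have sid (W : set E) (Wo : open W) i : smooth_on 2 W (fun x : E => x ord0 i).
  exact: smooth_on_coord.
have open_neq0 (F : E -> E) : (forall i, smooth_on 2 setT (fun x => F x ord0 i)) ->
    open [set u | F u != 0].
  move=> sF; have -> : [set u | F u != 0] = F @^-1` (~` [set 0]).
    by apply/seteqP; split => u /= /eqP.
  apply: open_comp; last first.
    apply/closed_openC.
    exact: accessible_closed_set1 (hausdorff_accessible (@norm_hausdorff _ E)) _.
  by move=> u _; apply: (smooth_continuous openT sF).
have U1o : open U1.
  by apply: open_neq0; apply: smooth_addc openT _; apply: smooth_mirror openT _; exact: sid openT.
have spsi (U : set E) : open U -> U `<=` U1 ->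
    forall i, smooth_on 2 U (fun u => psi u ord0 i).
  move=> Uo UU1; apply: (smooth_shear _ Uo); apply: (smooth_addc _ Uo).
  apply: (smooth_inversion _ Uo) => //.
  by apply: (smooth_addc _ Uo); apply: (smooth_mirror _ Uo); exact: sid.
have sphi : forall i, smooth_on 2 V (fun x => phi x ord0 i).
  apply: (smooth_mirror _ Vo); apply: (smooth_addc _ Vo).
  apply: (smooth_inversion _ Vo) => //.
  by apply: (smooth_addc _ Vo); apply: (smooth_shear _ Vo); exact: sid.
pose U0 := U1 `&` psi @^-1` V.
have U0o : open U0.
  rewrite openE => u [U1u Vu]; apply: filterI; first exact: open_nbhs_nbhs.
  by apply: (smooth_continuous U1o (spsi _ U1o _) U1u) => //; exact: open_nbhs_nbhs.
have psi_phi x : V x -> psi (phi x) = x.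
  move=> Vx; rewrite /psi /chi /phi /A mirrorK subrK inversionK//; last exact: VW.
  by rewrite addrK shearK.
have phi_psi u : U1 u -> phi (psi u) = u.
  move=> U1u; rewrite /psi /phi -{1}[eps]opprK shearK /chi subrK inversionK//.
  by rewrite addrK /A mirrorK.
have phiU x : V x -> U0 (phi x).
  move=> Vx; split; last by rewrite /= psi_phi.
  rewrite /U1 /= /phi /A mirrorK subrK; apply: inversion_neq0 => //; exact: VW.
have psi0 : psi 0 = p.
  by rewrite /psi /chi /A mirror0 add0r IX addrK /X shearK.
exists U0, psi; split => //.
- split => //; split; last by rewrite /= psi0.
  rewrite /U1 /= /A mirror0 add0r -mulr2n -scaler_nat scaler_eq0 negb_or pnatr_eq0/=.
  apply/eqP => X0; move: XX; rewrite X0 dot0l => /esym/eqP.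
  by rewrite expf_eq0/= (negbTE (lt0r_neq0 r0)).
- exists phi; split; last split.
  + split => //; first by move=> u [].
    by move=> u [U1u _]; exact: phi_psi.
  + exact: (smooth_on_C_on U0o (spsi _ U0o (@subIsetl _ _ _))).
  + exact: (smooth_on_C_on Vo sphi).
(* the inequality defining the ball becomes the sign of one coordinate *)
have key x : V x -> flat d x -> (level x <= r ^+ 2) = (0 <= hgt (phi x)).
  move=> Vx fx; rewrite level_shear//; set z := shear eps x + X.
  have z0 : z != 0 by exact: VW.
  have zz := dot_gt0 z0.
  have -> : shear eps x = z - X by rewrite /z addrK.
  have -> : hgt (phi x) = r^-1 * dot (inversion s z - (X + X)) X.
    rewrite -dot_pole /phi dotC -/z dot_mirror.
    have -> : mirror q pole = r^-1 *: X.
      have := AX; rewrite /A => /(congr1 (mirror q)).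
      rewrite mirrorK => {1}->.
      by rewrite mirrorZ scalerA mulVf ?scale1r// lt0r_neq0.
    by rewrite dotZr.
  rewrite pmulr_rge0 ?invr_gt0//.
  have -> : dot (z - X) (z - X) = dot z z - 2 * dot z X + r ^+ 2.
    by rewrite dotBl !dotBr (dotC X z) XX; ring.
  have -> : dot (inversion s z - (X + X)) X =
      2 * r ^+ 2 / dot z z * (2 * dot z X - dot z z).
    by rewrite dotBl dotDl XX /inversion dotZl /s; field; rewrite gt_eqF.
  rewrite pmulr_rge0; last by rewrite divr_gt0// mulr_gt0// exprn_gt0.
  by apply/idP/idP; lra.
apply/seteqP; split=> x.
  move=> [u [[U1u Vu] /half_flatE[fu hu]] <-]; split => //.
  have fpu : flat d (psi u).
    apply: flat_shear; apply: flat_sub => //; apply: fI; apply: flatD; last exact: flatD.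
    exact: fA.
  by split => //; rewrite key// phi_psi.
move=> [[fx lx] Vx]; exists (phi x); last exact: psi_phi.
split; first exact: phiU.
apply/half_flatE; rewrite -key//; split => //.
apply: fA; apply: flat_sub; last exact: flatD.
by apply: fI; apply: flatD => //; exact: flat_shear.
Qed.

End charts.

Section difference_quotient.
Context {R : realType} {D : nat}.
Local Notation E := 'rV[R]_D.

Lemma derive_quotient (f : E -> R) (a v : E) (e : R) : differentiable f a -> 0 < e ->
  \forall h \near 0^', `|'D_v f a - h^-1 * (f (h *: v + a) - f a)| < e.
Proof.
move=> fd e0; have : derivable f a v by exact: diff_derivable.
by move=> /cvgrPdist_lt; apply.
Qed.

Lemma near0_pick (P : R -> Prop) : (\forall h \near 0^', P h) ->
  exists h, [/\ 0 < h, P h & P (- h)].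
Proof.
move=> [e /= e0 He]; exists (e / 2).
have h0 : 0 < e / 2 by rewrite divr_gt0.
have he : e / 2 < e by rewrite ltr_pdivrMr// ltr_pMr// ltr1n.
split=> //; apply: He; rewrite /= ?oppr_eq0 ?gt_eqF//.
  by rewrite sub0r normrN gtr0_norm.
by rewrite sub0r opprK gtr0_norm.
Qed.

End difference_quotient.

Section manifold.
Context {R : realType} {D : nat} {k : nat}.
Local Notation E := 'rV[R]_D.
Local Notation d := k.+1.
Hypothesis dD : (d <= D)%N.
Implicit Types (x y z v m : E).
Context {r rho : R} (eps : R).
Hypotheses (r0 : 0 < r) (rho0 : 0 < rho) (rhor : rho <= r / 2)
  (epsr : `|eps| <= rho ^+ 2 / (100 * r)).

Local Notation hgt := (height dD).
Local Notation pole := (pole_vec dD).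
Local Notation level := (level_fun dD (rho := rho) eps).
Local Notation rim := (@rim R D k dD r rho eps).
Local Notation body := (@body R D k dD r rho eps).
Local Notation shear := (@shear R D k dD rho eps).

(** In a half-space chart at a point near which the set is flat, the chart
   could be left downwards along a flat direction, which the half-space
   forbids. *)
Lemma flat_no_half_chart (M : set E) p V : M `&` V = flat d `&` V ->
  open_nbhs p V -> chart (half_flat d) M p V -> False.
Proof.
move=> MV [Vo Vp] [U0 [psi [[U0o U00] [phi [[fpsi fphi pp1 pp2] [spsi sphi]]] psi0 psiM]]].
have dpsi : differentiable psi 0 by exact: spsi.1.
have dphi : differentiable phi p by exact: sphi.1.
have phip : phi p = 0 by rewrite -psi0 pp1.
have dpsic i : differentiable (fun x => psi x ord0 i) 0.
  apply: (@differentiable_comp _ _ _ _ psi (fun N : E => N ord0 i) 0 dpsi).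
  exact: differentiable_coord.
pose u := 'D_pole psi 0.
have hflat h : 0 <= h -> half_flat d (h *: pole).
  move=> h0; apply/(half_flatE dD); split; first by apply: flatZ; exact: flat_pole.
  by rewrite hgtZ hgt_pole mulr1.
have nearU : \forall h \near 0^', U0 (h *: pole).
  have : \forall h \near (0 : R), U0 (h *: pole).
    have c : {for (0 : R), continuous (fun h : R => h *: pole)}.
      by apply: (@cvgZr_tmp _ _ _ (nbhs (0:R))); exact: cvg_id.
    by apply: c; rewrite scale0r; exact: open_nbhs_nbhs.
  by apply: cvg_within.
have fu : flat d u.
  move=> i di; rewrite /u derive_mx; last exact: diff_derivable.
  rewrite mxE; apply/eqP/negPn/negP => /eqP u0.
  set L := 'D_pole _ 0 in u0.
  have L0 : 0 < `|L| by rewrite normr_gt0; apply/eqP.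
  have [h [h0 [hU hL] _]] := near0_pick (filterI nearU (derive_quotient pole (dpsic i) L0)).
  have pf y : U0 y -> half_flat d y -> psi y ord0 i = 0.
    move=> Uy hy; have : (psi @` (U0 `&` half_flat d)) (psi y) by exists y.
    by rewrite psiM MV => -[+ _]; apply.
  move: hL; rewrite addr0 pf//; last by apply: hflat; exact: ltW.
  rewrite pf//; last by rewrite -(scale0r pole); exact: hflat.
  by rewrite subr0 mulr0 subr0 ltxx.
have Dphi : 'D_u phi p = pole.
  rewrite deriveE// /u deriveE// -[LHS]/((_ \o _) _) -psi0 -diff_comp//; last by rewrite psi0.
  rewrite -deriveE; last by apply: differentiable_comp => //; rewrite psi0.
  rewrite (@near_eq_derive _ _ _ _ id); first by rewrite derive_id.
  by apply: near_open U00 _ => // y Uy /=; exact: pp1.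
have dphic : differentiable (fun x => hgt (phi x)) p.
  apply: (@differentiable_comp _ _ _ _ phi (fun N : E => hgt N) p dphi).
  exact: differentiable_coord.
have Dhgt : 'D_u (fun x => hgt (phi x)) p = 1.
  have := Dphi; rewrite derive_mx; last exact: diff_derivable.
  by move=> /(congr1 (fun x => hgt x)); rewrite hgt_pole {1}/height mxE.
have nearV : \forall h \near 0^', V (h *: u + p).
  have : \forall h \near (0 : R), V (h *: u + p).
    have c : {for (0 : R), continuous (fun h : R => h *: u + p)}.
      apply: (@continuousD _ _ _ (fun h : R => h *: u) (cst p)); last exact: cst_continuous.
      by apply: (@cvgZr_tmp _ _ _ (nbhs (0:R))); exact: cvg_id.
    by apply: c; rewrite scale0r add0r; exact: open_nbhs_nbhs.
  by apply: cvg_within.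
have fp : flat d p.
  have : (M `&` V) p; last by rewrite MV => -[].
  by rewrite -psiM; exists 0 => //; split => //; rewrite -(scale0r pole); exact: hflat.
have [h [h0 _ [hV hL]]] := near0_pick (filterI nearV (derive_quotient u dphic (@ltr01 R))).
have : (psi @` (U0 `&` half_flat d)) (- h *: u + p).
  rewrite psiM MV; split => //; apply: flatD => //; exact: flatZ.
move=> [y [Uy /(half_flatE dD)[_ hy]] yE].
move: hL; rewrite Dhgt -yE pp1// phip.
have -> : hgt (0 : E) = 0 by rewrite -(scale0r (0 : E)) hgtZ mul0r.
rewrite subr0 invrN mulNr opprK ger0_norm; last first.
  by rewrite addr_ge0// mulr_ge0// invr_ge0 ltW.
by rewrite gtrDl ltNge mulr_ge0// invr_ge0 ltW.
Qed.

Lemma open_sublevel : open [set x | level x < r ^+ 2].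
Proof.
have lc := @level_continuous R D k dD rho eps.
apply: (@open_comp _ _ level [set y | y < r ^+ 2]); last exact: open_lt.
by move=> x _; exact: lc.
Qed.

Lemma rim_small p : rim p -> for_small_open_nbhs p (chart (half_flat d) body p).
Proof.
move=> rp; have [fp lp] := rp.
have sid i : smooth_on 2 setT (fun x : E => x ord0 i).
  by apply: smooth_on_coord; exact: openT.
exists [set x | shear x + shear p != 0]; split.
  split.
    have -> : [set x | shear x + shear p != 0] = (fun x => shear x + shear p) @^-1` (~` [set 0]).
      by apply/seteqP; split => x /= /eqP.
    apply: open_comp; last first.
      apply/closed_openC.
      exact: accessible_closed_set1 (hausdorff_accessible (@norm_hausdorff _ E)) _.
    move=> x _.
    have sF := @smooth_addc R D setT 2 (shear p) _ openT
      (@smooth_shear R D k dD rho setT eps _ openT sid).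
    have h := @smooth_continuous R D setT _ openT sF x I.
    exact: h.
  rewrite /= -mulr2n -scaler_nat scaler_eq0 negb_or pnatr_eq0/=.
  apply/eqP => X0; move: (lp); rewrite (level_shear dD eps fp) X0 dot0l => /esym/eqP.
  by rewrite expf_eq0/= (negbTE (lt0r_neq0 r0)).
by move=> V pV VW; apply: chart_rim.
Qed.

Lemma inner_small p : body p -> level p < r ^+ 2 ->
  for_small_open_nbhs p (chart (flat d) body p).
Proof.
move=> bp lp; exists [set x | level x < r ^+ 2]; split.
  by split; first exact: open_sublevel.
by move=> V pV VW; exact: chart_interior.
Qed.

Lemma body_submanifold : C2_submanifold d body.
Proof.
split; first exact: body_closed.
move=> p bp; have [fp lp] := bp.
have [eq_r|lt_r] := eqVneq (level p) (r ^+ 2); last first.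
  have [W [pW WV]] : for_small_open_nbhs p (chart (flat d) body p).
    by apply: inner_small => //; rewrite lt_neqAle lt_r.
  by exists W; split => // V pV VW; left; exact: WV.
have [W [pW WV]] := rim_small (conj fp eq_r).
by exists W; split => // V pV VW; right; exact: WV.
Qed.

Lemma body_mboundary : mboundary d body = rim.
Proof.
apply/seteqP; split=> p.
  move=> [bp [W [[Wo Wp] WV]]]; have [fp lp] := bp.
  split=> //; apply/eqP; rewrite eq_le lp/= leNgt; apply/negP => lt_r.
  pose V := W `&` [set x | level x < r ^+ 2].
  have pV : open_nbhs p V by split => //; apply: openI => //; exact: open_sublevel.
  apply: (@flat_no_half_chart body p V _ pV); last by apply: WV => //; exact: subIsetl.
  apply/seteqP; split => x; first by move=> [[fx _] Vx].
  by move=> [fx [Wx lx]]; split => //; split => //; exact: ltW.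
by move=> rp; split; [exact: rim_body|exact: rim_small].
Qed.

Lemma body0 : body 0.
Proof.
split; first by move=> i _; rewrite mxE.
rewrite /level_fun /lifted_height.
have -> : hgt (0 : E) = 0 by rewrite -(scale0r (0 : E)) hgtZ mul0r.
have -> : @lateral R D k 0 = 0 by apply/rowP => i; rewrite !mxE; case: ifP.
rewrite dot0l add0r addr0 -real_normK ?num_real// lerXn2r ?nnegrE ?(ltW r0)//.
apply: (le_trans (bump_bound _ _)); have := eps_small r0 rho0 rhor epsr.
by have := r0; lra.
Qed.

(** The body is a union of segments with common end 0. *)
Lemma body_connected : connected body.
Proof.
have -> : body = \bigcup_(x in body) ((fun t : R => t *: x) @` `[0, 1]).
  apply/seteqP; split=> [x bx|x [y by_ [t /= t01 <-]]].
    by exists x => //; exists 1; rewrite ?scale1r//= in_itv/= ler01 lexx.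
  rewrite -[_ *: y]addr0 -(scaler0 _ (1 - t)); apply: body_convex => //.
  exact: body0.
apply: bigcup_connected.
  by exists 0 => x bx; exists 0; rewrite ?scale0r//= in_itv/= ler01 lexx.
move=> x bx; apply: connected_continuous_connected; first exact: segment_connected.
apply: continuous_subspaceT => t.
by apply: (@cvgZr_tmp _ _ _ (nbhs t)); exact: cvg_id.
Qed.

Lemma body_manifold (tau : R) : tau <= r / 4 ->
  manifold_class d +oo tau%:E body.
Proof.
move=> taur; split.
- exact: body_compact.
- exact: body_connected.
- exact: body_submanifold.
- rewrite reach_convex// => x y bx by_; apply: body_convex => //.
  by apply/andP; split; lra.
- rewrite body_mboundary; apply: (@le_trans _ _ (r / 4)%:E).
    by rewrite lee_fin.
  exact: rim_reach.
Qed.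

End manifold.

(** * Cubes inside and boxes around the bodies *)

Section body_boxes.
Context {R : realType} {D : nat} {k : nat}.
Local Notation E := 'rV[R]_D.
Local Notation d := k.+1.
Hypothesis dD : (d <= D)%N.
Implicit Types (x y z v : E).
Context {r rho : R} (eps : R).
Hypotheses (r0 : 0 < r) (rho0 : 0 < rho) (rhor : rho <= r / 2)
  (epsr : `|eps| <= rho ^+ 2 / (100 * r)).

Local Notation hgt := (height dD).
Local Notation lat := (@lateral R D k).
Local Notation lift := (lifted_height dD (rho := rho) eps).
Local Notation level := (level_fun dD (rho := rho) eps).
Local Notation bump := (@bump_fun R D k rho eps).
Local Notation body := (@body R D k dD r rho eps).

(** A cube in both bodies, to carry the mass left over by the density [fmin]. *)
Definition core : set E :=
  flat_box k (fun=> - (r / (4 * d%:R))) (fun=> - (r / (4 * d%:R)) + r / (2 * d%:R)).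

Lemma coreE x : core x -> flat d x /\ forall i : 'I_D, `|x ord0 i| <= r / (4 * d%:R).
Proof.
move=> [fx bx]; split => // i; have [id|di] := ltnP i d.
  have := bx i id; rewrite ler_norml.
  rewrite (_ : r / (2 * d%:R) = r / (4 * d%:R) + r / (4 * d%:R)); last by field.
  by move: (r / (4 * _)) => s; lra.
by rewrite fx// normr0 divr_ge0// ltW.
Qed.

Lemma core_body : core `<=` body.
Proof.
move=> x /coreE[fx bx]; split => //.
have d1 : 1 <= d%:R :> R by rewrite ler1n.
pose s := r / (4 * d%:R).
have s0 : 0 < s by rewrite divr_gt0// mulr_gt0// ltr0n.
have sr : s <= r / 4.
  rewrite /s ler_pM2l// lef_pV2 ?posrE ?mulr_gt0 ?ltr0n//; lra.
have hs : `|lift x| <= r / 2.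
  rewrite (le_trans (ler_normD _ _))//.
  have h1 : `|hgt x| <= r / 4 := le_trans (bx (star dD)) sr.
  have h2 : `|bump x| <= r / 400 := le_trans (bump_bound _ _) (eps_small r0 rho0 rhor epsr).
  by apply: (le_trans (lerD h1 h2)); have := r0; lra.
have xx : dot (lat x) (lat x) <= r ^+ 2 / 16.
  rewrite (dot_flat dD); last exact: flat_lat.
  apply: (@le_trans _ _ (\sum_(i < d) s ^+ 2)).
    apply: ler_sum => i _; rewrite -expr2 -real_normK ?num_real// lerXn2r ?nnegrE ?(ltW s0)//.
    by rewrite mxE; case: ifP => _; [exact: bx|rewrite normr0 ltW].
  rewrite sumr_const card_ord -[leLHS]mulr_natr /s expr_div_n.
  rewrite (_ : _ * _ = r ^+ 2 / 16 / d%:R); last by field.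
  by rewrite ler_pdivrMr ?ltr0n// ler_peMr// divr_ge0// sqr_ge0.
have hh : lift x ^+ 2 <= (r / 2) ^+ 2.
  by rewrite -real_normK ?num_real// lerXn2r ?nnegrE// divr_ge0// ltW.
by rewrite /level_fun (le_trans (lerD hh xx))// expr_div_n; have := sqr_ge0 r; lra.
Qed.

Lemma body_box : body `<=` flat_box k (fun=> - (4 * r)) (fun=> - (4 * r) + 8 * r).
Proof.
move=> x bx; split => [|i _]; first exact: bx.1.
have h := dot_body r0 rho0 rhor epsr bx.
have : `|x ord0 i| <= 4 * r.
  apply: le_trans (coord_le_enorm x i) _.
  by rewrite enorm_le// mulr_ge0// ltW.
by rewrite ler_norml; lra.
Qed.

Lemma level0_lt : level 0 < r ^+ 2.
Proof.
rewrite /level_fun /lifted_height.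
have -> : hgt (0 : E) = 0 by rewrite -(scale0r (0 : E)) hgtZ mul0r.
have -> : @lateral R D k 0 = 0 by apply/rowP => i; rewrite !mxE; case: ifP.
rewrite dot0l add0r addr0 -real_normK ?num_real//.
apply: (@le_lt_trans _ _ ((r / 400) ^+ 2)).
  have h4 : 0 <= r / 400 by have := r0; lra.
  apply: lerXn2r; [exact: normr_ge0|exact: h4|].
  exact: (le_trans (bump_bound _ _) (eps_small r0 rho0 rhor epsr)).
by rewrite expr_div_n; have : 0 < r ^+ 2 := exprn_gt0 2 r0; lra.
Qed.

(** Every point of the body is a limit of points of the open sublevel set,
   around which a whole flat cube is contained in the body. *)
Lemma body_cube x U : body x -> open_nbhs x U ->
  exists (lo : 'I_D -> R) s, 0 < s /\ flat_box k lo (fun i => lo i + s) `<=` U `&` body.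
Proof.
move=> bx [Uo Ux]; have [fx lx] := bx.
have [t [t0 t1 Ut]] : exists t : R, [/\ 0 < t, t <= 1 & U ((1 - t) *: x)].
  have : \forall t \near (0 : R), U ((1 - t) *: x).
    have c : {for (0 : R), continuous (fun t : R => (1 - t) *: x)}.
      apply: (@cvgZr_tmp _ _ _ (nbhs (0:R))).
      by apply: cvgB; [exact: cst_continuous|exact: cvg_id].
    by apply: c; rewrite subr0 scale1r; exact: open_nbhs_nbhs.
  move=> [e /= e0 He]; exists (Num.min 1 (e / 2)).
  have m0 : 0 < Num.min 1 (e / 2) by rewrite lt_min ltr01 divr_gt0.
  split=> //; first by rewrite ge_min lexx.
  apply: He; rewrite /= sub0r normrN gtr0_norm// gt_min; apply/orP; right.
  by rewrite ltr_pdivrMr// ltr_pMr// ltr1n.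
pose z := (1 - t) *: x.
have lz : level z < r ^+ 2.
  have b0 : body 0 by exact: body0.
  have t01 : 0 <= 1 - t <= 1 by rewrite subr_ge0 t1 lerBlDr lerDl ltW.
  have := level_convex r0 rho0 rhor epsr bx b0 t01.
  rewrite scaler0 addr0 => h; apply: (le_lt_trans h).
  have h1 : (1 - t) * level x <= (1 - t) * r ^+ 2.
    by rewrite ler_wpM2l// subr_ge0.
  have h2 : (1 - (1 - t)) * level 0 < (1 - (1 - t)) * r ^+ 2.
    by rewrite ltr_pM2l ?level0_lt// subKr.
  by have := ltr_leD h2 h1; lra.
have : nbhs z (U `&` [set x | level x < r ^+ 2]).
  apply: open_nbhs_nbhs; split => //; apply: openI => //.
  exact: open_sublevel.
move=> /nbhs_ballP[e /= e0 He].
exists (fun i => z ord0 i - e / 2), (e / 2); split; first by rewrite divr_gt0.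
have fz : flat d z by exact: flatZ.
move=> y [fy yb].
suff : ball z e y by move=> /He[Uy ly]; split => //; split => //; exact: ltW.
rewrite -ball_normE /=; apply: (@le_lt_trans _ _ (e / 2)).
  rewrite [leLHS]mx_normrE; apply/bigmax_leP; split => [|[i j] _ /=].
    by rewrite divr_ge0// ltW.
  have -> : (z - y) i j = z ord0 j - y ord0 j by rewrite (ord1 i) !mxE.
  have [jd|dj] := ltnP j d.
    have := yb j jd; have := e0; move: (z ord0 j) (y ord0 j) => a b h1 h2.
    by rewrite ler_norml; lra.
  by rewrite fy// fz// subr0 normr0 divr_ge0// ltW.
by rewrite ltr_pdivrMr// ltr_pMr// ltr1n.
Qed.

End body_boxes.

Section two_bodies.
Context {R : realType} {D : nat} {k : nat}.
Local Notation E := 'rV[R]_D.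
Local Notation d := k.+1.
Hypothesis dD : (d <= D)%N.
Implicit Types (x y z v : E).
Context {r rho eps : R}.
Hypotheses (r0 : 0 < r) (rho0 : 0 < rho) (rhor : rho <= r / 2)
  (eps0 : 0 < eps) (epsr : eps <= rho ^+ 2 / (100 * r)).

Local Notation hgt := (height dD).
Local Notation pole := (pole_vec dD).
Local Notation lat := (@lateral R D k).
Local Notation level e := (level_fun dD (rho := rho) e).
Local Notation rim e := (@rim R D k dD r rho e).
Local Notation body e := (@body R D k dD r rho e).
Local Notation bump e := (@bump_fun R D k rho e).

Lemma bumpN x : bump (- eps) x = - bump eps x.
Proof. by rewrite /bump_fun mulNr. Qed.

Lemma bump_ge0 x : 0 <= bump eps x.
Proof. by rewrite mulr_ge0 ?(ltW eps0)// exprn_ge0// tent_ge0. Qed.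

Lemma bump_le x : bump eps x <= eps.
Proof.
by rewrite (le_trans (ler_norm _))// (le_trans (bump_bound _ _))// gtr0_norm.
Qed.

Definition flip x : E := x - (2 * hgt x) *: pole.

Lemma lat_flip x : lat (flip x) = lat x.
Proof. by rewrite /flip -scaleNr latD latZ lat_pole scaler0 addr0. Qed.

Lemma hgt_flip x : hgt (flip x) = - hgt x.
Proof. by rewrite /flip -scaleNr hgtD hgtZ hgt_pole; ring. Qed.

Lemma flipK : involutive flip.
Proof.
move=> x; rewrite {1}/flip hgt_flip /flip.
by apply/rowP => i; rewrite !mxE; ring.
Qed.

Lemma flip_isometry x y : enorm (flip x - flip y) = enorm (x - y).
Proof.
have -> : flip x - flip y = flip (x - y).
  by apply/rowP => i; rewrite /flip /height !mxE; ring.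
move: (x - y) => u; rewrite !enormE; congr Num.sqrt.
rewrite /flip dotBl !dotBr !dotZl !dotZr (dotC u) !dot_pole hgt_pole; ring.
Qed.

Lemma flat_flip x : flat d x -> flat d (flip x).
Proof. by move=> fx; apply: flat_sub => //; apply: flatZ; exact: flat_pole. Qed.

Lemma level_flip e x : level (- e) (flip x) = level e x.
Proof.
rewrite /level_fun /lifted_height /bump_fun /bump_tent lat_flip hgt_flip; ring.
Qed.

Lemma body_flip : flip @^-1` body (- eps) = body eps.
Proof.
apply/seteqP; split => x /= [fx lx].
  by split; [rewrite -[x]flipK; exact: flat_flip|rewrite -level_flip].
by split; [exact: flat_flip|rewrite level_flip].
Qed.

Definition gap_side (i : 'I_D) : R := if (i < k)%N then 2 * rho else 3 * rho ^+ 2 / r.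
Definition gap_corner (i : 'I_D) : R :=
  if (i < k)%N then - rho else - (r + rho ^+ 2 / r).

(** The bodies differ only where the bump does not vanish, and there the sphere is
   within [rho ^+ 2 / r] of its pole; the difference is thus in one cap of width
   [rho], which explains the sides of the box. *)
Lemma body_gap : body eps `\` body (- eps) `<=`
  flat_box k gap_corner (fun i => gap_corner i + gap_side i).
Proof.
move=> x [[fx lx] nbx].
have lx' : r ^+ 2 < level (- eps) x.
  by rewrite ltNge; apply/negP => h; apply: nbx.
have b0 := bump_ge0 x; have b1 := bump_le x.
have rho2 : rho ^+ 2 / (100 * r) = (rho ^+ 2 / r) / 100 by field; rewrite gt_eqF.
(* [a] is the scale of the heights: a cap of width [rho] has height at most [a] *)
pose a := rho ^+ 2 / r.
have a0 : 0 < a by rewrite divr_gt0// exprn_gt0.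
have epsa : eps <= a / 100 by rewrite -rho2.
have ar : a * r = rho ^+ 2 by rewrite /a divfK// gt_eqF.
have a4 : a <= r / 4.
  rewrite -(ler_pM2r r0) ar; have : rho ^+ 2 <= (r / 2) ^+ 2.
    by rewrite lerXn2r ?nnegrE ?divr_ge0 ?(ltW rho0) ?(ltW r0).
  by rewrite expr_div_n; lra.
move: lx lx'; rewrite /level_fun /lifted_height bumpN => lx lx'.
have hb : hgt x * bump eps x < 0 by move: lx lx'; rewrite !sqrrD sqrrN; lra.
have bp : 0 < bump eps x.
  by rewrite lt_neqAle b0 andbT eq_sym; apply/eqP => b; move: hb; rewrite b mulr0 ltxx.
have h0 : hgt x < 0 by rewrite -(pmulr_llt0 _ bp).
have latrho : enorm (lat x) < rho.
  rewrite ltNge; apply/negP => h; move: bp.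
  rewrite /bump_fun /bump_tent tentE_out ?expr0n ?mulr0 ?ltxx//.
  by rewrite ler_pdivlMr// mul1r.
have lat2 : dot (lat x) (lat x) <= rho ^+ 2.
  by rewrite -sqr_enorm lerXn2r ?nnegrE ?enorm_ge0 ?ltW.
have hlo : - (r + a) <= hgt x.
  have h : - r <= hgt x + bump eps x.
    have : `|hgt x + bump eps x| <= r.
      rewrite -ler_sqr ?nnegrE ?(ltW r0)// real_normK ?num_real//.
      by apply: le_trans lx; rewrite lerDl dot_ge0.
    by rewrite ler_norml => /andP[].
  by have := epsa; have := a0; lra.
have hhi : hgt x <= - (r - 2 * a).
  rewrite leNgt; apply/negP => h.
  have u : 0 <= bump eps x - hgt x <= r - a by apply/andP; split; have := a0; have := epsa; lra.
  have : (bump eps x - hgt x) ^+ 2 <= (r - a) ^+ 2.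
    by case/andP: u => u0 u1; rewrite lerXn2r ?nnegrE// (le_trans u0).
  move: lx'; rewrite -[X in _ < X + _]sqrrN opprB.
  have : (r - a) ^+ 2 + rho ^+ 2 <= r ^+ 2.
    rewrite -ar sqrrB; have : a * a <= a * r by rewrite ler_pM2l//; have := r0; lra.
    by rewrite expr2; lra.
  lra.
split => // i id; rewrite /gap_corner /gap_side; case: ifP => ik.
  have : `|lat x ord0 i| <= rho by apply: le_trans (coord_le_enorm _ _) (ltW _).
  by rewrite mxE ik ler_norml; lra.
have -> : x ord0 i = hgt x.
  congr (x _ _); apply/val_inj => /=; apply/eqP.
  by rewrite eqn_leq -ltnS id/= leqNgt ik.
by rewrite -mulrA -/a; apply/andP; split; lra.
Qed.

Lemma gap_volume : \prod_(i < d) gap_side (flat_coord dD i) = 3 * 2 ^+ k * rho ^+ k.+2 / r.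
Proof.
rewrite big_ord_recr/= /gap_side /= ltnn.
rewrite (eq_bigr (fun=> 2 * rho)); last by move=> i _; rewrite /= ltn_ord.
by rewrite prodr_const card_ord exprMn !exprS; field; rewrite gt_eqF.
Qed.

(** The top of [body (- eps)], higher by [eps] than the ball, whereas the points
   of [body eps] are not higher than those of the ball. *)
Definition tip : E := (r + eps) *: pole.

Lemma tip_rim : rim (- eps) tip.
Proof.
split; first by apply: flatZ; exact: flat_pole.
rewrite /level_fun /lifted_height hgtZ hgt_pole latZ lat_pole scaler0 dot0l.
rewrite /bump_fun /bump_tent latZ lat_pole scaler0 enorm0 mul0r /tent expr0n subr0 max_r//.
by ring.
Qed.

Lemma tip_far y : rim eps y -> eps <= enorm (tip - y).
Proof.
move=> [fy ly]; have := lift_body r0 (_ : level eps y <= r ^+ 2).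
rewrite ly lexx => /(_ isT); rewrite ler_norml => /andP[_ hy].
have b0 := bump_ge0 y.
apply: le_trans (coord_le_enorm _ (star dD)); apply: le_trans (ler_norm _).
have -> : (tip - y) ord0 (star dD) = (r + eps) - hgt y.
  by rewrite !mxE !eqxx mulr1.
by move: hy; rewrite /lifted_height; lra.
Qed.

End two_bodies.

(** * Laws with a two-level density *)

Section two_level_law.
Context {R : realType} {D k : nat}.
Local Notation T := (borel_rV R D).
Local Notation d := k.+1.
Local Open Scope ereal_scope.

Lemma closed_measurable (C : set 'rV[R]_D) : closed C -> measurable (C : set T).
Proof.
move=> Ccl; rewrite -[X in measurable X]setCK; apply: measurableC.
by apply: sub_sigma_algebra; exact: closed_openC.
Qed.

Definition hmeas : {measure set T -> \bar R} :=
  (@hausdorff_measure R D k.+1 : set T -> \bar R).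

Context (M C : set T) (mM : measurable M) (mC : measurable C) (a b : {nonneg R}).

(** Density [a] on [M], raised to [a + b] on [C]. *)
Definition two_level : {measure set T -> \bar R} :=
  measure_add (mscale a (mrestr hmeas mM)) (mscale b (mrestr hmeas mC)).

Lemma two_levelE A :
  two_level A = a%:num%:E * hmeas (A `&` M) + b%:num%:E * hmeas (A `&` C).
Proof. exact: measure_addE. Qed.

(** When [two_level] has mass less than 1, as for the common part of two such
   laws, this is the corresponding conditional law. *)
Definition two_level_law : probability T R :=
  mnormalize two_level [the probability T R of dirac (point : T)].

Lemma two_level_lawE A : two_level setT \is a fin_num -> 0 < two_level setT ->
  two_level A = two_level setT * two_level_law A.
Proof.
move=> fin pos.
have noo : (two_level setT == +oo) = false.
  by apply/negbTE; move: fin; rewrite fin_numE => /andP[].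
have n0 : (two_level setT == 0) = false by rewrite gt_eqF.
have -> : two_level_law A = two_level A * (fine (two_level setT))^-1%:E.
  rewrite -[LHS]/((mnormalize two_level [the probability T R of dirac (point : T)]) A).
  by rewrite /mnormalize n0 noo.
have f0 : fine (two_level setT) != 0%R.
  by rewrite gt_eqF// fine_gt0// pos ltey_eq fin.
by rewrite -{1}(fineK fin) muleCA -EFinM divff// mule1.
Qed.

Hypotheses (CM : C `<=` M) (tot : two_level setT = 1).

Lemma two_level_law1 A : two_level_law A = two_level A.
Proof. by rewrite two_level_lawE tot ?mul1e// lte01. Qed.

Lemma two_level_density : has_density_on d two_level_law M
  (fun x => a%:num + b%:num * \1_C x)%R.
Proof.
have mf : measurable_fun setT (fun x : T => a%:num + b%:num * \1_C x : R)%R.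
  apply: measurable_funD; first exact: measurable_cst.
  by apply: measurable_funM; [exact: measurable_cst|exact: measurable_indic].
split=> // A mA; rewrite two_level_law1 two_levelE.
have mAM : measurable (A `&` M) by exact: measurableI.
have -> : \int[hausdorff_measure d : set T -> \bar R]_(x in A `&` M)
    (a%:num + b%:num * \1_C x)%:E =
  \int[hmeas]_(x in A `&` M) (a%:num%:E + b%:num%:E * (\1_C x)%:E).
  by apply: eq_integral => x _; rewrite EFinD EFinM.
rewrite ge0_integralD//; last first.
  apply: measurable_funeM; apply/measurable_EFinP.
  by apply: measurable_funTS; exact: measurable_indic.
congr (_ + _); first by rewrite integral_cst.
rewrite ge0_integralZl_EFin//; last first.
  apply/measurable_EFinP.
  by apply: measurable_funTS; exact: measurable_indic.
rewrite integral_indic//; congr (_ * hmeas _).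
apply/seteqP; split => x; first by move=> [Ax Cx]; split => //; split => //; exact: CM.
by move=> [Cx [Ax _]].
Qed.

Lemma two_level_support : closed (M : set 'rV[R]_D) -> (0 < a%:num)%R ->
  (forall x U, M x -> open_nbhs (x : 'rV[R]_D) U -> 0 < hmeas (U `&` M)) ->
  msupport two_level_law = M.
Proof.
move=> Mcl a0 Mpos; apply/seteqP; split=> x.
  move=> Px; apply: contrapT => Mx.
  have := Px (~` M) (conj (closed_openC Mcl) Mx).
  rewrite two_level_law1 two_levelE setICl measure0 mule0 add0e.
  rewrite (_ : ~` M `&` C = set0) ?measure0 ?mule0 ?ltxx//.
  by rewrite -subset0 => y [nMy Cy]; apply: nMy; exact: CM.
move=> Mx U Ux; rewrite two_level_law1 two_levelE.
apply: (@lt_le_trans _ _ (a%:num%:E * hmeas (U `&` M))).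
  by rewrite mule_gt0 ?lte_fin//; exact: Mpos Ux.
by rewrite leeDl// mule_ge0 ?lee_fin.
Qed.

Lemma two_level_class (tau fmin fmax : R) : a%:num = fmin -> (0 < fmin)%R ->
  (fmin + b%:num <= fmax)%R ->
  (forall x U, M x -> open_nbhs (x : 'rV[R]_D) U -> 0 < hmeas (U `&` M)) ->
  manifold_class d +oo tau%:E (M : set 'rV[R]_D) ->
  @dist_class R D d +oo tau%:E fmin fmax two_level_law.
Proof.
move=> afmin fmin0 bfmax Mpos Mmfd.
have Mcl : closed (M : set 'rV[R]_D) by case: Mmfd => _ _ [].
have supp : msupport two_level_law = M.
  by apply: two_level_support => //; rewrite afmin.
rewrite /dist_class /= supp; split => //.
exists (fun x => a%:num + b%:num * \1_C x)%R; split; first exact: two_level_density.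
move=> x _; rewrite afmin indicE; case: (_ \in _); rewrite ?mulr1 ?mulr0.
  by rewrite bfmax andbT lerDl.
by rewrite addr0 lexx/= (le_trans _ bfmax)// lerDl.
Qed.

End two_level_law.

(** * Le Cam's two point bound for boundary estimation *)

Section domination.
Context {R : realType}.
Local Open Scope ereal_scope.

Lemma ge0_scaled_measure_integral d (T : measurableType d)
    (m1 m2 : {measure set T -> \bar R}) (a : {nonneg R}) (f : T -> \bar R) :
  (forall A, measurable A -> a%:num%:E * m1 A <= m2 A) ->
  (forall x, 0 <= f x) -> measurable_fun setT f ->
  a%:num%:E * \int[m1]_x f x <= \int[m2]_x f x.
Proof.
move=> m12 f0 mf; rewrite -ge0_integral_mscale//.
by apply: ge0_le_measure_integral.
Qed.

Context d (T : measurableType d).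

(** By induction on the sample size, integrating over the first observation. *)
Lemma iid_law_ge (P Q : probability T R) (a : {nonneg R}) n :
  (forall A, measurable A -> a%:num%:E * Q A <= P A) ->
  forall A, measurable A -> (a%:num ^+ n)%:E * iid_law Q n A <= iid_law P n A.
Proof.
move=> QP; elim: n => [|n IH] A mA; first by rewrite expr0 mul1e.
have mA' : measurable (@tcons d T n @^-1` A).
  by rewrite -[X in measurable X]setTI; exact: measurable_tcons.
pose f x := iid_law Q n (xsection (@tcons d T n @^-1` A) x).
pose g x := iid_law P n (xsection (@tcons d T n @^-1` A) x).
have mf : measurable_fun setT f by exact: measurable_fun_xsection.
have mg : measurable_fun setT g by exact: measurable_fun_xsection.
have a0 : (0 <= a%:num ^+ n)%R by rewrite exprn_ge0.
apply: (@le_trans _ _ (a%:num%:E * \int[Q]_x ((a%:num ^+ n)%:E * f x))).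
  rewrite ge0_integralZl_EFin// muleA -EFinM -exprS.
  by rewrite le_eqVlt; apply/orP; left; apply/eqP.
apply: (@le_trans _ _ (a%:num%:E * \int[Q]_x g x)).
  rewrite lee_wpmul2l ?lee_fin//; apply: ge0_le_integral => //.
  - by move=> x _; rewrite mule_ge0 ?lee_fin.
  - exact: measurable_funeM.
  - by move=> x _; apply: IH; exact: measurable_xsection.
exact: ge0_scaled_measure_integral.
Qed.

(** Le Cam's two point bound, the common part of the two laws being given as
   [a] times a law [Q]. *)
Lemma two_point_bound (P0 P1 Q : probability T R) (a : {nonneg R}) n (sep : R)
    (f0 f1 : n.-tuple T -> \bar R) :
  (forall A, measurable A -> a%:num%:E * Q A <= P0 A) ->
  (forall A, measurable A -> a%:num%:E * Q A <= P1 A) ->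
  measurable_fun setT f0 -> measurable_fun setT f1 ->
  (forall s, 0 <= f0 s) -> (forall s, 0 <= f1 s) ->
  (0 <= sep)%R -> (forall s, sep%:E <= f0 s + f1 s) ->
  (a%:num ^+ n * sep)%:E <= \int[iid_law P0 n]_s f0 s + \int[iid_law P1 n]_s f1 s.
Proof.
move=> QP0 QP1 mf0 mf1 f00 f10 sep0 sep01.
have an0 : (0 <= a%:num ^+ n)%R by rewrite exprn_ge0.
pose b : {nonneg R} := NngNum an0.
have h0 := @ge0_scaled_measure_integral _ _ (iid_law Q n) (iid_law P0 n) b f0
  (@iid_law_ge _ _ _ n QP0) f00 mf0.
have h1 := @ge0_scaled_measure_integral _ _ (iid_law Q n) (iid_law P1 n) b f1
  (@iid_law_ge _ _ _ n QP1) f10 mf1.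
apply: (le_trans _ (leeD h0 h1)).
rewrite -ge0_muleDr ?integral_ge0// -ge0_integralD//.
rewrite EFinM lee_wpmul2l ?lee_fin//.
apply: (@le_trans _ _ (\int[iid_law Q n]_s sep%:E)).
  rewrite integral_cst// [X in _ * X](_ : _ = 1) ?mule1//.
  exact: (probability_setT (iid_law Q n)).
apply: ge0_le_integral => //.
exact: emeasurable_funD.
Qed.

End domination.

Section hausdorff_separation.
Context {R : realType} {D : nat}.
Local Notation E := 'rV[R]_D.
Local Open Scope ereal_scope.

Lemma dist_to_ge0 (x : E) S : 0 <= dist_to x S.
Proof. by apply: le_ereal_inf_tmp => _ [y _ <-]; rewrite lee_fin enorm_ge0. Qed.

Lemma hausdorff_dist_ge0 (S S' : set E) : S !=set0 -> 0 <= hausdorff_dist S S'.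
Proof.
move=> [x Sx]; rewrite /hausdorff_dist le_max; apply/orP; left.
apply: (le_trans (dist_to_ge0 x S')); apply: ereal_sup_ubound; exact: imageP.
Qed.

(** Triangle inequality through the points of [B], with [x] far from [K0]. *)
Lemma hausdorff_dist_separated (K0 K1 B : set E) x (sep : R) : K0 !=set0 -> K1 x ->
  (forall y, K0 y -> (sep <= enorm (x - y))%R) ->
  sep%:E <= hausdorff_dist K0 B + hausdorff_dist K1 B.
Proof.
move=> K00 K1x xsep.
have h0 := hausdorff_dist_ge0 B K00.
have h1 : 0 <= hausdorff_dist K1 B by apply: hausdorff_dist_ge0; exists x.
have [->|fin] := eqVneq (hausdorff_dist K0 B) +oo.
  by rewrite addye ?leey// -ltNye (lt_le_trans _ h1).
have hfin : hausdorff_dist K0 B \is a fin_num.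
  by rewrite ge0_fin_numE// lt_neqAle fin leey.
rewrite -leeBlDl//; apply: (@le_trans _ _ (dist_to x B)).
  apply: le_ereal_inf_tmp => _ [b Bb <-].
  rewrite leeBlDl// -leeBlDr//; apply: (@le_trans _ _ (dist_to b K0)).
    apply: le_ereal_inf_tmp => _ [y Ky <-].
    rewrite -EFinB lee_fin lerBlDl; apply: (le_trans (xsep _ Ky)).
    exact: ler_enorm_distD.
  rewrite /hausdorff_dist le_max; apply/orP; right.
  by apply: ereal_sup_ubound; exists b.
rewrite /hausdorff_dist le_max; apply/orP; left.
by apply: ereal_sup_ubound; exists x.
Qed.

End hausdorff_separation.

(** * The minimax lower bound *)

Lemma bernoulli (R : realType) (q : R) n : 0 <= q <= 1 -> 1 - q * n%:R <= (1 - q) ^+ n.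
Proof.
move=> /andP[q0 q1]; elim: n => [|n IH]; first by rewrite mulr0 subr0 expr0.
rewrite exprS; apply: le_trans (ler_wpM2l _ IH); last by rewrite subr_ge0.
have : 0 <= q * (q * n%:R) by rewrite !mulr_ge0.
rewrite -natr1; lra.
Qed.

Section lower_bound.
Context {R : realType} {D : nat} {k : nat}.
Local Notation E := 'rV[R]_D.
Local Notation d := k.+1.
Local Notation T := (borel_rV R D).
Local Notation c := (unit_ball_volume k.+1 / 2 ^+ k.+1 : R)%R.
Local Notation c1 := (c * (2 * d%:R) ^+ d).

(** The first two inequalities on [fmin] and [fmax] leave room for the two-level
   density: [c1 * (8 * r) ^ d] bounds the volume of the bodies from above, and
   [c * (r / (2 * d)) ^ d] that of the cube from below. The last one bounds by
   one half the mass on which the laws of the samples differ. *)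
Lemma minimax_lower (r rho eps tau fmin fmax : R) (n : nat) : (d <= D)%N -> (1 <= n)%N ->
  0 < r -> 0 < rho -> rho <= r / 2 -> 0 < eps -> eps <= rho ^+ 2 / (100 * r) ->
  tau <= r / 4 -> 0 < fmin -> fmin * (c1 * (8 * r) ^+ d) <= 1 ->
  (c * (r / (2 * d%:R)) ^+ d)^-1 <= fmax ->
  fmin * (c1 * (3 * 2 ^+ k * rho ^+ k.+2 / r)) * n%:R <= 1 / 2 ->
  ((eps / 4)%:E <= minimax_risk d n (@dist_class R D d +oo tau%:E fmin fmax))%E.
Proof.
move=> dD n1 r0 rho0 rhor eps0 epsr taur fmin0 fminM fmaxC small.
have epsr1 : `|eps| <= rho ^+ 2 / (100 * r) by rewrite gtr0_norm.
have epsr2 : `|- eps| <= rho ^+ 2 / (100 * r) by rewrite normrN gtr0_norm.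
pose M1 : set T := @body R D k dD r rho eps.
pose M2 : set T := @body R D k dD r rho (- eps).
pose C : set T := @core R D k r.
pose H := @hmeas R D k.
have mM1 : measurable M1 by apply: closed_measurable; exact: body_closed.
have mM2 : measurable M2 by apply: closed_measurable; exact: body_closed.
have mC : measurable C.
  apply: closed_measurable; apply: compact_closed; first exact: norm_hausdorff.
  exact: compact_flat_box.
have CM1 : C `<=` M1 by exact: (core_body dD r0 rho0 rhor epsr1).
have CM2 : C `<=` M2 by exact: (core_body dD r0 rho0 rhor epsr2).
have c0 : 0 < c by exact: c_gt0.
have r8 : 0 < 8 * r by rewrite mulr_gt0.
have HM1le : (H M1 <= (c1 * (8 * r) ^+ d)%:E)%E.
  have h := @hausdorff_box_le R D k dD (fun=> - (4 * r)) (fun=> 8 * r) (fun=> r8).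
  rewrite prodr_const card_ord in h; apply: le_trans h.
  apply: (@le_hausdorff_measure R D k).
  exact: (body_box r0 rho0 rhor epsr1).
have HM1fin : H M1 \is a fin_num.
  by rewrite ge0_fin_numE ?measure_ge0// (le_lt_trans HM1le)// ltry.
have HM21 : H M2 = H M1.
  have := @hausdorff_measure_isometry R D k (flip dD) M2 (flip_isometry dD) (flipK dD).
  by rewrite /M2 body_flip => h; exact: esym h.
have r2d : 0 < r / (2 * d%:R) by rewrite divr_gt0// mulr_gt0// ltr0n.
have HCge : ((c * (r / (2 * d%:R)) ^+ d)%:E <= H C)%E.
  exact: (hausdorff_cube_ge dD (fun=> - (r / (4 * d%:R))) r2d).
have HCM1 : (H C <= H M1)%E by apply: le_measure => //; rewrite inE.
have HCfin : H C \is a fin_num.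
  by rewrite ge0_fin_numE ?measure_ge0// (le_lt_trans HCM1)// -ge0_fin_numE ?measure_ge0.
pose hM := fine (H M1); pose hC := fine (H C).
have HM1E : H M1 = hM%:E by rewrite fineK.
have HCE : H C = hC%:E by rewrite fineK.
have hCM : hC <= hM by rewrite -lee_fin -HM1E -HCE.
have cr0 : 0 < c * (r / (2 * d%:R)) ^+ d by rewrite mulr_gt0// exprn_gt0.
have hCge : c * (r / (2 * d%:R)) ^+ d <= hC by rewrite -lee_fin -HCE.
have hC0 : 0 < hC by exact: lt_le_trans hCge.
have hMle : fmin * hM <= 1.
  by apply: le_trans fminM; rewrite ler_pM2l// -lee_fin -HM1E.
have b0 : 0 <= (1 - fmin * hM) / hC by rewrite divr_ge0 ?subr_ge0// ltW.
pose a : {nonneg R} := NngNum (ltW fmin0).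
pose b : {nonneg R} := NngNum b0.
have bC : b%:num * hC = 1 - fmin * hM by rewrite /b/= divfK// gt_eqF.
have bmax : fmin + b%:num <= fmax.
  apply: le_trans fmaxC; apply: (@le_trans _ _ hC^-1); last first.
    by rewrite lef_pV2 ?posrE.
  rewrite -[leRHS]mul1r ler_pdivlMr// mulrDl bC.
  have : fmin * hC <= fmin * hM by rewrite ler_pM2l.
  lra.
have tot1 : two_level (k := k) mM1 mC a b setT = 1%E.
  apply: (etrans (two_levelE (k := k) mM1 mC a b setT)).
  rewrite !setTI -/H HM1E HCE -!EFinM -EFinD bC /=.
  by congr EFin; ring.
have tot2 : two_level (k := k) mM2 mC a b setT = 1%E.
  apply: (etrans (two_levelE (k := k) mM2 mC a b setT)).
  rewrite !setTI -/H HM21 HM1E HCE -!EFinM -EFinD bC /=.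
  by congr EFin; ring.
have Mpos e x U : `|e| <= rho ^+ 2 / (100 * r) -> @body R D k dD r rho e x ->
    open_nbhs (x : E) U -> (0 < H (U `&` @body R D k dD r rho e))%E.
  move=> er bx Ux; have [lo [s [s0 sub]]] := body_cube r0 rho0 rhor er bx Ux.
  apply: (@lt_le_trans _ _ (c * s ^+ d)%:E).
    by rewrite lte_fin mulr_gt0// exprn_gt0.
  apply: (le_trans (hausdorff_cube_ge dD lo s0)).
  exact: (@le_hausdorff_measure R D k).
pose P1 := two_level_law (k := k) mM1 mC a b; pose P2 := two_level_law (k := k) mM2 mC a b.
have P1class : @dist_class R D d +oo tau%:E fmin fmax P1.
  apply: (@two_level_class R D k M1 C mM1 mC a b CM1 tot1) => //.
  - by move=> x U Mx Ux; exact: (Mpos eps x U).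
  - exact: (body_manifold dD r0 rho0 rhor epsr1).
have P2class : @dist_class R D d +oo tau%:E fmin fmax P2.
  apply: (@two_level_class R D k M2 C mM2 mC a b CM2 tot2) => //.
  - by move=> x U Mx Ux; exact: (Mpos (- eps) x U).
  - exact: (body_manifold dD r0 rho0 rhor epsr2).
have supp1 : msupport P1 = M1.
  apply: (@two_level_support R D k M1 C mM1 mC a b CM1 tot1) => //.
    exact: body_closed.
  by move=> x U Mx Ux; exact: (Mpos eps x U).
have supp2 : msupport P2 = M2.
  apply: (@two_level_support R D k M2 C mM2 mC a b CM2 tot2) => //.
    exact: body_closed.
  by move=> x U Mx Ux; exact: (Mpos (- eps) x U).
(* both densities are [fmin] on the intersection, raised by [b] on the cube *)
have mI : measurable (M1 `&` M2) by exact: measurableI.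
have CI : C `<=` M1 `&` M2 by move=> x Cx; split; [exact: CM1|exact: CM2].
pose N := two_level (k := k) mI mC a b; pose Q := two_level_law (k := k) mI mC a b.
have HDle : (H (M1 `\` M2) <= (c1 * (3 * 2 ^+ k * rho ^+ k.+2 / r))%:E)%E.
  have gs0 i : 0 < @gap_side R D k r rho i.
    rewrite /gap_side; case: ifP => _; first by rewrite mulr_gt0.
    by rewrite divr_gt0// mulr_gt0// exprn_gt0.
  have h := @hausdorff_box_le R D k dD (@gap_corner R D k r rho) _ gs0.
  rewrite (gap_volume dD r0) in h; apply: le_trans h.
  apply: (@le_hausdorff_measure R D k).
  exact: (body_gap r0 rho0 rhor eps0 epsr).
have HDfin : H (M1 `\` M2) \is a fin_num.
  by rewrite ge0_fin_numE ?measure_ge0// (le_lt_trans HDle)// ltry.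
have HIfin : H (M1 `&` M2) \is a fin_num.
  rewrite ge0_fin_numE ?measure_ge0//.
  rewrite (le_lt_trans (@le_hausdorff_measure R D k _ _ (@subIsetl _ M1 M2)))//.
  by rewrite -/H -ge0_fin_numE ?measure_ge0.
pose q := fmin * fine (H (M1 `\` M2)).
have q0 : 0 <= q by rewrite mulr_ge0 ?(ltW fmin0)// fine_ge0.
have qn : q * n%:R <= 1 / 2.
  apply: le_trans small; rewrite ler_wpM2r// ler_pM2l// -lee_fin fineK//.
have hMI : hM = fine (H (M1 `\` M2)) + fine (H (M1 `&` M2)).
  rewrite /hM -fineD//; congr fine.
  exact: (measureDI H).
have hDM : fine (H (M1 `\` M2)) <= hM.
  by rewrite hMI lerDl fine_ge0.
have q1 : q <= 1 by apply: le_trans hMle; rewrite ler_pM2l.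
have Ntot : N setT = (1 - q)%:E.
  rewrite /N two_levelE !setTI -/H HCE -(fineK HIfin) -!EFinM -EFinD bC /=.
  by congr EFin; rewrite /q hMI; ring.
have q12 : q <= 1 / 2.
  by apply: le_trans qn; rewrite ler_peMr// ler1n.
have QN A : ((1 - q)%:E * Q A = N A)%E.
  have h1 : N setT \is a fin_num by rewrite Ntot.
  have h2 : (0 < N setT)%E 
    by rewrite Ntot lte_fin subr_gt0 (le_lt_trans q12)// ltr_pdivrMr// mul1r ltr1n.
  by rewrite -Ntot; exact: esym (two_level_lawE A h1 h2).
have Nle (M : set T) (mM : measurable M) A : measurable A -> M1 `&` M2 `<=` M ->
    (N A <= two_level (k := k) mM mC a b A)%E.
  move=> mA IM; rewrite /N !two_levelE leeD2r// lee_wpmul2l ?lee_fin//.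
  by apply: (@le_hausdorff_measure R D k) => x [Ax Ix]; split => //; exact: IM.
have Q1 A : measurable A -> ((1 - q)%:E * Q A <= P1 A)%E.
  move=> mA; rewrite QN (two_level_law1 tot1); apply: Nle => //.
have Q2 A : measurable A -> ((1 - q)%:E * Q A <= P2 A)%E.
  move=> mA; rewrite QN (two_level_law1 tot2); apply: Nle => //.
have q10 : 0 <= 1 - q by rewrite subr_ge0.
pose a' : {nonneg R} := NngNum q10.
apply: le_ereal_inf_tmp => _ [B [Bcpt Bmeas] <-].
set S := ereal_sup _.
have risk1 : (boundary_risk d P1 B <= S)%E by apply: ereal_sup_ubound; exists P1.
have risk2 : (boundary_risk d P2 B <= S)%E by apply: ereal_sup_ubound; exists P2.
have bd1 : mboundary d (msupport P1) = @rim R D k dD r rho eps.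
  by rewrite supp1; exact: body_mboundary.
have bd2 : mboundary d (msupport P2) = @rim R D k dD r rho (- eps).
  by rewrite supp2; exact: body_mboundary.
have rim2 : (@rim R D k dD r rho (- eps)) (@tip R D k dD r eps) by exact: tip_rim.
have rim1 : (@rim R D k dD r rho eps) !=set0.
  exists (flip dD (@tip R D k dD r eps)); have [ft lt] := rim2.
  split; first exact: flat_flip.
  have h := @level_flip R D k dD rho (- eps) (@tip R D k dD r eps).
  by rewrite opprK in h; rewrite h.
have rim20 : (@rim R D k dD r rho (- eps)) !=set0 by eexists; exact: rim2.
have := @two_point_bound R _ T P1 P2 Q a' n eps
  (fun s => hausdorff_dist (@rim R D k dD r rho eps) (B s))
  (fun s => hausdorff_dist (@rim R D k dD r rho (- eps)) (B s)) Q1 Q2.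
move=> /(_ (Bmeas _ (@rim_compact R D k dD r rho eps r0 rho0 rhor epsr1) rim1)).
move=> /(_ (Bmeas _ (@rim_compact R D k dD r rho (- eps) r0 rho0 rhor epsr2) rim20)).
move=> /(_ (fun s => hausdorff_dist_ge0 (B s) rim1)).
move=> /(_ (fun s => hausdorff_dist_ge0 (B s) rim20) (ltW eps0)).
have sep s : (eps%:E <= hausdorff_dist (@rim R D k dD r rho eps) (B s) +
    hausdorff_dist (@rim R D k dD r rho (- eps)) (B s))%E.
  apply: (hausdorff_dist_separated _ rim1 rim2) => y ry.
  exact: tip_far ry.
move=> /(_ sep); rewrite -bd1 -bd2 => bound.
have {}bound := le_trans bound (leeD risk1 risk2).
have half : eps / 2 <= a'%:num ^+ n * eps.
  rewrite mulrC ler_pM2r//.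
  have := @bernoulli R q n; rewrite q0 q1 => /(_ isT) /=.
  by apply: le_trans; move: qn; move: (q * _) => y; clear; lra.
have {}bound : ((eps / 2)%:E <= S + S)%E by apply: le_trans bound; rewrite lee_fin.
move: S bound {risk1 risk2} => [s| |] bound.
- rewrite lee_fin; move: bound; rewrite -EFinD lee_fin.
  by clear; move: eps => e; lra.
- exact: leey.
- by move: bound; rewrite leeNy_eq.
Qed.

End lower_bound.

Theorem theorem3p13 (R : realType) (d : nat) (d_ge1 : (1 <= d)%N) :
  exists c c' C : R, [/\ 0 < c, 0 < c' & 0 < C] /\
  forall D : nat, (d <= D)%N ->
  forall tau fmin fmax : R,
    0 < tau -> 0 < fmin -> fmin <= fmax ->
    fmin <= c / tau ^+ d -> c' / tau ^+ d <= fmax ->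
  forall n : nat, (1 <= n)%N ->
  ((C * tau *
     Num.min 1 ((1 / (fmin * tau ^+ d * n%:R)) `^ (2 / (d.+1)%:R)))%:E
   <= minimax_risk d n (@dist_class R D d +oo tau%:E fmin fmax))%E.
Proof.
case: d d_ge1 => // k _.
pose c0 : R := unit_ball_volume k.+1 / 2 ^+ k.+1.
have c0_gt0 : 0 < c0 by exact: c_gt0.
pose c1 := c0 * (2 * k.+1%:R) ^+ k.+1.
have c1_gt0 : 0 < c1 by rewrite mulr_gt0// exprn_gt0// mulr_gt0// ltr0n.
pose c2 := c1 * (3 * 2 ^+ k * 4 ^+ k.+1).
have c2_gt0 : 0 < c2 by rewrite mulr_gt0// mulr_gt0 ?exprn_gt0// mulr_gt0 ?exprn_gt0.
(* the bumps have width [rho = w * r], with [w <= w0]: then [n] draws see the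
   difference of the bodies with probability at most [c2 * w0 <= 1 / 2] *)
pose w0 := Num.min (1 / 2) (1 / (2 * c2)).
have w0_gt0 : 0 < w0 by rewrite lt_min !divr_gt0// mulr_gt0.
have w0_half : w0 <= 1 / 2 by rewrite ge_min lexx.
have w0c2 : c2 * w0 <= 1 / 2.
  apply: (@le_trans _ _ (c2 * (1 / (2 * c2)))); last first.
    by rewrite le_eqVlt; apply/orP; left; apply/eqP; field; rewrite gt_eqF.
  by rewrite ler_pM2l// ge_min lexx orbT.
have d_gt0 : 0 < k.+1%:R :> R by rewrite ltr0n.
exists (1 / (c1 * 32 ^+ k.+1)), (1 / (c0 * (2 / k.+1%:R) ^+ k.+1)), (w0 ^+ 2 / 100).
split; first split.
- by rewrite divr_gt0// mulr_gt0// exprn_gt0.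
- by rewrite divr_gt0// mulr_gt0// exprn_gt0// divr_gt0.
- by rewrite divr_gt0// exprn_gt0.
move=> D dD tau fmin fmax tau0 fmin0 _ fminc fmaxc n n1.
have td0 : 0 < tau ^+ k.+1 by rewrite exprn_gt0.
have n0 : 0 < n%:R :> R by rewrite ltr0n.
pose u := 1 / (fmin * tau ^+ k.+1 * n%:R).
have u0 : 0 < u by rewrite divr_gt0// mulr_gt0// mulr_gt0.
(* the width [w0 * min 1 p] balances [n] and the volume of the cap *)
pose p := u `^ (1 / k.+2%:R).
have p0 : 0 < p by rewrite powR_gt0.
have pu : p ^+ k.+2 = u.
  by rewrite -powR_mulrn ?(ltW p0)// /p -powRrM divfK ?pnatr_eq0// powRr1// ltW.
have p2 : u `^ (2 / k.+2%:R) = p ^+ 2.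
  by rewrite -powR_mulrn ?(ltW p0)// /p -powRrM; congr (_ `^ _); rewrite mul1r mulrC.
rewrite -/u p2; pose m := Num.min 1 p.
have m0 : 0 < m by rewrite lt_min ltr01.
have m1 : m <= 1 by rewrite ge_min lexx.
have mp : m <= p by rewrite ge_min lexx orbT.
have -> : Num.min 1 (p ^+ 2) = m ^+ 2.
  rewrite /m; have [p1|p1] := leP 1 p.
    by rewrite min_l ?expr1n// exprn_ege1.
  by rewrite min_r// exprn_ile1 ?ltW.
pose w := w0 * m; have w_gt0 : 0 < w by rewrite mulr_gt0.
have w_half : w <= 1 / 2 by apply: le_trans w0_half; rewrite ger_pMr.
pose r := 4 * tau; have r0 : 0 < r by rewrite mulr_gt0.
pose rho := w * r; have rho0 : 0 < rho by rewrite mulr_gt0.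
pose eps := rho ^+ 2 / (100 * r).
have eps0 : 0 < eps by rewrite divr_gt0 ?exprn_gt0// mulr_gt0.
have epsE : w0 ^+ 2 / 100 * tau * m ^+ 2 = eps / 4.
  by rewrite /eps /rho /r /w; field; rewrite gt_eqF.
rewrite epsE; apply: (@minimax_lower R D k r rho) => //.
- by rewrite /rho mulrC ler_pM2l//; move: w_half; rewrite mul1r.
- by rewrite /r mulrC mulKf// pnatr_eq0.
- apply: (@le_trans _ _ (1 / (c1 * 32 ^+ k.+1) / tau ^+ k.+1 * (c1 * (8 * r) ^+ k.+1))).
    by rewrite ler_wpM2r// mulr_ge0 ?(ltW c1_gt0)// exprn_ge0// mulr_ge0// ltW.
  have -> : 8 * r = 32 * tau by rewrite /r mulrA -natrM.
  rewrite exprMn le_eqVlt; apply/orP; left; apply/eqP.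
  have : 0 < (32 : R) ^+ k.+1 by rewrite exprn_gt0.
  move: ((32 : R) ^+ _) (tau ^+ _) td0 => A B B0 A0.
  by field; rewrite !gt_eqF.
- apply: le_trans fmaxc; rewrite le_eqVlt; apply/orP; left; apply/eqP.
  have -> : r / (2 * k.+1%:R) = 2 / k.+1%:R * tau by rewrite /r; field.
  rewrite exprMn -/c0.
  have : 0 < (2 / k.+1%:R : R) ^+ k.+1 by rewrite exprn_gt0// divr_gt0.
  move: (_ ^+ _) (tau ^+ _) td0 => A B B0 A0.
  by field; rewrite !gt_eqF.
rewrite -/c0 -/c1.
have -> : fmin * (c1 * (3 * 2 ^+ k * rho ^+ k.+2 / r)) * n%:R =
    c2 * w ^+ k.+2 * (fmin * tau ^+ k.+1 * n%:R).
  have rE : rho ^+ k.+2 / r = w ^+ k.+2 * (4 ^+ k.+1 * tau ^+ k.+1).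
    have -> : rho ^+ k.+2 = w ^+ k.+2 * (r * r ^+ k.+1) by rewrite -exprS -exprMn.
    have -> : 4 ^+ k.+1 * tau ^+ k.+1 = r ^+ k.+1 by rewrite -exprMn.
    by move: (r ^+ _) (w ^+ _) => A B; field; rewrite gt_eqF.
  by rewrite -(mulrA _ _ r^-1) rE /c2; ring.
have wk : w ^+ k.+2 <= w0 * u.
  rewrite exprMn ler_pM ?exprn_ge0 ?(ltW w0_gt0) ?(ltW m0)//.
    rewrite exprS ler_piMr ?(ltW w0_gt0)// exprn_ile1 ?(ltW w0_gt0)//.
    by apply: (le_trans w0_half); lra.
  by rewrite -pu lerXn2r ?nnegrE ?(ltW p0) ?(ltW m0).
apply: le_trans w0c2.
have N0 : 0 < fmin * tau ^+ k.+1 * n%:R by rewrite mulr_gt0// mulr_gt0.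
apply: (@le_trans _ _ (c2 * (w0 * u) * (fmin * tau ^+ k.+1 * n%:R))).
  by rewrite ler_pM2r// ler_pM2l.
have uN : u * (fmin * tau ^+ k.+1 * n%:R) = 1 by rewrite /u mul1r mulVf// gt_eqF.
by rewrite -mulrA -(mulrA w0) uN mulr1.
Qed.
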